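(* Let $\Omega\subset\mathbb R^N$ be an open domain, $a\in\Omega$, $T>0$, $\alpha>-1$ and $1<q<q_{\alpha,N}:=1+\frac{2(1+\alpha)}{N}$. Let $u\in C^1(Q_T^\Omega)\cap C\big((\Omega\times[0,T])\setminus\{(a,0)\}\big)$, where $Q_T^\Omega=\Omega\times(0,T)$, be a positive solution of $$\partial_tu-\Delta u+t^\alpha|u|^{q-1}u=0\quad\text{in }Q_T^\Omega$$ such that $u(x,0)=0$ for all $x\in\Omega\setminus\{a\}$. Then (i) either there exists $k\ge0$ such that $u(\cdot,0)=k\delta_a$ and $$u(x,t)\sim kE(x-a,t)\qquad\text{as }(x,t)\to(a,0);$$ (ii) or $$u(x,t)\sim v_\alpha(x-a,t)\qquad\text{as }(x,t)\to(a,0).$$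
   Context: $E(x,t)=(4\pi t)^{-N/2}e^{-|x|^2/(4t)}$ is the heat kernel. $v_\alpha$ is the very singular solution: $v_\alpha(x,t)=t^{-\frac{1+\alpha}{q-1}}V_\alpha(x/\sqrt t)$, where $V_\alpha$ is the unique positive $C^2$ function on $\mathbb R^N$ satisfying $-\Delta V-\frac12\eta\cdot\nabla V-\frac{1+\alpha}{q-1}V+V^q=0$ in $\mathbb R^N$ and $\lim_{|\eta|\to\infty}|\eta|^{\frac{2(1+\alpha)}{q-1}}V(\eta)=0$ (it exists for $1<q<q_{\alpha,N}$). $u(\cdot,0)=k\delta_a$ means $\lim_{t\to0}\int_\Omega u(x,t)\zeta(x)\,dx=k\zeta(a)$ for all $\zeta\in C_c(\Omega)$. The asymptotics are taken with $t>0$: $u\sim v_\alpha(\cdot-a,\cdot)$ means that the quotient tends to $1$; $u\sim kE(\cdot-a,\cdot)$ means $u(x,t)/E(x-a,t)\to k$ (which also covers $k=0$). *)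

(* Defs.v *)
(* Points of R^N are row vectors 'rV[R]_N, whose library topology is the usual
   one; space-time points are pairs (x, t) : 'rV[R]_N * R. *)
From HB Require Import structures.
From mathcomp Require Import all_boot all_order all_algebra.
From mathcomp Require Import all_classical all_reals all_analysis.
Set Implicit Arguments.
Unset Strict Implicit.
Unset Printing Implicit Defensive.
Import Order.TTheory GRing.Theory Num.Theory.
Import numFieldNormedType.Exports.
Local Open Scope classical_set_scope.
Local Open Scope ring_scope.

(* The library norm `|x| on 'rV[R]_N is the sup norm; this is the Euclidean
   one. *)
Definition enorm (R : realType) (N : nat) (x : 'rV[R]_N) : R :=
  Num.sqrt (\sum_(i < N) x 0 i ^+ 2).

(* The filter |eta| -> +oo. *)
Definition nbhs_infty (R : realType) (N : nat) : set_system 'rV[R]_N :=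
  filter_from [set: R] (fun M => [set eta | M < enorm eta]).

Global Instance nbhs_infty_filter (R : realType) (N : nat) :
  Filter (@nbhs_infty R N).
Proof.
apply: filter_from_filter; first by exists 0.
move=> M1 M2 _ _; exists (Num.max M1 M2) => // eta /=.
by rewrite gt_max => /andP[].
Qed.

(* N-dimensional Lebesgue measure, built as an iterated product of the
   one-dimensional one and carried by the measurable type of N-tuples (the
   library puts no sigma-algebra on 'rV[R]_N). *)
Definition cons_pair (R : realType) (n : nat)
    (p : measurableTypeR R * n.-tuple (measurableTypeR R)) :
  n.+1.-tuple (measurableTypeR R) := [tuple of p.1 :: p.2].

Lemma measurable_cons_pair (R : realType) (n : nat) :
  measurable_fun [set: _] (@cons_pair R n).
Proof. exact: measurable_cons. Qed.

Section pushforward_cons.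
Context (R : realType) (n : nat).
Variable m : {sigma_finite_measure set (n.-tuple (measurableTypeR R)) -> \bar R}.

Definition lebesgue_cons : set (n.+1.-tuple (measurableTypeR R)) -> \bar R :=
  pushforward (@lebesgue_measure R \x m)%E (@cons_pair R n).

Let lebesgue_cons0 : lebesgue_cons set0 = 0%E.
Proof. by rewrite /lebesgue_cons /pushforward preimage_set0 measure0. Qed.

Let lebesgue_cons_ge0 A : (0 <= lebesgue_cons A)%E.
Proof. by rewrite /lebesgue_cons /pushforward measure_ge0. Qed.

Let lebesgue_cons_sigma_additive : semi_sigma_additive lebesgue_cons.
Proof.
move=> F mF tF mUF; rewrite /lebesgue_cons /pushforward preimage_bigcup.
apply: measure_semi_sigma_additive.
- by move=> i; rewrite -[X in measurable X]setTI; exact: measurable_cons_pair.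
- apply/trivIsetP => /= i j _ _ ij; rewrite -preimage_setI.
  by move/trivIsetP : tF => /(_ i j Logic.I Logic.I ij) ->; rewrite preimage_set0.
- by rewrite -preimage_bigcup -[X in measurable X]setTI;
    exact: measurable_cons_pair.
Qed.

HB.instance Definition _ := isMeasure.Build _ _ _ lebesgue_cons
  lebesgue_cons0 lebesgue_cons_ge0 lebesgue_cons_sigma_additive.

Let lebesgue_cons_sigma_finite : sigma_finite setT lebesgue_cons.
Proof.
have [F FT mF] : sigma_finite setT (@lebesgue_measure R \x m)%E.
  have /sigma_finiteP[F [TF ndF Foo]] := sigma_finiteT (@lebesgue_measure R).
  have /sigma_finiteP[G [TG ndG Goo]] := sigma_finiteT m.
  exists (fun i => F i `*` G i).
    rewrite -setXTT TF TG predeqE => -[x y]; split=> /=.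
      move=> [[i _ Fix] [j _ Gjy]]; exists (maxn i j) => //; split.
      - by move: x Fix; exact/subsetPset/ndF/leq_maxl.
      - by move: y Gjy; exact/subsetPset/ndG/leq_maxr.
    by move=> [i _ []/= ? ?]; split; exists i.
  move=> k; have [? ?] := Foo k; have [? ?] := Goo k.
  split; first exact: measurableX.
  by rewrite product_measure1E// lte_mul_pinfty// ge0_fin_numE.
pose g (y : n.+1.-tuple (measurableTypeR R)) :
  measurableTypeR R * n.-tuple (measurableTypeR R) :=
  (tnth y ord0, [tuple of behead y]).
have mg : measurable_fun setT g.
  apply/measurable_fun_pair; first exact: measurable_tnth.
  exact: measurable_behead.
have gK p : g (cons_pair p) = p.
  by case: p => a b; rewrite /g /cons_pair /=; congr (_, _); exact: val_inj.
exists (fun i => g @^-1` F i); first by rewrite -preimage_bigcup -FT preimage_setT.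
move=> i; have [mFi Fioo] := mF i; split.
  by rewrite -[X in measurable X]setTI; exact: mg.
rewrite /lebesgue_cons /pushforward -comp_preimage.
by rewrite (_ : g \o _ = id) // funeqE => p /=; rewrite gK.
Qed.

HB.instance Definition _ := Measure_isSigmaFinite.Build _ _ _ lebesgue_cons
  lebesgue_cons_sigma_finite.

End pushforward_cons.

Fixpoint lebesgueN (R : realType) (N : nat) :
    {sigma_finite_measure set (N.-tuple (measurableTypeR R)) -> \bar R} :=
  match N with
  | 0%N => dirac [tuple]
  | n.+1 => lebesgue_cons (lebesgueN R n)
  end.

Definition row_of_tuple (R : realType) (N : nat) (y : N.-tuple R) : 'rV[R]_N :=
  \row_(i < N) tnth y i.

Definition integral_on (R : realType) (N : nat) (Omega : set 'rV[R]_N)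
    (f : 'rV[R]_N -> R) : R :=
  \int[lebesgueN R N]_(y in @row_of_tuple R N @^-1` Omega) f (row_of_tuple y).

(* Meant for an open set D of a finite-dimensional V, where it is equivalent to
   the existence and continuity of the partial derivatives along a basis. *)
Definition C1_on (R : realType) (V : normedModType R) (D : set V) (f : V -> R) :=
  forall v : V, forall p : V, D p ->
    derivable f p v /\ {for p, continuous ('D_v f)}.

Definition C2_on (R : realType) (V : normedModType R) (D : set V) (f : V -> R) :=
  C1_on D f /\ forall v : V, C1_on D ('D_v f).

Definition ebasis (R : realType) (N : nat) (i : 'I_N) : 'rV[R]_N := delta_mx 0 i.

Definition laplacian (R : realType) (N : nat) (f : 'rV[R]_N -> R)
    (x : 'rV[R]_N) : R :=
  \sum_(i < N) 'D_(ebasis R i) ('D_(ebasis R i) f) x.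

(* The derivatives in [laplacian f x] exist; needed because 'D_v is total. *)
Definition has_laplacian (R : realType) (N : nat) (f : 'rV[R]_N -> R)
    (x : 'rV[R]_N) : Prop :=
  forall i : 'I_N, (\forall y \near x, derivable f y (ebasis R i)) /\
    derivable ('D_(ebasis R i) f) x (ebasis R i).

Definition heat_kernel (R : realType) (N : nat) (x : 'rV[R]_N) (t : R) : R :=
  (4 * pi * t) `^ (- (N%:R / 2)) * expR (- (enorm x ^+ 2 / (4 * t))).

Definition q_crit (R : realType) (N : nat) (alpha : R) : R :=
  1 + 2 * (1 + alpha) / N%:R.

Definition is_profile (R : realType) (N : nat) (alpha q : R)
    (V : 'rV[R]_N -> R) : Prop :=
  [/\ forall eta, 0 < V eta,
      C2_on [set: 'rV[R]_N] V,
      forall eta,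
        - laplacian V eta
        - 2^-1 * \sum_(i < N) eta 0 i * 'D_(ebasis R i) V eta
        - (1 + alpha) / (q - 1) * V eta + V eta `^ q = 0 &
      (fun eta => enorm eta `^ (2 * (1 + alpha) / (q - 1)) * V eta)
        @ @nbhs_infty R N --> (0 : R)].

Definition very_singular (R : realType) (N : nat) (alpha q : R)
    (V : 'rV[R]_N -> R) (x : 'rV[R]_N) (t : R) : R :=
  t `^ (- ((1 + alpha) / (q - 1))) * V ((Num.sqrt t)^-1 *: x).

(* Classical solution of d_t u - Delta u + t^alpha |u|^(q-1) u = 0 in Q; for u
   of class C^1, only the pure second derivatives in x are required to exist
   in addition. *)
Definition solves (R : realType) (N : nat) (alpha q : R)
    (Q : set ('rV[R]_N * R)) (u : 'rV[R]_N * R -> R) : Prop :=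
  forall (x : 'rV[R]_N) (t : R), Q (x, t) ->
    [/\ derivable (fun s : R => u (x, s)) t 1,
        has_laplacian (fun y => u (y, t)) x &
        derive1 (fun s : R => u (x, s)) t - laplacian (fun y => u (y, t)) x
        + t `^ alpha * (`|u (x, t)| `^ (q - 1) * u (x, t)) = 0].

(* C_c(Omega), its elements being extended by 0 to R^N. *)
Definition Cc (R : realType) (N : nat) (Omega : set 'rV[R]_N)
    (zeta : 'rV[R]_N -> R) : Prop :=
  let supp := closure [set x | zeta x != 0] in
  [/\ continuous zeta, compact supp & supp `<=` Omega].

(* u(., 0) = k delta_a. *)
Definition initial_dirac (R : realType) (N : nat) (Omega : set 'rV[R]_N)
    (u : 'rV[R]_N * R -> R) (k : R) (a : 'rV[R]_N) : Prop :=
  forall zeta : 'rV[R]_N -> R, Cc Omega zeta ->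
    (fun t : R => integral_on Omega (fun x => u (x, t) * zeta x))
      @ 0^'+ --> k * zeta a.

(* The filter (x, t) -> (a, 0) with t > 0. *)
Definition to_origin (R : realType) (N : nat) (a : 'rV[R]_N) :
    set_system ('rV[R]_N * R) :=
  within [set p | 0 < p.2] (nbhs (a, 0 : R)).

(* Main.v *)
(* Everything rests on the parabolic maximum principle, in a form that only uses
   symmetric second differences along the coordinate axes.  Put
   g = (1 + alpha) / (q - 1), so that q < q_crit means N / 2 < g.

   Barriers of the form t^-g exp(- (r - |x - y|^2)^2 / (32 r t)) on balls give
   u <= C t^-g, and then, because u vanishes initially away from a,
   u <= C t^-g exp(- |x - a|^2 / (128 t)).  The very singular solution v satisfies
   the same bound.  If two solutions f and v satisfy it and v >= c t^-g on every
   paraboloid |x - a|^2 <= R t, then limsup f / v <= 1: a constant K > 1 with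
   f <= K v can always be decreased, by convexity of the absorption term.

   Let R2 be large.  If t^(N/2) u is unbounded on |x - a|^2 <= R2 t, then at
   well-chosen points (x0, t0) an interior Lipschitz estimate makes u large on a
   ball of radius comparable to sqrt t0, and comparison with a damped difference of
   two heat kernels issued from there yields u >= c t^-g on paraboloids; the ratio
   bound then applies in both directions and u / v -> 1.  If t^(N/2) u is bounded
   there, let K be the infimum of the constants with u <= K E near a; the
   mechanism of the unbounded case, applied to K' E - u with K' close to K, shows
   that u also stays above (K - d) E, whence u / E -> K and the initial trace. *)
Require Import Defs.
From HB Require Import structures.
From mathcomp Require Import all_boot all_order all_algebra.
From mathcomp Require Import all_classical all_reals all_analysis.
From mathcomp Require Import measurable_realfun ring lra.
Set Implicit Arguments.
Unset Strict Implicit.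
Unset Printing Implicit Defensive.
Import Order.TTheory GRing.Theory Num.Theory.
Import numFieldNormedType.Exports.
Local Open Scope classical_set_scope.
Local Open Scope ring_scope.

(** The hypotheses give the second derivatives of [u] only pointwise, so every step is a comparison
    with an explicit function, without regularity theory, Harnack inequality or limits of rescaled
    solutions. Two difficulties recur. First, on the lateral boundary of a ball nothing is known
    beyond the Gaussian bound. Its value there, [gauss_edge], depends on time alone and is
    nondecreasing for small times, hence a supersolution that can be added freely; on the smaller
    ball |x|^2 <= c0 rho it is exponentially small against t^-g exp(- |x|^2 / (4 t)) and against E.
    Secondly, there is no datum to compare at t = 0: there the Gaussian bound is beaten by (e / t)
    times itself, which is still a supersolution away from a paraboloid |x|^2 <= R2 t. Inside
    paraboloids scaling decides: t^-g is the size at which absorption balances diffusion, t^-(N/2)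
    that of a point mass. As g > N/2, absorption is negligible near t = 0 for bounded masses, while
    unbounded ones are cut down to a multiple of t^-g that no longer depends on the mass. *)

(** * Second derivatives as limits of symmetric differences *)

Section second_differences.
Variable R : realType.
Implicit Types (g : R -> R) (L : R).

(** This weak second derivative is all that a maximum needs in order to give a sign, and it passes
    to sums, multiples and reflections. The quotient is even in h, so a one-sided filter is
    enough. *)
Definition sdiff g L :=
  (fun h => (g h + g (- h) - 2 * g 0) / h ^+ 2) @ 0^'+ --> L.

Lemma is_derive_near g (x L e : R) : is_derive x 1 g L -> 0 < e ->
  \forall h \near 0^', `|(g (x + h) - g x) / h - L| < e.
Proof.
move=> dg e0.
have [/cvg_ex[l gl] vL] := dg.
have lL : l = L.
  by rewrite -vL; apply/esym/cvg_lim.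
move: gl; rewrite lL => /cvgrPdist_lt/(_ e e0); apply: filterS => h /=.
by rewrite distrC [h *: 1]mulr1 /= [h^-1 *: _]mulrC (addrC x).
Qed.

(** Cauchy's mean value theorem, applied to the even part of [g] against s^2, turns the quotient
    into [(g1 s - g1 (- s)) / (2 * s)], the average of two difference quotients of [g1] at 0.
    Differentiability of [g1] at the single point 0 is thus sufficient. *)
Lemma sdiff_of_derive g (g1 : R -> R) L :
  (\forall s \near (0 : R), is_derive (s : R) 1 g (g1 s)) ->
  is_derive (0 : R) 1 g1 L -> sdiff g L.
Proof.
move=> dg dg1; apply/cvgrPdist_lt => e e0.
have /nbhs_ballP[r1 /= r1gt0 H1] := dg.
have /nbhs_ballP[r2 /= r2gt0 H2] := is_derive_near dg1 e0.
near=> h.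
have h0 : 0 < h by near: h; exact: nbhs_right_gt.
have hr1 : h < r1 by near: h; exact: nbhs_right_lt.
have hr2 : h < r2 by near: h; exact: nbhs_right_lt.
have D (s : R) : `|s| <= h -> is_derive s 1 g (g1 s).
  by move=> sh; apply: H1; rewrite /ball/= sub0r normrN; exact: le_lt_trans hr1.
pose K := g h + g (- h) - 2 * g 0.
(* [P] vanishes at 0 and at h, so its derivative vanishes in between. *)
pose P := fun s => (g s + g (- s) - 2 * g 0) * h ^+ 2 - K * s ^+ 2.
have dP (s : R) : s \in `[0, h] ->
    is_derive s 1 P ((g1 s - g1 (- s)) * h ^+ 2 - K * (2 * s)).
  rewrite in_itv/= => /andP[s0 sh].
  have d1 : is_derive s 1 g (g1 s) by apply: D; rewrite ger0_norm.
  have d2 : is_derive (- s) 1 g (g1 (- s)) by apply: D; rewrite normrN ger0_norm.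
  have d3 : is_derive s 1 (fun s => g (- s)) (g1 (- s) * (-1)).
    exact: is_derive1_comp.
  rewrite /P.
  apply: is_derive_eq; rewrite /GRing.scale/=. ring.
have dPo (s : R) : s \in `]0, h[ ->
    is_derive s 1 P ((g1 s - g1 (- s)) * h ^+ 2 - K * (2 * s)).
  by rewrite in_itv/= => /andP[/ltW a0 /ltW ah]; apply: dP; rewrite in_itv/= a0.
have cP : {within `[0, h], continuous P}.
  by apply: derivable_within_continuous => s /dP[].
have [s sI] := MVT h0 dPo cP.
move: sI; rewrite in_itv/= => /andP[s0 sh].
have -> : P h - P 0 = 0 by rewrite /P /K oppr0; ring.
rewrite subr0 => /esym/eqP; rewrite mulf_eq0 (gt_eqF h0) orbF subr_eq0 => /eqP E.
have -> : K / h ^+ 2 = (g1 s - g1 (- s)) / (2 * s).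
  have [hn0 sn0] : h != 0 /\ s != 0 by rewrite !gt_eqF.
  apply/eqP; rewrite eqr_div ?mulf_neq0 ?expf_neq0 ?pnatr_eq0//.
  by rewrite -E.
have B1 : `|(g1 (0 + s) - g1 0) / s - L| < e.
  apply: H2; last by rewrite gt_eqF.
  by rewrite /ball/= sub0r normrN gtr0_norm// (lt_trans sh).
have B2 : `|(g1 (0 + - s) - g1 0) / (- s) - L| < e.
  apply: H2; last by rewrite oppr_eq0 gt_eqF.
  by rewrite /ball/= sub0r opprK gtr0_norm// (lt_trans sh).
have -> : L - (g1 s - g1 (- s)) / (2 * s) =
   - (((g1 (0 + s) - g1 0) / s - L) + ((g1 (0 + - s) - g1 0) / (- s) - L)) / 2.
  by rewrite !add0r; field; rewrite gt_eqF.
rewrite normrM normrN (gtr0_norm (_ : 0 < 2^-1)) ?invr_gt0//.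
rewrite ltr_pdivrMr//; apply: (le_lt_trans (ler_normD _ _)); lra.
Unshelve. all: by end_near. Qed.

Lemma sdiffD g1 g2 L1 L2 : sdiff g1 L1 -> sdiff g2 L2 ->
  sdiff (fun s => g1 s + g2 s) (L1 + L2).
Proof.
move=> h1 h2; rewrite /sdiff.
apply: cvg_trans (cvgD h1 h2); apply: near_eq_cvg; apply: nearW => h /=.
by rewrite -[LHS]mulrDl; congr (_ / _); ring.
Qed.

Lemma sdiffZ k g L : sdiff g L -> sdiff (fun s => k * g s) (k * L).
Proof.
move=> h1; rewrite /sdiff.
apply: cvg_trans (cvgM (cvg_cst k) h1); apply: near_eq_cvg.
by apply: nearW => h /=; rewrite [LHS]mulrA; congr (_ / _); ring.
Qed.

Lemma sdiff_exp (p p1 : R -> R) L :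
  (forall s : R, is_derive s 1 p (p1 s)) -> is_derive (0 : R) 1 p1 L ->
  sdiff (fun s => expR (p s)) (expR (p 0) * (p1 0 ^+ 2 + L)).
Proof.
move=> dp dp1.
have de (s : R) : is_derive s 1 (fun s => expR (p s)) (p1 s * expR (p s)).
  by rewrite mulrC; exact: is_derive1_comp.
apply: (@sdiff_of_derive _ (fun s => p1 s * expR (p s))).
  exact: filterE de.
have := de 0; move=> d0.
apply: is_derive_eq; rewrite /GRing.scale/=; ring.
Qed.

End second_differences.

(** * The heat operator and the maximum principle *)

Section heat_operator.
Variables (R : realType) (N : nat).
Notation X := 'rV[R]_N.
Implicit Types (f g : X -> R -> R) (x y : X) (t : R).

Definition sd (f : X -> R) x i L := sdiff (fun h => f (x + h *: ebasis R i)) L.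

(* [heat f x t d]: the value of [f_t - Delta f] at [(x, t)] is [d]. *)
Definition heat f x t d := exists a L, [/\ is_derive t 1 (f x) a,
  forall i, sd (f ^~ t) x i (L i) & d = a - \sum_(i < N) L i].

Lemma heatD f g x t d1 d2 : heat f x t d1 -> heat g x t d2 ->
  heat (fun x t => f x t + g x t) x t (d1 + d2).
Proof.
move=> [a1 [L1 [h1 h2 ->]]] [a2 [L2 [h3 h4 ->]]].
exists (a1 + a2), (fun i => L1 i + L2 i); split.
- exact: is_deriveD.
- by move=> i; exact: (sdiffD (h2 i) (h4 i)).
- by rewrite big_split/=; ring.
Qed.

Lemma heatZ k f x t d : heat f x t d -> heat (fun x t => k * f x t) x t (k * d).
Proof.
move=> [a [L [h1 h2 ->]]]; exists (k * a), (fun i => k * L i); split.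
- exact: is_deriveZ.
- by move=> i; have H := sdiffZ (k := k) (h2 i); rewrite /sd; exact: H.
- by rewrite -mulr_sumr; ring.
Qed.

Lemma heatB f g x t d1 d2 : heat f x t d1 -> heat g x t d2 ->
  heat (fun x t => f x t - g x t) x t (d1 - d2).
Proof.
move=> h1 /(heatZ (-1)) h2; have := heatD h1 h2; rewrite !mulN1r.
by under eq_fun do under eq_fun do rewrite mulN1r.
Qed.

Lemma heat_time (m : R -> R) x t d : is_derive t 1 m d -> heat (fun _ => m) x t d.
Proof.
move=> dm; exists d, (fun _ => 0); split=> //; last by rewrite big1// subr0.
move=> i; apply: cvg_near_cst; apply: nearW => h /=.
by rewrite (_ : _ + _ - _ = 0) ?mul0r//; ring.
Qed.

Lemma heatM (m : R -> R) f x t dm d : is_derive t 1 m dm -> heat f x t d ->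
  heat (fun x t => m t * f x t) x t (dm * f x t + m t * d).
Proof.
move=> h1 [a [L [h2 h3 ->]]]; exists (dm * f x t + m t * a), (fun i => m t * L i); split.
- apply: is_derive_eq; rewrite /GRing.scale/=; ring.
- by move=> i; have H := sdiffZ (k := m t) (h3 i); rewrite /sd; exact: H.
- by rewrite -mulr_sumr; ring.
Qed.

(** Only earlier times are consulted, so the final time of a domain counts as interior: f_t >= 0
    comes from the backward quotient, and the second differences are <= 0 along each axis. *)
Lemma heat_touch f x t d : heat f x t d ->
  (forall i, \forall h \near 0, f (x + h *: ebasis R i) t <= f x t) ->
  (\forall h \near 0^'+, f x (t - h) <= f x t) -> 0 <= d.
Proof.
move=> [a [L [h1 h2 ->]]] h3 h4.
have a0 : 0 <= a.
  rewrite leNgt; apply/negP => a0.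
  have /= K := is_derive_near h1 (_ : 0 < - a).
  have {K} : \forall h \near 0^', `|(f x (t + h) - f x t) / h - a| < - a.
    by apply: K; rewrite oppr_gt0.
  move/nbhs_ballP => [r /= r0 H].
  have [h [h0 hr ht]] : exists h : R, [/\ 0 < h, h < r & f x (t - h) <= f x t].
    near ((0 : R)^'+) => h; exists h; split; near: h; [exact: nbhs_right_gt|exact: nbhs_right_lt|exact: h4].
  have := H (- h); rewrite /ball/= sub0r opprK gtr0_norm// oppr_eq0 gt_eqF// => /(_ hr isT).
  have : 0 <= (f x (t - h) - f x t) / - h.
    by rewrite invrN mulrN -mulNr divr_ge0 ?(ltW h0)// oppr_ge0 subr_le0.
  move=> k0; rewrite ltr_norml => /andP[_]; lra.
have L0 i : L i <= 0.
  rewrite -(cvg_lim (@norm_hausdorff _ _) (h2 i)); apply: limr_le; first exact: cvgP (h2 i).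
  near=> h.
  have h0 : 0 < h by near: h; exact: nbhs_right_gt.
  rewrite pmulr_lle0 ?invr_gt0 ?exprn_gt0//.
  have P1 : f (x + h *: ebasis R i) t <= f x t.
    by near: h; apply: cvg_within; exact: h3.
  have P2 : f (x + (- h) *: ebasis R i) t <= f x t.
    near: h; apply: cvg_within.
    have : (fun h : R => - h) @ 0 --> (0:R) by rewrite -[X in _ --> X]oppr0; apply: cvgN; exact: cvg_id.
    by move=> /(_ _ (h3 i)).
  by rewrite scale0r addr0; lra.
rewrite subr_ge0 (le_trans _ a0)//; exact: sumr_le0.
Unshelve. all: by end_near. Qed.


Definition n2 x := \sum_(i < N) x 0 i ^+ 2.

Lemma n2_ge0 x : 0 <= n2 x.
Proof. by apply: sumr_ge0 => i _; exact: sqr_ge0. Qed.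

Lemma n2_0 : n2 0 = 0.
Proof. by rewrite /n2 big1// => i _; rewrite mxE expr0n. Qed.

Lemma coord_le_n2 x i : x 0 i ^+ 2 <= n2 x.
Proof.
by rewrite /n2 (bigD1 i)//= lerDl sumr_ge0// => j _; exact: sqr_ge0.
Qed.

Lemma n2N x : n2 (- x) = n2 x.
Proof. by apply: eq_bigr => i _; rewrite mxE sqrrN. Qed.

Lemma n2_line x i h :
  n2 (x + h *: ebasis R i) = n2 x + 2 * x 0 i * h + h ^+ 2.
Proof.
rewrite /n2 !(bigD1 i (P := predT))//= !mxE !eqxx/= mulr1.
rewrite (eq_bigr (fun j => x 0 j ^+ 2)); first by ring.
by move=> j ji; rewrite !mxE eqxx/= (negbTE ji) mulr0 addr0.
Qed.

Lemma n2D_le x y : n2 (x + y) <= 2 * n2 x + 2 * n2 y.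
Proof.
rewrite /n2 !mulr_sumr -big_split/=; apply: ler_sum => i _; rewrite !mxE.
have := sqr_ge0 (x 0 i - y 0 i); nra.
Qed.

Lemma n2_continuous : continuous n2.
Proof.
rewrite /n2; elim: (index_enum _) => [|i r IH] x.
  by rewrite (_ : (fun _ => _) = fun=> 0); [exact: cst_continuous|apply/funext => y; rewrite big_nil].
rewrite (_ : (fun _ => _) = (fun y : X => y 0 i ^+ 2 + \sum_(j <- r) y 0 j ^+ 2)); last first.
  by apply/funext => y; rewrite big_cons.
have h1 : (fun y : X => y 0 i) @ nbhs x --> x 0 i by exact: coord_continuous.
exact: (cvgD (cvgM h1 h1) (IH x)).
Qed.

Lemma maxprin_compact (G : X -> R -> R) (B t1 : R) :
  continuous (fun p : X * R => G p.1 p.2) ->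
  (forall x t, G x t <= 0 -> t <= t1 -> n2 x <= B /\ 0 <= t) ->
  compact [set p : X * R | G p.1 p.2 <= 0 /\ p.2 <= t1].
Proof.
move=> cG GB.
have cK : compact ([set x : X | forall i, x 0 i \in `[- (B + 1), B + 1]] `*` `[0, t1]%classic).
  apply: compact_setX; last exact: segment_compact.
  apply: (@rV_compact _  _ (fun=> `[(- (B + 1)), (B + 1)]%classic)).
  by move=> _; apply: segment_compact.
apply: (subclosed_compact _ cK).
- apply: closedI.
    by apply: (@closed_comp _ _ (fun p : X * R => G p.1 p.2) [set y | y <= 0]); [move=> p _; exact: cG|exact: closed_le].
  apply: (@closed_comp _ _ (fun p : X * R => p.2) [set y | y <= t1]); last exact: closed_le.
  by move=> p _; exact: cvg_snd.
- move=> [x t] /= [Gx tt1]; have [xB t0] := GB _ _ Gx tt1; split => /=; last by rewrite in_itv/= t0.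
  move=> i; rewrite in_itv/=.
  have := coord_le_n2 x i; have := n2_ge0 x; nra.
Qed.

(** A domain is a sublevel set of [G] cut at time [t1], and its parabolic boundary is never named: a
    boundary comparison becomes the obligation that [0 < phi] forces [G < 0]. The sign of the heat
    operator is likewise asked only where [phi] is positive, which is where the absorption terms are
    ordered. A positive maximum would then contradict [heat_touch], [G < 0] ensuring that the
    neighbouring points belong to the domain. *)
Lemma maxprin (G phi : X -> R -> R) (B t1 : R) :
  continuous (fun p : X * R => G p.1 p.2) ->
  (forall x t, G x t <= 0 -> t <= t1 -> n2 x <= B /\ 0 <= t) ->
  (forall x t, G x t <= 0 -> t <= t1 ->
    {for (x, t), continuous (fun p : X * R => phi p.1 p.2)}) ->
  (forall x t, G x t <= 0 -> t <= t1 -> 0 < phi x t ->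
    G x t < 0 /\ exists2 d, heat phi x t d & d < 0) ->
  forall x t, G x t <= 0 -> t <= t1 -> phi x t <= 0.
Proof.
move=> cG GB cphi H x0 t0 G0 t01; rewrite leNgt; apply/negP => phi0.
pose K := [set p : X * R | G p.1 p.2 <= 0 /\ p.2 <= t1].
have [] := @compact_EVT_max _ _ (fun p : X * R => phi p.1 p.2) K.
- by exists (x0, t0).
- exact: maxprin_compact GB.
- apply: continuous_in_subspaceT => -[x t]; rewrite inE => -[/= Gx tt1]; exact: cphi.
move=> [x t]; rewrite inE => -[/= Gx tt1] Hmax.
have {}Hmax y s : G y s <= 0 -> s <= t1 -> phi y s <= phi x t.
  by move=> *; apply: (Hmax (y, s)); rewrite inE.
have px : 0 < phi x t by apply: (lt_le_trans phi0); exact: Hmax.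
have [Gx0 [d hd d0]] := H x t Gx tt1 px.
have nG : \forall p \near (x, t), G p.1 p.2 < 0.
  have := cG (x, t); move/cvgr_lt; apply; exact: Gx0.
suff : 0 <= d by rewrite leNgt d0.
apply: (heat_touch hd).
- move=> i.
  have : (fun h : R => (x + h *: ebasis R i, t)) @ 0 --> (x, t).
    have c1 : (fun h : R => x + h *: ebasis R i) @ 0 --> x; last first.
      exact: (cvg_pair c1 (cvg_cst t)).
    rewrite -[X in _ --> X]addr0; apply: cvgD; first exact: cvg_cst.
    rewrite -[X in _ --> X](scale0r (ebasis R i)); apply: cvgZl; exact: cvg_id.
  move=> cv; near=> h; apply: Hmax => //.
  by apply: ltW; near: h; exact: (cv _ nG).
- have : (fun h : R => (x, t - h)) @ 0^'+ --> (x, t).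
    have c1 : (fun h : R => t - h) @ 0^'+ --> t; last first.
      exact: (cvg_pair (cvg_cst x) c1).
    rewrite -[X in _ --> X]subr0; apply: cvgB; first exact: cvg_cst.
    exact: cvg_at_right_filter.
  move=> /(_ _ nG) nG'; near=> h; apply: Hmax; first by apply: ltW; near: h.
  have : 0 < h by near: h; exact: nbhs_right_gt.
  lra.
Unshelve. all: by end_near. Qed.

End heat_operator.

(** * Elementary calculus of powers and exponentials *)

Section real_lemmas.
Variable R : realType.
Implicit Types t g : R.

Lemma powR_opp_succ t g : 0 < t -> t `^ (- (g + 1)) = t `^ (- g) / t.
Proof.
move=> t0; rewrite opprD powRD ?(gt_eqF t0) ?implybT//.
by rewrite powR_inv1 ?ltW.
Qed.

Lemma is_derive_continuous (f : R -> R) t d :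
  is_derive t 1 f d -> {for t, continuous f}.
Proof.
by move=> [df _]; apply: differentiable_continuous; apply/derivable1_diffP.
Qed.

Lemma expR_small (k e : R) : 0 < k -> 0 < e ->
  exists2 tau, 0 < tau & forall t, 0 < t -> t <= tau -> expR (- (k / t)) <= e.
Proof.
move=> k0 e0; exists (k * e) => [|t t0 tt]; first exact: mulr_gt0.
have h : e^-1 <= k / t by rewrite ler_pdivlMr// mulrC ler_pdivrMr.
have : 1 + k / t <= expR (k / t) by exact: expR_ge1Dx.
move=> h2; rewrite expRN -[leRHS]invrK lef_pV2 ?posrE ?expR_gt0 ?invr_gt0//; lra.
Qed.

Lemma is_derive_powexp g k t : 0 < t ->
  is_derive t 1 (fun t => t `^ (- g) * expR (- (k / t)))
    (t `^ (- g) * expR (- (k / t)) / t * (- g + k / t)).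
Proof.
move=> t0.
have d1 : is_derive t 1 (fun t : R => t^-1) (- t ^- 2).
  rewrite -[X in is_derive _ _ _ X]mulr1; apply: is_deriveV; rewrite gt_eqF//.
have d2 := @is_derive1_powR _ (- g) t t0.
have d3 : is_derive t 1 (fun t => expR (- (k / t))) (expR (- (k / t)) * (k / t ^+ 2)).
  have d4 : is_derive t 1 (fun t => - (k / t)) (k / t ^+ 2).
    by apply: is_derive_eq; rewrite /GRing.scale/=; ring.
  exact: is_derive1_comp.
apply: is_derive_eq; rewrite /GRing.scale/= -opprD powR_opp_succ//.
by field; rewrite gt_eqF.
Qed.

End real_lemmas.

(** * Gaussian functions *)

Section gaussians.
Variables (R : realType) (N : nat).
Notation X := 'rV[R]_N.
Implicit Types (x y : X) (t s g c : R).

Lemma cont_time (m : R -> R) x t : {for t, continuous m} ->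
  {for (x, t), continuous (fun p : X * R => m p.2)}.
Proof.
move=> h; apply: (@continuous_comp _ _ _ (fun p : X * R => p.2) m); last exact: h.
exact: cvg_snd.
Qed.

Lemma cont_space (m : X -> R) x t : {for x, continuous m} ->
  {for (x, t), continuous (fun p : X * R => m p.1)}.
Proof.
move=> h; apply: (@continuous_comp _ _ _ (fun p : X * R => p.1) m); last exact: h.
exact: cvg_fst.
Qed.

(** For g = N / 2 and c = 1 / 4 this is the heat kernel issued from (y, s), without its normalising
    constant; other exponents give barriers. *)
Definition gauss g c y s x t : R :=
  (t - s) `^ (- g) * expR (- (c * n2 (x - y) / (t - s))).

Lemma gauss_gt0 g c y s x t : s < t -> 0 < gauss g c y s x t.
Proof. by move=> st; rewrite mulr_gt0 ?powR_gt0 ?expR_gt0// subr_gt0. Qed.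

Lemma gauss_succ g c y s x t : s < t ->
  gauss (g + 1) c y s x t = gauss g c y s x t / (t - s).
Proof.
by move=> st; rewrite /gauss powR_opp_succ ?subr_gt0//; ring.
Qed.

Lemma gauss_continuous g c y s x t : s < t ->
  {for (x, t), continuous (fun p : X * R => gauss g c y s p.1 p.2)}.
Proof.
move=> st; have ts0 : 0 < t - s by rewrite subr_gt0.
have c1 : {for (x, t), continuous (fun p : X * R => p.2 - s)}.
  by apply: (@cont_time (fun t => t - s)); apply: cvgB; [exact: cvg_id|exact: cvg_cst].
have c2 : {for (x, t), continuous (fun p : X * R => (p.2 - s) `^ (- g))}.
  apply: (@continuous_comp _ _ _ (fun p : X * R => p.2 - s) (fun u => u `^ (- g))) => //.
  exact: is_derive_continuous (is_derive1_powR _ ts0).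
have c3 : {for (x, t), continuous (fun p : X * R => n2 (p.1 - y))}.
  apply: (@cont_space (fun x => n2 (x - y))).
  apply: (@continuous_comp _ _ _ (fun x : X => x - y) (@n2 R N)); last exact: n2_continuous.
  have h1 : (@id X) @ nbhs x --> x by exact: cvg_id.
  exact: (cvgB h1 (cvg_cst y)).
apply: cvgM; first exact: c2.
apply: (@continuous_comp _ _ _ (fun p : X * R => - (c * n2 (p.1 - y) / (p.2 - s))) expR); last exact: continuous_expR.
apply: cvgN; apply: cvgM; first by apply: cvgM; [exact: cvg_cst|exact: c3].
by apply: cvgV; [rewrite /= gt_eqF|exact: c1].
Qed.

(** Both uses can be read off the last factor: c = 1 / 4 removes the spatial term and leaves N / 2 -
    g, while 0 < c < 1 / 4 makes the factor nonnegative once |x - y|^2 is a large multiple of t -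
    s. *)
Lemma heat_gauss g c y s x t : s < t ->
  heat (gauss g c y s) x t (gauss g c y s x t / (t - s) *
    (- g + c * (1 - 4 * c) * n2 (x - y) / (t - s) + 2 * c * N%:R)).
Proof.
move=> st; have ts0 : 0 < t - s by rewrite subr_gt0.
have tsn : t - s != 0 by rewrite gt_eqF.
pose D := gauss g c y s x t.
exists (D / (t - s) * (- g + c * n2 (x - y) / (t - s))),
  (fun i => D * ((- (c * 2 * (x - y) 0 i / (t - s))) ^+ 2 + - (2 * c / (t - s)))).
split.
- have := is_derive_powexp g (c * n2 (x - y)) ts0.
  move=> h; have d1 : is_derive t 1 (fun t : R => t - s) 1.
    by apply: is_derive_eq; rewrite subr0.
  have := @is_derive1_comp R (fun t => t `^ (- g) * expR (- (c * n2 (x - y) / t))) (fun t => t - s) t _ _ h d1.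
  by rewrite mulr1.
- move=> i; rewrite /sd /gauss /D /gauss -mulrA; apply: sdiffZ.
  set z := x - y.
  pose p h := - (c * (n2 z + 2 * z 0 i * h + h ^+ 2) / (t - s)).
  pose p1 h := - (c * (2 * z 0 i + 2 * h) / (t - s)).
  have -> : (fun h => expR (- (c * n2 (x + h *: ebasis R i - y) / (t - s)))) = (fun h => expR (p h)).
    by apply/funext => h; rewrite /p -n2_line -addrA (addrC _ (- y)) addrA.
  have -> : n2 z = n2 z + 2 * z 0 i * 0 + 0 ^+ 2 by ring.
  have -> : c * 2 * z 0 i = c * (2 * z 0 i + 2 * 0) by ring.
  apply: (@sdiff_exp _ p p1).
    by move=> h; rewrite /p /p1; apply: is_derive_eq; rewrite /GRing.scale/=; ring.
  by rewrite /p1; apply: is_derive_eq; rewrite /GRing.scale/=; ring.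
- rewrite -mulr_sumr big_split/= sumr_const card_ord.
  rewrite (eq_bigr (fun i => 4 * c ^+ 2 / (t - s) ^+ 2 * (x - y) 0 i ^+ 2)); last first.
    by move=> i _; field.
  rewrite -mulr_sumr -/(n2 (x - y)) -/D -mulr_natl; by field.
Qed.

End gaussians.

(** * The absorption term and its scaling *)

Section absorption.
Variables (R : realType) (alpha q : R).
Hypotheses (alpha_gt : -1 < alpha) (q_gt1 : 1 < q).
Implicit Types t y : R.

Definition decay_exp := (1 + alpha) / (q - 1).

Lemma decay_exp_gt0 : 0 < decay_exp.
Proof.
rewrite divr_gt0 ?subr_gt0//.
have := alpha_gt; lra.
Qed.

Definition absorb t y := t `^ alpha * y `^ q.

Lemma absorb_ge0 t y : 0 <= absorb t y.
Proof. by rewrite mulr_ge0 ?powR_ge0. Qed.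

Lemma absorb_gt0 t y : 0 < t -> 0 < y -> 0 < absorb t y.
Proof. by move=> *; rewrite mulr_gt0 ?powR_gt0. Qed.

Lemma absorb_lt t y1 y2 : 0 < t -> 0 <= y1 -> y1 < y2 -> absorb t y1 < absorb t y2.
Proof.
move=> t0 y0 y12; have q1 := q_gt1.
by rewrite ltr_pM2l ?powR_gt0// gt0_ltr_powR// ?nnegrE//; lra.
Qed.

Lemma absorb_le t y1 y2 : 0 < t -> 0 <= y1 -> y1 <= y2 -> absorb t y1 <= absorb t y2.
Proof.
move=> t0 y0; rewrite le_eqVlt => /predU1P[->//|y12].
by apply: ltW; exact: absorb_lt.
Qed.

(** Per unit of y the absorption is 1 / t times a power of the scale-invariant quantity t^g y. This
    is the form in which it is compared with heat operators, whose natural size is y / t. *)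
Lemma absorb_scale t y : 0 < t -> 0 < y ->
  absorb t y = y / t * (t `^ decay_exp * y) `^ (q - 1).
Proof.
move=> t0 y0; rewrite powRM ?powR_ge0 ?ltW// -powRrM /decay_exp divfK ?subr_eq0 ?gt_eqF//.
rewrite (@powRD _ t) ?(gt_eqF t0) ?implybT// powRr1 ?ltW//.
rewrite /absorb -(@mulr_powRB1 _ y q) ?ltW//; last by have := q_gt1; lra.
by field; rewrite gt_eqF.
Qed.

Lemma absorbM t k y : 0 <= k -> 0 <= y -> absorb t (k * y) = k `^ q * absorb t y.
Proof. by move=> *; rewrite /absorb powRM//; ring. Qed.

Lemma powR_ge_id k : 1 <= k -> k <= k `^ q.
Proof. by move=> k1; apply: le1r_powR => //; exact: ltW. Qed.

End absorption.

Lemma decay_exp_gt_half (R : realType) (N : nat) (alpha q : R) : (0 < N)%N -> 1 < q ->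
  q < q_crit N alpha -> N%:R / 2 < decay_exp alpha q.
Proof.
move=> N0 q1; rewrite /q_crit /decay_exp => qc.
have N0' : 0 < N%:R :> R by rewrite ltr0n.
rewrite ltr_pdivlMr ?subr_gt0//.
have : q - 1 < 2 * (1 + alpha) / N%:R by lra.
rewrite ltr_pdivlMr//; lra.
Qed.

Section gauss_facts.
Variables (R : realType) (N : nat).
Notation X := 'rV[R]_N.

Lemma gauss0E g c (x : X) (t : R) :
  gauss g c 0 0 x t = t `^ (- g) * expR (- (c * n2 x / t)).
Proof. by rewrite /gauss !subr0. Qed.

Lemma continuous_n2p (p : X * R) :
  {for p, continuous (fun p : X * R => n2 p.1)}.
Proof. by case: p => x t; apply: (@cont_space _ _ (@n2 R N)); exact: n2_continuous. Qed.

Lemma continuous_snd (p : X * R) :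
  {for p, continuous (fun p : X * R => p.2)}.
Proof. by case: p => x t; exact: cvg_snd. Qed.

Lemma continuous_maxr (f h : X * R -> R) (p : X * R) :
  {for p, continuous f} -> {for p, continuous h} ->
  {for p, continuous (fun p => Num.max (f p) (h p))}.
Proof. by move=> cf ch; exact: (continuous_max cf ch). Qed.

End gauss_facts.

(* The constant delivered by the barrier [bowl] in [gaussian_bound]; the
   comparisons away from paraboloids only need [c0 < 1 / 4]. *)
Definition c0 {R : realType} : R := 128^-1.

Lemma c0_gt0 (R : realType) : 0 < c0 :> R.
Proof. by rewrite /c0 invr_gt0. Qed.

(** * Comparison outside a paraboloid *)

Section outer.
Variables (R : realType) (N : nat) (alpha q : R).
Hypotheses (alpha_gt : -1 < alpha) (q_gt1 : 1 < q).
Notation X := 'rV[R]_N.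
Notation g := (decay_exp alpha q).
Notation A := (absorb alpha q).
Variables (rho T R2 : R).
Hypotheses (TM : T <= c0 * rho / g) (R2_ge : g + 1 <= c0 * (1 - 4 * c0) * R2).
Implicit Types (x : X) (t : R).

(* The value of [gauss g c0 0 0 x t] on the lateral boundary [n2 x = rho]. *)
Definition gauss_edge t : R := t `^ (- g) * expR (- (c0 * rho / t)).

Lemma gauss_edge_gt0 t : 0 < t -> 0 < gauss_edge t.
Proof. by move=> t0; rewrite mulr_gt0 ?powR_gt0 ?expR_gt0. Qed.

(** [TM] keeps t before c0 rho / g, the time at which [gauss_edge] reaches its maximum. *)
Lemma heat_gauss_edge x t : 0 < t -> t <= T ->
  exists2 d, heat (fun (_ : X) t => gauss_edge t) x t d & 0 <= d.
Proof.
move=> t0 tT; have g0 : 0 < g by exact: decay_exp_gt0.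
exists (gauss_edge t / t * (- g + c0 * rho / t)).
  by apply: heat_time; exact: is_derive_powexp.
apply: mulr_ge0; first by rewrite divr_ge0// ltW// gauss_edge_gt0.
suff : g <= c0 * rho / t by lra.
rewrite ler_pdivlMr// mulrC -ler_pdivlMr//; exact: le_trans TM.
Qed.

Lemma continuous_gauss_edge x t : 0 < t ->
  {for (x, t), continuous (fun p : X * R => gauss_edge p.2)}.
Proof.
move=> t0; apply: cont_time.
exact: is_derive_continuous (is_derive_powexp g (c0 * rho) t0).
Qed.

Lemma R2_gt0 : 0 < R2.
Proof.
have := decay_exp_gt0 alpha_gt q_gt1; have := R2_ge; rewrite /c0.
move=> h1 h2; rewrite ltNge; apply/negP => h3; lra.
Qed.

(** [R2_ge] is tailored to the exponent g + 1: compared with the Gaussian bound this function has an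
    additional 1 / t, which lets it dominate as t -> 0. *)
Lemma heat_gauss_outer x t : 0 < t -> R2 * t <= n2 x ->
  exists2 d, heat (gauss (g + 1) c0 (0 : X) 0) x t d & 0 <= d.
Proof.
move=> t0 Rt; eexists; first exact: heat_gauss.
apply: mulr_ge0; first by rewrite divr_ge0// ?ltW ?gauss_gt0// subr0.
rewrite !subr0.
have c00 := @c0_gt0 R.
have cN : 0 <= 2 * c0 * N%:R :> R by rewrite mulr_ge0 ?ler0n//; lra.
suff : g + 1 <= c0 * (1 - 4 * c0) * n2 x / t by lra.
have h1 : 0 <= c0 * (1 - 4 * c0) :> R by rewrite /c0; lra.
apply: (le_trans R2_ge); rewrite -[leRHS]mulrA; apply: ler_wpM2l => //.
by rewrite ler_pdivlMr.
Qed.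

(** A subsolution [w] and a supersolution [b] are compared between the paraboloid and the sphere.
    The sphere is paid for by [C * gauss_edge]. Near t = 0, where only the Gaussian bound on [w] is
    available, a multiple e of [Z] = gauss / t takes over, and e is arbitrary. *)
Lemma outer_comparison C (w b : X -> R -> R) : 0 <= C ->
  (forall x t, 0 < t <= T -> R2 * t <= n2 x <= rho ->
    [/\ {for (x, t), continuous (fun p : X * R => w p.1 p.2)},
        exists2 d, heat w x t d & d <= - A t (w x t) &
        w x t <= C * gauss g c0 0 0 x t]) ->
  (forall x t, 0 < t <= T -> R2 * t <= n2 x <= rho ->
    [/\ {for (x, t), continuous (fun p : X * R => b p.1 p.2)},
        0 <= b x t & exists2 d, heat b x t d & - A t (b x t) <= d]) ->
  (forall x t, 0 < t <= T -> n2 x = R2 * t -> n2 x <= rho -> w x t <= b x t) ->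
  forall x t, 0 < t <= T -> R2 * t <= n2 x <= rho -> w x t <= b x t + C * gauss_edge t.
Proof.
move=> C0 Hw Hb Hin x0 t0 /andP[t00 t0T] /andP[x0R x0r].
pose Z := gauss (g + 1) c0 (0 : X) 0.
suff main e : 0 < e -> w x0 t0 <= b x0 t0 + C * gauss_edge t0 + e * Z x0 t0.
  apply/ler_addgt0Pr => e e0.
  have Z0 : 0 < Z x0 t0 by exact: gauss_gt0.
  have := main (e / Z x0 t0); rewrite divfK ?gt_eqF//; apply.
  by rewrite divr_gt0.
move=> e0.
(* At time [tau] one has C <= e / t, so that e Z = (e / t) gauss already exceeds the bound on [w]; C
   + 1 covers C = 0. *)
pose tau := Num.min t0 (e / (C + 1)).
have tau0 : 0 < tau by rewrite lt_min t00 divr_gt0//; lra.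
have tauC : C * tau <= e.
  have : tau <= e / (C + 1) by rewrite ge_min lexx orbT.
  rewrite ler_pdivlMr; last lra.
  nra.
pose G := fun x t => Num.max (Num.max (n2 x - rho) (R2 * t - n2 x)) (tau - t).
pose phi := fun x t => w x t - b x t - C * gauss_edge t - e * Z x t.
have GE x t : G x t <= 0 = [&& n2 x <= rho, R2 * t <= n2 x & tau <= t].
  by rewrite /G !ge_max !subr_le0 andbA.
have GL x t : G x t < 0 = [&& n2 x < rho, R2 * t < n2 x & tau < t].
  by rewrite /G !gt_max !subr_lt0 andbA.
suff : phi x0 t0 <= 0 by rewrite /phi; lra.
apply: (@maxprin _ _ G phi rho T) => //.
- move=> p; apply: continuous_maxr; [apply: continuous_maxr|].
  + by apply: cvgB; [exact: continuous_n2p|exact: cvg_cst].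
  + by apply: cvgB; [apply: cvgM; [exact: cvg_cst|exact: continuous_snd]|exact: continuous_n2p].
  + by apply: cvgB; [exact: cvg_cst|exact: continuous_snd].
- by move=> x t; rewrite GE => /and3P[h1 _ h2] _; split=> //; lra.
- move=> x t; rewrite GE => /and3P[h1 h2 h3] tT.
  have t_gt0 : 0 < t by lra.
  have tI : 0 < t <= T by rewrite t_gt0.
  have xI : R2 * t <= n2 x <= rho by rewrite h2.
  have [cw _ _] := Hw _ _ tI xI; have [cb _ _] := Hb _ _ tI xI.
  apply: cvgB; [apply: cvgB; [apply: cvgB; [exact: cw|exact: cb]|]|].
    by apply: cvgM; [exact: cvg_cst|exact: continuous_gauss_edge].
  by apply: cvgM; [exact: cvg_cst|exact: gauss_continuous].
- move=> x t; rewrite GE => /and3P[h1 h2 h3] tT px.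
  have t_gt0 : 0 < t by lra.
  have tI : 0 < t <= T by rewrite t_gt0.
  have xI : R2 * t <= n2 x <= rho by rewrite h2.
  have [cw [dw hw dw_le] wC] := Hw _ _ tI xI; have [cb b0 [db hb db_ge]] := Hb _ _ tI xI.
  have M0 := gauss_edge_gt0 t_gt0; have Z0 : 0 < Z x t by exact: gauss_gt0.
  have CM0 : 0 <= C * gauss_edge t by rewrite mulr_ge0// ltW.
  have eZ0 : 0 < e * Z x t by rewrite mulr_gt0.
  have bw : b x t < w x t by move: px; rewrite /phi; lra.
  have bw' : 0 < w x t - b x t - C * gauss_edge t - e * Z x t by [].
  split.
    rewrite GL; apply/and3P; split.
    + rewrite lt_neqAle h1 andbT; apply/eqP => E.
      by move: wC; rewrite gauss0E E -/(gauss_edge t); lra.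
    + rewrite lt_neqAle h2 andbT; apply/eqP => E.
      by have := Hin _ _ tI (esym E) h1; lra.
    + rewrite lt_neqAle h3 andbT; apply/eqP => E.
      have : e * Z x t = e / t * gauss g c0 0 0 x t.
        by rewrite /Z gauss_succ// subr0; ring.
      have : C <= e / t by rewrite ler_pdivlMr// -E.
      have : 0 < gauss g c0 0 0 x t by exact: gauss_gt0.
      nra.
  have [dM hM dM0] := heat_gauss_edge x t_gt0 tT.
  have [dZ hZ dZ0] := heat_gauss_outer t_gt0 h2.
  exists (dw - db - C * dM - e * dZ).
    by apply: heatB; [apply: heatB; [exact: heatB|exact: heatZ]|exact: heatZ].
  have := absorb_lt alpha q_gt1 t_gt0 b0 bw.
  have : 0 <= C * dM by rewrite mulr_ge0.
  have : 0 <= e * dZ by rewrite mulr_ge0// ltW.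
  lra.
- by rewrite GE x0r x0R ge_min lexx.
Qed.

End outer.

Section small.
Variable R : realType.
Implicit Types k e t a : R.

(** With m = a + 1, exp(k / t) = exp(k / (m t))^m >= (k / (m t))^m, one power of 1 / t more than
    t^-a requires. *)
Lemma powexp_small a k e : 0 <= a -> 0 < k -> 0 < e ->
  exists2 tau, 0 < tau &
    forall t, 0 < t <= tau -> t `^ (- a) * expR (- (k / t)) <= e.
Proof.
move=> a0 k0 e0; set m := a + 1; have m0 : 0 < m by rewrite /m; lra.
pose L := (m / k) `^ m; have L0 : 0 < L by rewrite powR_gt0 ?divr_gt0.
exists (e / L) => [|t /andP[t0 tt]]; first exact: divr_gt0.
have h1 : (k / m / t) `^ m <= expR (k / t).
  have -> : expR (k / t) = (expR (k / m / t)) `^ m.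
    by rewrite -expRM; congr expR; field; rewrite !gt_eqF.
  have h2 := @expR_ge1Dx R (k / m / t).
  have h3 : 0 < k / m / t by rewrite !divr_gt0.
  apply: ge0_ler_powR; rewrite ?nnegrE ?expR_ge0 ?(ltW h3) ?(ltW m0)//; lra.
have h4 : t `^ m = t `^ a * t by rewrite powRD ?(gt_eqF t0) ?implybT// powRr1 ?ltW.
rewrite expRN powRN -invfM.
have ta : 0 < t `^ a by exact: powR_gt0.
pose Q := (k / m / t) `^ m; have Q0 : 0 < Q by rewrite powR_gt0// !divr_gt0.
have h5 : L * Q * (t `^ a * t) = 1.
  have mk0 : 0 < m / k by exact: divr_gt0.
  have q0 : 0 < k / m / t by rewrite !divr_gt0.
  rewrite -h4 -!powRM ?(ltW t0) ?(ltW mk0) ?(ltW q0) ?(ltW (mulr_gt0 mk0 q0))//.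
  by rewrite (_ : m / k * _ * t = 1) ?powR1//; field; rewrite !gt_eqF.
have h6 : t `^ a * Q <= t `^ a * expR (k / t) by rewrite ler_pM2l.
have h7 : (t `^ a * Q)^-1 = L * t.
  have n0 : t `^ a * Q != 0 by rewrite gt_eqF ?mulr_gt0.
  by apply: (mulfI n0); rewrite mulfV// -h5; ring.
apply: (@le_trans _ _ (t `^ a * Q)^-1).
  by rewrite lef_pV2 ?posrE ?mulr_gt0 ?expR_gt0.
by rewrite h7 mulrC -ler_pdivlMr.
Qed.

End small.

Section heat_poly.
Variables (R : realType) (N : nat).
Notation X := 'rV[R]_N.

Lemma heat_n2 (x : X) (t : R) : heat (fun x _ => n2 x) x t (- (2 * N%:R)).
Proof.
exists 0, (fun=> 2); split; first exact: is_derive_cst.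
- move=> i; rewrite /sd (_ : (fun h => _) = (fun h => n2 x + 2 * x 0 i * h + h ^+ 2)); last first.
    by apply/funext => h; rewrite n2_line.
  apply: (@sdiff_of_derive _ _ (fun h => 2 * x 0 i + 2 * h)).
    by apply: filterE => h; apply: is_derive_eq; rewrite /GRing.scale/=; ring.
  by apply: is_derive_eq; rewrite /GRing.scale/=; ring.
- by rewrite sumr_const card_ord -mulr_natr; ring.
Qed.

End heat_poly.

(** * Solutions with a Gaussian bound *)

Section gauss_sol.
Variables (R : realType) (N : nat) (alpha q : R).
Hypotheses (alpha_gt : -1 < alpha) (q_gt1 : 1 < q).
Notation X := 'rV[R]_N.
Notation g := (decay_exp alpha q).
Notation A := (absorb alpha q).
Implicit Types (x : X) (t c : R).

(** The class into which both the translated [u] and the very singular solution are brought. The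
    last clause stands for the initial condition: it forces [f] to vanish as t -> 0 away from the
    origin. *)
Definition gauss_sol rho T C (f : X -> R -> R) := forall x t, 0 < t <= T -> n2 x <= rho ->
  [/\ {for (x, t), continuous (fun p : X * R => f p.1 p.2)}, 0 < f x t,
      heat f x t (- A t (f x t)) & f x t <= C * gauss g c0 0 0 x t].

Lemma gauss_le g' c c' x t : 0 < t -> c' <= c ->
  gauss g' c 0 0 x t <= gauss g' c' 0 0 x t.
Proof.
move=> t0 cc; rewrite !gauss0E ler_pM2l ?powR_gt0// ler_expR lerN2.
by rewrite ler_pM2r ?invr_gt0// ler_wpM2r// n2_ge0.
Qed.

Lemma gauss_le_pow g' c x t : 0 < t -> 0 <= c -> gauss g' c 0 0 x t <= t `^ (- g').
Proof.
move=> t0 c_ge0; rewrite gauss0E ger_pMr ?powR_gt0// -expR0 ler_expR oppr_le0.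
by rewrite divr_ge0 ?mulr_ge0 ?n2_ge0// ltW.
Qed.

Lemma gauss_ge_pow g' c x t r : 0 < t -> 0 <= c -> n2 x <= r ->
  t `^ (- g') * expR (- (c * r / t)) <= gauss g' c 0 0 x t.
Proof.
move=> t0 c_ge0 xr; rewrite gauss0E ler_pM2l ?powR_gt0// ler_expR lerN2.
by rewrite ler_pM2r ?invr_gt0// ler_wpM2l.
Qed.

Lemma powg_mul t : 0 < t -> t `^ g * t `^ (- g) = 1.
Proof. by move=> t0; rewrite powRN divff// gt_eqF// powR_gt0. Qed.

(** With exponent 1 / 4 the heat operator gives -(g - N / 2) times c G / t, whereas the absorption
    is at most c^(q-1) times c G / t because t^g c G <= c. The gap g > N / 2 is what leaves room for
    such a c. *)
Lemma subsol_gauss c x t : 0 < t -> 0 < c -> c `^ (q - 1) <= g - N%:R / 2 ->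
  exists2 d, heat (fun x t => c * gauss g 4^-1 0 0 x t) x t d &
    d <= - A t (c * gauss g 4^-1 0 0 x t).
Proof.
move=> t0 c_gt0 cq; eexists; first by apply: heatZ; exact: heat_gauss.
set G := gauss _ _ _ _ _ _; have G0 : 0 < G by exact: gauss_gt0.
have cG0 : 0 < c * G by exact: mulr_gt0.
rewrite subr0 (absorb_scale alpha q_gt1 t0 cG0).
have h1 : t `^ g * (c * G) <= c.
  have := gauss_le_pow g x t0 (_ : 0 <= 4^-1); rewrite -/G => h.
  have := h; rewrite invr_ge0 ler0n => /(_ isT) {}h.
  have : t `^ g * G <= 1 by rewrite -(powg_mul t0) ler_pM2l ?powR_gt0.
  nra.
have h2 : (t `^ g * (c * G)) `^ (q - 1) <= c `^ (q - 1).
  apply: ge0_ler_powR => //; rewrite ?nnegrE ?(ltW c_gt0)//.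
  - by rewrite subr_ge0 ltW.
  - by rewrite !mulr_ge0 ?powR_ge0 ?(ltW c_gt0) ?(ltW G0).
set P := powR _ _ in h2 *.
have -> : c * (G / t * (- g + 4^-1 * (1 - 4 / 4) * n2 (x - 0) / t + 2 / 4 * N%:R)) =
    c * G / t * (- g + N%:R / 2) by field; rewrite gt_eqF.
have cG : 0 < c * G / t by rewrite divr_gt0// mulr_gt0.
rewrite -[leRHS]mulrN ler_pM2l//; lra.
Qed.

Lemma supersol_scale K (v : X -> R -> R) x t : 1 <= K -> 0 < v x t ->
  heat v x t (- A t (v x t)) ->
  exists2 d, heat (fun x t => K * v x t) x t d & - A t (K * v x t) <= d.
Proof.
move=> K1 v0 hv; exists (K * - A t (v x t)); first exact: heatZ.
rewrite mulrN lerN2 absorbM ?(ltW v0)//; last by lra.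
by apply: ler_wpM2r; [exact: absorb_ge0|exact: powR_ge_id].
Qed.

End gauss_sol.

(** * The ratio of two solutions *)

Section upper.
Variables (R : realType) (N : nat) (alpha q : R).
Hypotheses (alpha_gt : -1 < alpha) (q_gt1 : 1 < q).
Hypothesis gN : N%:R / 2 < decay_exp alpha q.
Notation X := 'rV[R]_N.
Notation g := (decay_exp alpha q).
Notation A := (absorb alpha q).
Variables (rho T R2 : R).
Hypotheses (rho_gt0 : 0 < rho) (T_gt0 : 0 < T) (TM : T <= c0 * rho / g)
  (R2_ge : g + 1 <= c0 * (1 - 4 * c0) * R2).
Notation edge := (gauss_edge alpha q rho).
Implicit Types (x : X) (t : R).
Ltac slra := clear -alpha_gt q_gt1 gN rho_gt0 T_gt0 TM R2_ge; lra.

Lemma gauss_lower C c tau (v : X -> R -> R) : gauss_sol alpha q rho T C v ->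
  0 < c -> 0 < tau <= T ->
  (forall x t, 0 < t <= tau -> n2 x <= R2 * t -> n2 x <= rho ->
     c * t `^ (- g) <= v x t) ->
  exists2 c1, 0 < c1 & forall x t, 0 < t <= tau -> n2 x <= rho ->
    c1 * gauss g 4^-1 0 0 x t <= v x t + c1 * edge t.
Proof.
move=> Hv c_gt0 /andP[tau0 tauT] vc.
have gN0 : 0 < g - N%:R / 2 by rewrite subr_gt0.
have q10 : 0 < q - 1 by rewrite subr_gt0.
pose c1 := Num.min c ((g - N%:R / 2) `^ (q - 1)^-1).
have c10 : 0 < c1 by rewrite lt_min c_gt0 powR_gt0.
have c1q : c1 `^ (q - 1) <= g - N%:R / 2.
  have -> : g - N%:R / 2 = ((g - N%:R / 2) `^ (q - 1)^-1) `^ (q - 1).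
    by rewrite -powRrM mulVf ?gt_eqF// powRr1// ltW.
  by apply: ge0_ler_powR; rewrite ?nnegrE ?powR_ge0 ?(ltW c10) ?(ltW q10)// ge_min lexx orbT.
have c1c : c1 <= c by rewrite ge_min lexx.
exists c1 => // x t /andP[t0 tt] xr.
have inner y s : 0 < s <= tau -> n2 y <= R2 * s -> n2 y <= rho ->
    c1 * gauss g 4^-1 0 0 y s <= v y s.
  move=> /andP[s0 st] yR yr.
  apply: le_trans (vc y s _ yR yr); last by rewrite s0.
  apply: ler_pM => //; rewrite ?(ltW c10) ?(ltW (gauss_gt0 _ _ _ _ s0))//.
  by apply: gauss_le_pow; rewrite ?invr_ge0.
have [xR|/ltW xR] := leP (n2 x) (R2 * t).
  rewrite -[leLHS]addr0; apply: lerD; first by apply: inner; rewrite ?t0.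
  by rewrite mulr_ge0 ?ltW ?gauss_edge_gt0.
have tauM : tau <= c0 * rho / g by exact: le_trans TM.
apply: (outer_comparison alpha_gt q_gt1 tauM R2_ge (w := fun x t => c1 * gauss g 4^-1 0 0 x t)).
- exact: ltW.
- move=> y s /andP[s0 st] yR; split.
  + by apply: cvgM; [exact: cvg_cst|exact: gauss_continuous].
  + exact: subsol_gauss.
  + by rewrite ler_pM2l// gauss_le// /c0 lef_pV2 ?posrE// ler_nat.
- move=> y s /andP[s0 st] /andP[_ yr].
  have [|h1 h2 h3 _] := Hv y s _ yr; first by rewrite s0 (le_trans st).
  by split=> //; [exact: ltW|exists (- A s (v y s))].
- by move=> y s sI yE yr; apply: inner => //; rewrite yE.
- by rewrite t0.
- by rewrite xR.
Qed.

(** On |x|^2 <= c0 rho the exponent |x|^2 / (4 t) is at most a quarter of the exponent c0 rho / t of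
    [edge]; the remaining three quarters make the quotient tend to 0. *)
Lemma gauss_edge_negligible c tau (v : X -> R -> R) : 0 < c -> 0 < tau ->
  (forall x t, 0 < t <= tau -> n2 x <= rho ->
    c * gauss g 4^-1 0 0 x t <= v x t + c * edge t) ->
  forall d, 0 < d -> exists2 tau', 0 < tau' <= tau & forall x t, 0 < t <= tau' ->
    n2 x <= c0 * rho -> edge t <= d * v x t.
Proof.
move=> c_gt0 tau0 H d d0.
(* The bound 1 / 2 gives edge <= G / 2, hence c G / 2 <= v; then edge <= (d c / 2) G is at most d
   v. *)
pose e := Num.min 2^-1 (d * c / 2).
have e0 : 0 < e by rewrite lt_min invr_gt0 ltr0n divr_gt0 ?mulr_gt0.
have c00 := @c0_gt0 R.
have k0 : 0 < 3 / 4 * (c0 * rho) by rewrite !mulr_gt0.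
have [t1 t10 Ht1] := expR_small k0 e0.
exists (Num.min tau t1); first by rewrite lt_min tau0 t10 ge_min lexx.
move=> x t /andP[t0]; rewrite le_min => /andP[tt tt1] xr.
have xr' : n2 x <= rho.
  by apply: (le_trans xr); rewrite ger_pMl// /c0 invf_le1 ?ler1n ?ltr0n.
have h1 := H x t _ xr'; have {}h1 := h1 (introT andP (conj t0 tt)).
have h2 : t `^ (- g) * expR (- (4^-1 * (c0 * rho) / t)) <= gauss g 4^-1 0 0 x t.
  by apply: gauss_ge_pow => //; rewrite invr_ge0.
have h3 : edge t = t `^ (- g) * expR (- (4^-1 * (c0 * rho) / t)) * expR (- (3 / 4 * (c0 * rho) / t)).
  rewrite /gauss_edge -[RHS]mulrA -expRD; congr (_ * expR _); field; rewrite gt_eqF//.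
have h4 := Ht1 t t0 tt1.
set G := gauss g 4^-1 0 0 x t in h1 h2.
have G0 : 0 < G by exact: gauss_gt0.
have h5 : edge t <= e * G.
  rewrite h3 mulrC; apply: ler_pM h4 h2; first exact: expR_ge0.
  by rewrite mulr_ge0 ?powR_ge0 ?expR_ge0.
have e1 : e <= 2^-1 by rewrite ge_min lexx.
have e2 : e <= d * c / 2 by rewrite ge_min lexx orbT.
have m1 : edge t <= 2^-1 * G by apply: (le_trans h5); rewrite ler_pM2r.
have m2 : c * edge t <= c * (2^-1 * G) by rewrite ler_pM2l.
have m3 : e * G <= d * c / 2 * G by rewrite ler_pM2r.
have m4 : d * (c * G / 2) <= d * v x t by rewrite ler_pM2l//; lra.
by apply: (le_trans h5); lra.
Qed.

Lemma sol_spread Cf Cv tau (f v : X -> R -> R) K : gauss_sol alpha q rho T Cf f ->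
  gauss_sol alpha q rho T Cv v -> 0 <= Cf -> 1 <= K -> 0 < tau <= T ->
  (forall x t, 0 < t <= tau -> n2 x <= R2 * t -> n2 x <= rho ->
     f x t <= K * v x t) ->
  forall x t, 0 < t <= tau -> n2 x <= rho -> f x t <= K * v x t + Cf * edge t.
Proof.
move=> Hf Hv Cf0 K1 /andP[tau0 tauT] H x t tI xr.
have tauM : tau <= c0 * rho / g by exact: le_trans TM.
have T1 s : 0 < s <= tau -> 0 < s <= T.
  by move=> /andP[-> /= h]; exact: le_trans tauT.
have [xR|/ltW xR] := leP (n2 x) (R2 * t).
  rewrite -[leLHS]addr0; apply: lerD; first exact: H.
  by rewrite mulr_ge0// ltW// gauss_edge_gt0; case/andP: tI.
apply: (outer_comparison alpha_gt q_gt1 tauM R2_ge (b := fun x t => K * v x t)) => //.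
- move=> y s sI /andP[yR yr]; have [h1 h2 h3 h4] := Hf y s (T1 _ sI) yr.
  by split=> //; exists (- A s (f y s)).
- move=> y s sI /andP[yR yr]; have [h1 h2 h3 h4] := Hv y s (T1 _ sI) yr.
  split; first by apply: cvgM; [exact: cvg_cst|exact: h1].
  + by rewrite mulr_ge0 ?(ltW h2)//; lra.
  + exact: supersol_scale.
- by move=> y s sI yE yr; apply: H => //; rewrite yE.
- by rewrite xR.
Qed.

(* By strict convexity of the absorption, [K * v] is a supersolution with room
   to spare as soon as [K > 1], so that the ratio [K] can be lowered. *)
Lemma sol_improve Cf Cv c tau0 (f v : X -> R -> R) R3 K0 : gauss_sol alpha q rho T Cf f ->
  gauss_sol alpha q rho T Cv v -> 0 < c -> 0 < tau0 -> R2 < R3 -> 1 < K0 ->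
  (forall x t, 0 < t <= tau0 -> n2 x <= R3 * t -> c * t `^ (- g) <= v x t) ->
  exists d e, [/\ 0 < d, 0 < e & forall K tau, K0 <= K <= K0 + d -> 0 < tau ->
    (forall x t, 0 < t <= tau -> n2 x <= R3 * t -> f x t <= K * v x t) ->
    exists2 tau', 0 < tau' <= T & forall x t, 0 < t <= tau' -> n2 x <= R2 * t ->
      f x t <= (K - e) * v x t].
Proof.
move=> Hf Hv c_gt0 tau00 R23 K01 vc.
have R20 : 0 < R2 by have := R2_gt0 alpha_gt q_gt1 R2_ge.
have g0 : 0 < g by exact: decay_exp_gt0.
have q10 : 0 < q - 1 by rewrite subr_gt0.
have q1 := q_gt1.
(* Any exponent strictly between 1 / q and 1 yields K1 < K0 < K1^q for K1 = K0^sg. *)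
pose sg := (1 + q^-1) / 2.
have qV : q * q^-1 = 1 by rewrite mulfV// gt_eqF//; lra.
have qV1 : q^-1 < 1 by rewrite invf_lt1//; lra.
have qV0 : 0 < q^-1 by rewrite invr_gt0; lra.
pose K1 := K0 `^ sg.
have lnK0 : 0 < ln K0 by rewrite ln_gt0.
have K1K0 : K1 < K0.
  rewrite /K1 /powR gt_eqF; last lra.
  rewrite -[X in _ < X](@lnK _ K0) ?posrE; last lra.
  by rewrite ltr_expR gtr_pMl// /sg; lra.
have K1q : K0 < K1 `^ q.
  rewrite /K1 -powRrM /powR gt_eqF; last lra.
  rewrite -[X in X < _](@lnK _ K0) ?posrE; last lra.
  rewrite ltr_expR ltr_pMl//.
  have -> : sg * q = (1 + q) / 2 by rewrite /sg mulrAC mulrDl mul1r mulVf ?(addrC q)// gt_eqF//; lra.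
  lra.
have K10 : 0 <= K1 by exact: powR_ge0.
(* For every K <= K0 + mu there remains K1^q - K >= mu. *)
pose mu := (K1 `^ q - K0) / 2.
have muE : K1 `^ q = K0 + 2 * mu by rewrite /mu; lra.
have mu0 : 0 < mu by rewrite /mu; lra.
clearbody mu K1.
pose c' := c * 2 `^ (- g); have c'0 : 0 < c' by rewrite mulr_gt0 ?powR_gt0.
have c'E : c' = c * 2 `^ (- g) by [].
clearbody c'.
have R30 : 0 < R3 by lra.
pose P := mu * c' * c `^ (q - 1) / 2.
have P0 : 0 < P by rewrite /P divr_gt0 ?mulr_gt0 ?powR_gt0.
have PE : P = mu * c' * c `^ (q - 1) / 2 by [].
clearbody P.
pose D := 3 * R3 + 2 * N%:R.
have N0 : 0 <= N%:R :> R by exact: ler0n.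
have D0 : 0 < D by rewrite /D; lra.
have DE : D = 3 * R3 + 2 * N%:R by [].
clearbody D.
(* The first bound will give z <= (K0 - K1) v, the second keeps the heat operator of z below mu
   times the absorption of v. *)
pose e1 := Num.min (c' * (K0 - K1) / (2 * R3)) (P / (2 * D)).
have e10 : 0 < e1 by rewrite lt_min !divr_gt0 ?mulr_gt0 ?subr_gt0.
have e1a : 2 * R3 * e1 <= c' * (K0 - K1).
  have : e1 <= c' * (K0 - K1) / (2 * R3) by rewrite ge_min lexx.
  by rewrite ler_pdivlMr ?mulr_gt0// mulrC.
have e1b : e1 * D < P.
  have : e1 <= P / (2 * D) by rewrite ge_min lexx orbT.
  rewrite ler_pdivlMr ?mulr_gt0//.
  have : 0 < e1 * D by exact: mulr_gt0.
  lra.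
clearbody e1.
pose e := 2 * e1 * (R3 - R2) / (`|Cv| + 1).
have Cv1 : 0 < `|Cv| + 1 by rewrite ltr_wpDl.
exists mu, e; split=> //; first by rewrite !divr_gt0 ?mulr_gt0 ?subr_gt0.
move=> K tau /andP[KK0 KK1] tau_gt0 H.
pose tau' := Num.min (Num.min T tau) (Num.min tau0 (rho / R3)).
have tau'0 : 0 < tau' by rewrite !lt_min T_gt0 tau_gt0 tau00 divr_gt0.
have tau'T : tau' <= T by rewrite !ge_min lexx.
have tau't : tau' <= tau by rewrite !ge_min lexx !orbT.
have tau't0 : tau' <= tau0 by rewrite !ge_min lexx !orbT.
have tau'r : R3 * tau' <= rho.
  have : tau' <= rho / R3 by rewrite !ge_min lexx !orbT.
  by rewrite ler_pdivlMr// mulrC.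
exists tau'; first by rewrite tau'0.
move=> x0 t1 /andP[t10 t1t] x0R.
(* The gain at time t1 is accumulated over the interval from t1 / 2 to t1. *)
pose t0 := t1 / 2; have t00 : 0 < t0 by rewrite divr_gt0.
have t12 : t1 = 2 * t0 by rewrite /t0 mulrC divfK ?pnatr_eq0.
pose k := e1 * (t0 `^ (- g) / t0 ^+ 2).
have k0 : 0 < k by rewrite mulr_gt0// divr_gt0 ?powR_gt0 ?exprn_gt0.
have ktt : k * t0 * t0 = e1 * t0 `^ (- g).
  by rewrite /k; field; rewrite gt_eqF.
have kE : k = e1 * (t0 `^ (- g) / t0 ^+ 2) by [].
clearbody k; clearbody t0.
(* z vanishes at t = t0 and on |x|^2 = R3 t, where only f <= K v is known. At time t1 it is bounded
   below by a multiple of t0^-g on the narrower paraboloid |x|^2 <= R2 t1, and this is the gain e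
   v. *)
pose z (x : X) t := k * ((t - t0) * (R3 * t - n2 x)).
pose phi x t := f x t + z x t - K * v x t.
pose G (x : X) t := Num.max (n2 x - R3 * t) (t0 - t).
have GE x t : G x t <= 0 = (n2 x <= R3 * t) && (t0 <= t).
  by rewrite /G !ge_max !subr_le0.
have GL x t : G x t < 0 = (n2 x < R3 * t) && (t0 < t).
  by rewrite /G !gt_max !subr_lt0.
have R3t1 t : t <= t1 -> R3 * t <= rho.
  by move=> h; apply: le_trans tau'r; rewrite ler_pM2l//; exact: le_trans t1t.
have zc x t : {for (x, t), continuous (fun p : X * R => z p.1 p.2)}.
  apply: cvgM; first exact: cvg_cst.
  apply: cvgM; first by apply: cvgB; [exact: continuous_snd|exact: cvg_cst].
  apply: cvgB; last exact: continuous_n2p.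
  by apply: cvgM; [exact: cvg_cst|exact: continuous_snd].
suff : phi x0 t1 <= 0.
  rewrite /phi => h.
  have xr : n2 x0 <= rho.
    by apply: le_trans (R3t1 _ (lexx _)); apply: (le_trans x0R); rewrite ler_pM2r//; exact: ltW.
  have tI : 0 < t1 <= T by rewrite t10 (le_trans t1t).
  have [_ v0 _ vC] := Hv x0 t1 tI xr.
  have h1 : 2 * e1 * (R3 - R2) * t0 `^ (- g) <= z x0 t1.
    have -> : 2 * e1 * (R3 - R2) * t0 `^ (- g) = 2 * (R3 - R2) * (e1 * t0 `^ (- g)) by ring.
    have -> : 2 * (R3 - R2) * (e1 * t0 `^ (- g)) = k * (t0 * ((R3 - R2) * t1)).
      by rewrite -ktt t12; ring.
    rewrite /z ler_pM2l// (_ : t1 - t0 = t0); last by rewrite t12; ring.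
    by rewrite ler_pM2l//; move: x0R; slra.
  have h2 : v x0 t1 <= (`|Cv| + 1) * t0 `^ (- g).
    apply: (le_trans vC); apply: (@le_trans _ _ ((`|Cv| + 1) * gauss g c0 0 0 x0 t1)).
      have CvC : Cv <= `|Cv| + 1 by apply: (le_trans (ler_norm Cv)); rewrite lerDl.
      by rewrite ler_pM2r ?gauss_gt0.
    rewrite ler_pM2l//; apply: (@le_trans _ _ (t1 `^ (- g))).
      by apply: gauss_le_pow => //; exact/ltW/c0_gt0.
    rewrite !powRN lef_pV2 ?posrE ?powR_gt0// ge0_ler_powR ?nnegrE ?(ltW g0) ?(ltW t00) ?(ltW t10)//.
    by move: t00; rewrite t12; slra.
  have h3 : e * v x0 t1 <= 2 * e1 * (R3 - R2) * t0 `^ (- g).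
    have Q0 : 0 < 2 * e1 * (R3 - R2) by rewrite !mulr_gt0 ?subr_gt0.
    have h3 := ler_wpM2l (ltW Q0) h2.
    rewrite /e mulrAC ler_pdivrMr//; move: h3; slra.
  by move: h h1 h3; slra.
apply: (@maxprin _ _ G phi rho t1) => //.
- move=> p; apply: continuous_maxr.
  + apply: cvgB; first exact: continuous_n2p.
    by apply: cvgM; [exact: cvg_cst|exact: continuous_snd].
  + by apply: cvgB; [exact: cvg_cst|exact: continuous_snd].
- move=> x t; rewrite GE => /andP[h1 h2] tt1; split; last exact: le_trans (ltW t00) h2.
  by apply: (le_trans h1); exact: R3t1.
- move=> x t; rewrite GE => /andP[h1 h2] tt1.
  have t_gt0 : 0 < t by exact: lt_le_trans h2.
  have tI : 0 < t <= T by rewrite t_gt0/= (le_trans tt1)// (le_trans t1t).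
  have xr : n2 x <= rho by apply: (le_trans h1); exact: R3t1.
  have [cf _ _ _] := Hf x t tI xr; have [cv _ _ _] := Hv x t tI xr.
  apply: cvgB; first by apply: cvgD; [exact: cf|exact: zc].
  by apply: cvgM; [exact: cvg_cst|exact: cv].
- move=> x t; rewrite GE => /andP[h1 h2] tt1 px.
  have t_gt0 : 0 < t by exact: lt_le_trans h2.
  have tI : 0 < t <= T by rewrite t_gt0/= (le_trans tt1)// (le_trans t1t).
  have xr : n2 x <= rho by apply: (le_trans h1); exact: R3t1.
  have [_ f0 hf fC] := Hf x t tI xr; have [_ v0 hv vC] := Hv x t tI xr.
  have fKv : f x t <= K * v x t by apply: H => //; rewrite t_gt0/= (le_trans tt1)// (le_trans t1t).
  have px' : 0 < f x t + z x t - K * v x t by [].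
  have z0 : 0 < z x t by move: px' fKv; slra.
  have h1' : n2 x < R3 * t.
    by rewrite lt_neqAle h1 andbT; apply/eqP => E; move: z0; rewrite /z E subrr !mulr0 ltxx.
  have h2' : t0 < t.
    by rewrite lt_neqAle h2 andbT; apply/eqP => E; move: z0; rewrite /z E subrr mul0r mulr0 ltxx.
  split; first by rewrite GL h1' h2'.
  pose dz := k * (R3 * t - n2 x + (t - t0) * (R3 + 2 * N%:R)).
  have hz : heat z x t dz.
    have d1 : is_derive t 1 (fun t => R3 * t) R3.
      by apply: is_derive_eq; rewrite /GRing.scale/=; ring.
    have d2 : is_derive t 1 (fun t => t - t0) 1.
      by apply: is_derive_eq; rewrite subr0.
    have := heatZ k (heatM d2 (heatB (heat_time x d1) (heat_n2 x t))).
    by congr heat; rewrite /dz; ring.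
  exists (- A t (f x t) + dz - K * - A t (v x t)).
    by apply: heatB; [exact: heatD|exact: heatZ].
  have n2x := n2_ge0 x.
  have dzD : dz <= e1 * D * (t0 `^ (- g) / t0).
    have -> : e1 * D * (t0 `^ (- g) / t0) = k * (t0 * D).
      by rewrite kE; field; rewrite gt_eqF.
    have a1 : R3 * t <= R3 * (2 * t0) by rewrite ler_pM2l// -t12.
    have a2 : (t - t0) * (R3 + 2 * N%:R) <= t0 * (R3 + 2 * N%:R).
      by apply: ler_wpM2r; [move: R30 N0; slra|move: tt1; rewrite t12; slra].
    rewrite /dz ler_pM2l// DE; by move: a1 a2 n2x; slra.
  have pt : 0 < t0 `^ (- g) by exact: powR_gt0.
  have tg : 2 `^ (- g) * t0 `^ (- g) <= t `^ (- g).
    rewrite -powRM ?(ltW t00)// -t12 !powRN lef_pV2 ?posrE ?powR_gt0//.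
    by apply: ge0_ler_powR; rewrite ?nnegrE ?(ltW g0) ?(ltW t10) ?(ltW t_gt0).
  have vc1 : c * t `^ (- g) <= v x t by apply: vc => //; rewrite t_gt0/= (le_trans tt1)// (le_trans t1t).
  have vc2 : c' * t0 `^ (- g) <= v x t.
    by apply: le_trans vc1; rewrite c'E -mulrA ler_pM2l.
  have zle : z x t <= (K0 - K1) * v x t.
    apply: (@le_trans _ _ (2 * R3 * e1 * t0 `^ (- g))).
      have -> : 2 * R3 * e1 * t0 `^ (- g) = 2 * R3 * (k * t0 * t0) by rewrite ktt; ring.
      rewrite /z (_ : 2 * R3 * _ = k * (t0 * (R3 * (2 * t0)))); last by ring.
      have a1 : R3 * t <= R3 * (2 * t0) by rewrite ler_pM2l// -t12.
      rewrite ler_pM2l//; apply: ler_pM; rewrite ?subr_ge0//; [by move: tt1; rewrite t12; slra|by move: a1 n2x; slra].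
    apply: (@le_trans _ _ (c' * (K0 - K1) * t0 `^ (- g))); first by rewrite ler_pM2r.
    rewrite mulrAC mulrC ler_pM2l ?subr_gt0//.
  (* Positivity of phi forces f > K v - z >= K1 v. The absorption of f is then at least K1^q times
     that of v, which exceeds K times it by the margin mu. *)
  have fK1 : K1 * v x t <= f x t.
    have : K0 * v x t <= K * v x t by rewrite ler_pM2r.
    by move: px' zle; slra.
  have AfK1 : K1 `^ q * A t (v x t) <= A t (f x t).
    rewrite -absorbM ?(ltW v0)//; apply: absorb_le => //; by rewrite mulr_ge0 ?(ltW v0).
  have Av : c' * c `^ (q - 1) / 2 * (t0 `^ (- g) / t0) <= A t (v x t).
    rewrite (absorb_scale alpha q_gt1 t_gt0 v0).
    have -> : c' * c `^ (q - 1) / 2 * (t0 `^ (- g) / t0) =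
        c' * t0 `^ (- g) / t1 * c `^ (q - 1) by rewrite t12; field; rewrite gt_eqF.
    apply: ler_pM.
    + by rewrite divr_ge0 ?(ltW t10)// mulr_ge0 ?(ltW c'0) ?(ltW pt).
    + exact: powR_ge0.
    + apply: ler_pM => //; first by rewrite mulr_ge0 ?(ltW c'0) ?(ltW pt).
        by rewrite invr_ge0 ltW.
      by rewrite lef_pV2 ?posrE.
    + apply: ge0_ler_powR; rewrite ?nnegrE ?(ltW q10) ?(ltW c_gt0)//.
        by rewrite mulr_ge0 ?powR_ge0 ?(ltW v0).
      have : t `^ g * (c * t `^ (- g)) <= t `^ g * v x t by rewrite ler_pM2l// powR_gt0.
      by rewrite mulrCA (powg_mul alpha q t_gt0) mulr1.
  have A0 : 0 < A t (v x t) by exact: absorb_gt0.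
  have pp : 0 < t0 `^ (- g) / t0 by rewrite divr_gt0.
  have m1 : mu * A t (v x t) <= (K1 `^ q - K) * A t (v x t).
    by rewrite ler_pM2r//; move: KK1; rewrite muE; slra.
  have m2 : mu * (c' * c `^ (q - 1) / 2 * (t0 `^ (- g) / t0)) <= mu * A t (v x t).
    by rewrite ler_pM2l.
  have m3 : e1 * D * (t0 `^ (- g) / t0) < P * (t0 `^ (- g) / t0) by rewrite ltr_pM2r.
  have m4 : P * (t0 `^ (- g) / t0) = mu * (c' * c `^ (q - 1) / 2 * (t0 `^ (- g) / t0)).
    by rewrite PE; ring.
  by move: AfK1 m1 m2 m3 m4 dzD; slra.
- by rewrite GE (le_trans x0R) ?ler_pM2r ?(ltW R23)//= t12; move: t00; slra.
Qed.

Lemma sol_bounded_ratio Cf c tau (f v : X -> R -> R) r : gauss_sol alpha q rho T Cf f ->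
  0 < c -> 0 < tau -> 0 < r ->
  (forall x t, 0 < t <= tau -> n2 x <= r * t -> c * t `^ (- g) <= v x t) ->
  exists2 K, 1 <= K & exists2 tau', 0 < tau' & forall x t, 0 < t <= tau' ->
    n2 x <= r * t -> f x t <= K * v x t.
Proof.
move=> Hf c_gt0 tau0 r0 vc; exists (1 + `|Cf| / c).
  by rewrite lerDl divr_ge0// ltW.
exists (Num.min (Num.min T tau) (rho / r)).
  by rewrite !lt_min T_gt0 tau0 divr_gt0.
move=> x t /andP[t0]; rewrite !le_min => /andP[/andP[tT tt]].
rewrite ler_pdivlMr// mulrC => tr xr.
have [_ f0 _ fC] := Hf x t (introT andP (conj t0 tT)) (le_trans xr tr).
have h1 := vc x t (introT andP (conj t0 tt)) xr.
have tg : 0 < t `^ (- g) by exact: powR_gt0.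
have h2 : f x t <= `|Cf| * t `^ (- g).
  apply: (le_trans fC); apply: (@le_trans _ _ (`|Cf| * gauss g c0 0 0 x t)).
    by rewrite ler_pM2r ?gauss_gt0// ler_norm.
  by apply: ler_wpM2l => //; apply: gauss_le_pow => //; exact/ltW/c0_gt0.
have h3 : `|Cf| / c * (c * t `^ (- g)) <= `|Cf| / c * v x t.
  by apply: ler_wpM2l => //; rewrite divr_ge0// ltW.
have h4 : `|Cf| / c * (c * t `^ (- g)) = `|Cf| * t `^ (- g).
  by field; rewrite gt_eqF.
have v0 : 0 < v x t by apply: lt_le_trans h1; rewrite mulr_gt0.
lra.
Qed.

(** The infimum K0 of the admissible ratios on |x|^2 <= R3 t is shown to be 1. [sol_improve] gains a
    fixed e but retreats to |x|^2 <= R2 t; [spread] goes back to a ball, which contains the wider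
    paraboloid for small t, at an arbitrarily small cost. If K0 > 1 the net gain contradicts the
    infimum. *)
Theorem sol_ratio_le Cf Cv (f v : X -> R -> R) : gauss_sol alpha q rho T Cf f ->
  gauss_sol alpha q rho T Cv v -> 0 <= Cf ->
  (forall r, 0 < r -> exists2 c, 0 < c & exists2 tau, 0 < tau &
    forall x t, 0 < t <= tau -> n2 x <= r * t -> c * t `^ (- g) <= v x t) ->
  forall d, 0 < d -> exists2 tau, 0 < tau & forall x t, 0 < t <= tau ->
    n2 x <= c0 * rho -> f x t <= (1 + d) * v x t.
Proof.
move=> Hf Hv Cf0 vlow.
have R20 : 0 < R2 by have := R2_gt0 alpha_gt q_gt1 R2_ge.
pose R3 := R2 + 1; have R23 : R2 < R3 by rewrite /R3; lra.
have R30 : 0 < R3 by lra.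
have [c c_gt0 [tauc tauc0 vc]] := vlow R3 R30.
have negl : forall d, 0 < d -> exists2 tau, 0 < tau <= T & forall x t,
    0 < t <= tau -> n2 x <= c0 * rho -> Cf * edge t <= d * v x t.
  pose tau1 := Num.min T tauc.
  have tau1I : 0 < tau1 <= T by rewrite lt_min T_gt0 tauc0 ge_min lexx.
  have [c1 c10 H1] : exists2 c1, 0 < c1 & forall x t, 0 < t <= tau1 -> n2 x <= rho ->
      c1 * gauss g 4^-1 0 0 x t <= v x t + c1 * edge t.
    apply: (gauss_lower Hv c_gt0 tau1I) => x t /andP[t0 tt] xR _; apply: vc.
      by rewrite t0 (le_trans tt)// ge_min lexx orbT.
    by apply: (le_trans xR); rewrite ler_pM2r//; lra.
  move=> d d0; have [tau10 tau1T] := andP tau1I.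
  have [|tau /andP[tau0 taut] H] := gauss_edge_negligible c10 tau10 H1 (d := d / (Cf + 1)).
    by rewrite divr_gt0//; lra.
  exists tau; first by rewrite tau0 (le_trans taut).
  move=> x t tI xr; have := H x t tI xr => h.
  have M0 : 0 < edge t by apply: gauss_edge_gt0; case/andP: tI.
  rewrite mulrAC ler_pdivlMr in h; last lra.
  nra.
pose adm K := 1 <= K /\ exists2 tau, 0 < tau & forall x t, 0 < t <= tau ->
    n2 x <= R3 * t -> f x t <= K * v x t.
have spread K tau d : 1 <= K -> 0 < tau <= T -> 0 < d ->
    (forall x t, 0 < t <= tau -> n2 x <= R2 * t -> n2 x <= rho -> f x t <= K * v x t) ->
    exists2 tau', 0 < tau' <= tau & forall x t, 0 < t <= tau' ->
      n2 x <= c0 * rho -> f x t <= (K + d) * v x t.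
  move=> K1 /andP[tau0 tauT] d0 H.
  have [tau' /andP[tau'0 tau'T] Hn] := negl d d0.
  exists (Num.min tau tau'); first by rewrite lt_min tau0 tau'0 ge_min lexx.
  move=> x t /andP[t0]; rewrite le_min => /andP[tt tt'] xr.
  have xr' : n2 x <= rho.
    by apply: (le_trans xr); rewrite ger_pMl// /c0 invf_le1 ?ler1n ?ltr0n.
  have h1 : f x t <= K * v x t + Cf * edge t.
    by apply: (sol_spread Hf Hv Cf0 K1 _ H) => //; rewrite ?tau0 ?t0.
  have h2 := Hn x t (introT andP (conj t0 tt')) xr.
  lra.
have shrink r (tau : R) : 0 < r -> 0 < tau -> exists2 tau' : R, 0 < tau' <= tau &
    forall t, t <= tau' -> r * t <= c0 * rho.
  move=> r0 tau0; exists (Num.min tau (c0 * rho / r)).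
    by rewrite lt_min tau0 ge_min lexx divr_gt0// mulr_gt0// c0_gt0.
  by move=> t; rewrite le_min => /andP[_]; rewrite ler_pdivlMr// mulrC.
have adm_spread K tau d : 1 <= K -> 0 < tau <= T -> 0 < d ->
    (forall x t, 0 < t <= tau -> n2 x <= R2 * t -> n2 x <= rho -> f x t <= K * v x t) ->
    adm (K + d).
  move=> K1 tauI d0 H; split; first by lra.
  have [tau' /andP[tau'0 _] H'] := spread K tau d K1 tauI d0 H.
  have [tau2 /andP[tau20 tau2t] Hs] := shrink R3 tau' R30 tau'0.
  exists tau2 => // x t /andP[t0 tt] xr; apply: H'.
    by rewrite t0 (le_trans tt).
  by apply: (le_trans xr); exact: Hs.
have adm_ne : [set K | adm K] !=set0.
  have [K K1 HK] := sol_bounded_ratio Hf c_gt0 tauc0 R30 vc.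
  by exists K.
have adm_lb : has_lbound [set K | adm K] by exists 1 => K -[].
pose K0 := inf [set K | adm K].
have K01 : 1 <= K0 by apply: lb_le_inf => // K -[].
have K0lb K : adm K -> K0 <= K by move=> ?; apply: ge_inf.
have adm_near e : 0 < e -> exists2 K, adm K & K < K0 + e.
  by move=> e0; have [|K HK KK] := @inf_adherent _ [set K | adm K] e e0; [|exists K].
have K0E : K0 = 1.
  apply/eqP; rewrite eq_le K01 andbT leNgt; apply/negP => K0gt.
  have [d [e [d0 e0 imp]]] := sol_improve Hf Hv c_gt0 tauc0 R23 K0gt vc.
  have [|K [K1 [tau tau0 HK]] KK] := adm_near (Num.min d (e / 2)).
    by rewrite lt_min d0 divr_gt0.
  have Kd : K <= K0 + d.
    by apply: (le_trans (ltW KK)); rewrite lerD2l ge_min lexx.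
  have Ke : K < K0 + e / 2.
    by apply: (lt_le_trans KK); rewrite lerD2l ge_min lexx orbT.
  have KI : K0 <= K <= K0 + d by rewrite Kd K0lb//; split=> //; exists tau.
  have [tau' tau'I H'] := imp K tau KI tau0 HK.
  (* K v is a supersolution for K >= 1 only, hence the maximum. *)
  pose K1' := Num.max 1 (K - e).
  have K1'1 : 1 <= K1' by rewrite le_max lexx.
  have K1'0 : K1' < K0 by rewrite gt_max K0gt/=; lra.
  have : adm (K1' + (K0 - K1') / 2).
    apply: (adm_spread _ tau') => //; first by lra.
    move=> x t tI xR xr; apply: (le_trans (H' x t tI xR)).
    have [_ v0 _ _] : [/\ True, 0 < v x t, True & True].
      have tIT : 0 < t <= T.
        by have [t0 tt] := andP tI; rewrite t0 (le_trans tt)//; case/andP: tau'I.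
      by have [] := Hv x t tIT xr.
    by rewrite ler_pM2r// le_max lexx orbT.
  move=> /K0lb; lra.
move=> d d0.
have [|K [K1 [tau tau0 HK]] KK] := adm_near (d / 2); first by lra.
have [|||tau' /andP[tau'0 _] H] := spread K (Num.min T tau) (d / 2) K1.
- by rewrite lt_min T_gt0 tau0 ge_min lexx.
- by rewrite divr_gt0.
- move=> x t /andP[t0]; rewrite le_min => /andP[_ tt] xR _.
  apply: HK; first by rewrite t0.
  by apply: (le_trans xR); rewrite ler_pM2r//; lra.
exists (Num.min T tau') => [|x t /andP[t0]]; first by rewrite lt_min T_gt0.
rewrite le_min => /andP[tT tt] xr.
apply: (le_trans (H x t (introT andP (conj t0 tt)) xr)).
have xr' : n2 x <= rho.
  by apply: (le_trans xr); rewrite ger_pMl// /c0 invf_le1 ?ler1n ?ltr0n.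
have [_ v0 _ _] := Hv x t (introT andP (conj t0 tT)) xr'.
rewrite ler_pM2r//; lra.
Qed.

End upper.

(** * Interior Lipschitz estimate by reflection *)

Section polynomial_barriers.
Variables (R : realType) (N : nat).
Notation X := 'rV[R]_N.
Implicit Types (x y c : X) (t : R).

Lemma sdiff_opp (f : R -> R) L : sdiff f L -> sdiff (fun h => f (- h)) L.
Proof.
move=> H; apply: cvg_trans H; apply: near_eq_cvg; apply: nearW => h /=.
by rewrite opprK oppr0; congr (_ / _); ring.
Qed.

Lemma sdiff_quad (a b c : R) : sdiff (fun h => a + b * h + c * h ^+ 2) (2 * c).
Proof.
apply: (@sdiff_of_derive _ _ (fun h => b + 2 * c * h)).
  by apply: filterE => h; apply: is_derive_eq; rewrite /GRing.scale/=; ring.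
by apply: is_derive_eq; rewrite /GRing.scale/=; ring.
Qed.

Lemma heat_shift_n2 c x t : heat (fun x _ => n2 (x - c)) x t (- (2 * N%:R)).
Proof.
exists 0, (fun=> 2); split; first exact: is_derive_cst.
- move=> i; rewrite /sd (_ : (fun h => _) = (fun h => n2 (x - c) + 2 * (x - c) 0 i * h + 1 * h ^+ 2)).
    by have := @sdiff_quad (n2 (x - c)) (2 * (x - c) 0 i) 1; rewrite mulr1.
  by apply/funext => h; rewrite mul1r -n2_line addrAC.
- by rewrite sumr_const card_ord -mulr_natr; ring.
Qed.

Lemma heat_coord i (a : R) x t : heat (fun x _ => x 0 i - a) x t 0.
Proof.
exists 0, (fun=> 0); split; first exact: is_derive_cst.
- move=> j; rewrite /sd (_ : (fun h => _) = (fun h => (x 0 i - a) + (i == j)%:R * h + 0 * h ^+ 2)).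
    by have := @sdiff_quad (x 0 i - a) (i == j)%:R 0; rewrite mulr0.
  by apply/funext => h; rewrite !mxE eqxx/=; ring.
- by rewrite big1// subr0.
Qed.

Lemma heat_coord2 i (a : R) x t : heat (fun x _ => (x 0 i - a) ^+ 2) x t (- 2).
Proof.
exists 0, (fun j => 2 * (i == j)%:R); split; first exact: is_derive_cst.
- move=> j; rewrite /sd (_ : (fun h => _) = (fun h => (x 0 i - a) ^+ 2 + 2 * (x 0 i - a) * (i == j)%:R * h + (i == j)%:R * h ^+ 2)).
    exact: sdiff_quad.
  apply/funext => h; rewrite !mxE eqxx/=; case: (i == j) => /=; ring.
- rewrite -mulr_sumr (bigD1 i)//= eqxx big1 ?addr0 ?mulr1 ?sub0r// => j ji.
  by rewrite eq_sym (negbTE ji).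
Qed.

(** Reflection in the hyperplane x_i = a. *)
Definition mirror i (a : R) x : X := x + (2 * (a - x 0 i)) *: ebasis R i.

Lemma n2_mirror i a x c : c 0 i = a -> n2 (mirror i a x - c) = n2 (x - c).
Proof.
move=> ca; apply: eq_bigr => j _; rewrite !mxE eqxx/=.
by case: eqP => [->|_]; rewrite ?mulr0 ?addr0// mulr1 ca; ring.
Qed.

Lemma heat_mirror i a (f : X -> R -> R) x t d :
  heat f (mirror i a x) t d -> heat (fun x t => f (mirror i a x) t) x t d.
Proof.
move=> [b [L [h1 h2 ->]]]; exists b, L; split=> // j.
have E h : (x + h *: ebasis R j) 0 i = x 0 i + h * (i == j)%:R.
  by rewrite !mxE eqxx.
have [ji|ji] := eqVneq j i.
  have := sdiff_opp (h2 j); congr sdiff; apply/funext => h /=; congr (f _ t).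
  rewrite /mirror E ji eqxx mulr1 -!addrA; congr (_ + _).
  by rewrite -!scalerDl; congr (_ *: _); ring.
have := h2 j; congr sdiff; apply/funext => h /=; congr (f _ t).
rewrite /mirror E [i == j]eq_sym (negbTE ji) mulr0 addr0.
by rewrite addrAC.
Qed.

Lemma coord_cont i x : {for x, continuous (fun x : X => x 0 i)}.
Proof. exact: coord_continuous. Qed.

Lemma continuous_coordp i (p : X * R) :
  {for p, continuous (fun p : X * R => p.1 0 i)}.
Proof. by case: p => x t; apply: (@cont_space _ _ (fun x : X => x 0 i)); exact: coord_cont. Qed.

Lemma continuous_mirror i a x t : {for (x, t), continuous (fun p : X * R => (mirror i a p.1, p.2))}.
Proof.
have h1 : (fun p : X * R => mirror i a p.1) @ nbhs (x, t) --> mirror i a x.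
  apply: cvgD; first exact: cvg_fst.
  apply: cvgZl; apply: cvgM; first exact: cvg_cst.
  by have ci := @continuous_coordp i (x, t); exact: (cvgB (cvg_cst a) ci).
have h2 : (fun p : X * R => p.2) @ nbhs (x, t) --> t by exact: cvg_snd.
exact: (cvg_pair h1 h2).
Qed.

Lemma continuous_n2_sub c (p : X * R) : {for p, continuous (fun p : X * R => n2 (p.1 - c))}.
Proof.
case: p => x t; apply: (@cont_space _ _ (fun x => n2 (x - c))).
apply: (@continuous_comp _ _ _ (fun x : X => x - c) (@n2 R N)); last exact: n2_continuous.
have h1 : (@id X) @ nbhs x --> x by exact: cvg_id.
exact: (cvgB h1 (cvg_cst c)).
Qed.

(** Chosen so that 2 lip_const - 2 N - 1 = 3: the heat operator of the barrier is 3 B / r^2, above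
    the 2 B / r^2 that the difference of f and its mirror image can reach. *)
Definition lip_const : R := N%:R + 2.

(* The difference of [f] and its mirror image vanishes on the mirror hyperplane;
   there the polynomial barrier [b] controls its slope. *)
Lemma coord_lipschitz (f : X -> R -> R) c i r B t0 : 0 < r -> 0 < B -> r ^+ 2 <= t0 ->
  (forall x t, n2 (x - c) <= r ^+ 2 -> t0 - r ^+ 2 <= t <= t0 ->
    [/\ {for (x, t), continuous (fun p : X * R => f p.1 p.2)}, 0 <= f x t <= B &
        exists2 d, heat f x t d & `|d| <= B / r ^+ 2]) ->
  forall h, 0 <= h <= r ->
    f (c + h *: ebasis R i) t0 - f (c - h *: ebasis R i) t0 <= B * (lip_const * (h / r)).
Proof.
move=> r0 B0 rt0 Hf h /andP[h_ge0 hr].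
set a := c 0 i.
pose z x t := f x t - f (mirror i a x) t.
pose b x t := B / r ^+ 2 * (n2 (x - c) + lip_const * (r * (x 0 i - a)) - lip_const * (x 0 i - a) ^+ 2 + (t0 - t)).
pose phi x t := z x t - b x t.
pose G x t := Num.max (Num.max (n2 (x - c) - r ^+ 2) (a - x 0 i)) (t0 - r ^+ 2 - t).
have r20 : 0 < r ^+ 2 by rewrite exprn_gt0.
have Br0 : 0 < B / r ^+ 2 by rewrite divr_gt0.
have GE x t : G x t <= 0 = [&& n2 (x - c) <= r ^+ 2, a <= x 0 i & t0 - r ^+ 2 <= t].
  by rewrite /G !ge_max !subr_le0 andbA.
have GL x t : G x t < 0 = [&& n2 (x - c) < r ^+ 2, a < x 0 i & t0 - r ^+ 2 < t].
  by rewrite /G !gt_max !subr_lt0 andbA.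
have K2 : 2 <= lip_const by rewrite /lip_const lerDr.
have coordr x : n2 (x - c) <= r ^+ 2 -> a <= x 0 i -> x 0 i - a <= r.
  move=> xr xa; rewrite -(@ler_pXn2r _ 2) ?nnegrE ?subr_ge0 ?(ltW r0)//.
  by apply: le_trans xr; have := coord_le_n2 (x - c) i; rewrite !mxE.
have bge x t : n2 (x - c) <= r ^+ 2 -> a <= x 0 i -> t <= t0 ->
    B / r ^+ 2 * (n2 (x - c) + (t0 - t)) <= b x t.
  move=> xr xa tt; rewrite /b ler_pM2l//.
  have := coordr x xr xa; set y := x 0 i - a => yr.
  have y0 : 0 <= y by rewrite subr_ge0.
  have : y ^+ 2 <= r * y by rewrite expr2 ler_wpM2r.
  have : 0 <= lip_const by lra.
  move=> k0 k1; have := ler_wpM2l k0 k1; lra.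
have reflr x : n2 (x - c) <= r ^+ 2 -> n2 (mirror i a x - c) <= r ^+ 2.
  by rewrite n2_mirror.
have n2h : n2 (c + h *: ebasis R i - c) = h ^+ 2.
  rewrite addrAC subrr add0r; have := n2_line (0 : X) i h; rewrite add0r => ->.
  by rewrite mxE mulr0 mul0r /n2 big1 ?add0r// => j _; rewrite mxE expr0n.
have ch : (c + h *: ebasis R i) 0 i = a + h by rewrite !mxE !eqxx mulr1.
suff : phi (c + h *: ebasis R i) t0 <= 0.
  have E : mirror i a (c + h *: ebasis R i) = c - h *: ebasis R i.
    rewrite /mirror ch -addrA; congr (_ + _).
    by rewrite -scalerDl -scaleNr; congr (_ *: _); ring.
  rewrite /phi /z E /b n2h ch => H.
  have -> : B * (lip_const * (h / r)) = B / r ^+ 2 * (lip_const * (r * h)) by field; rewrite gt_eqF.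
  have : 0 <= B / r ^+ 2 * ((lip_const - 1) * h ^+ 2).
    by apply: mulr_ge0; [exact: ltW|apply: mulr_ge0; [lra|exact: sqr_ge0]].
  lra.
apply: (@maxprin _ _ G phi (2 * r ^+ 2 + 2 * n2 c) t0) => //.
- move=> p; apply: continuous_maxr; [apply: continuous_maxr|].
  + by apply: cvgB; [exact: continuous_n2_sub|exact: cvg_cst].
  + by apply: cvgB; [exact: cvg_cst|exact: continuous_coordp].
  + by apply: cvgB; [exact: cvg_cst|exact: continuous_snd].
- move=> x t; rewrite GE => /and3P[h1 h2 h3] tt; split; last by lra.
  have := n2D_le (x - c) c; rewrite subrK => h4; lra.
- move=> x t; rewrite GE => /and3P[h1 h2 h3] tt.
  have tI : t0 - r ^+ 2 <= t <= t0 by rewrite h3.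
  have [cf _ _] := Hf x t h1 tI; have [cr _ _] := Hf _ t (reflr x h1) tI.
  apply: cvgB.
    apply: cvgB; first exact: cf.
    by apply: (@continuous_comp _ _ _ (fun p : X * R => (mirror i a p.1, p.2)) (fun p => f p.1 p.2)) => //; exact: continuous_mirror.
  have ci : {for (x, t), continuous (fun p : X * R => p.1 0 i - a)}.
    by apply: cvgB; [exact: continuous_coordp|exact: cvg_cst].
  apply: cvgM; first exact: cvg_cst.
  apply: cvgD; last by apply: cvgB; [exact: cvg_cst|exact: continuous_snd].
  apply: cvgB.
    apply: cvgD; first exact: continuous_n2_sub.
    by apply: cvgM; [exact: cvg_cst|apply: cvgM; [exact: cvg_cst|exact: ci]].
  by apply: cvgM; [exact: cvg_cst|apply: cvgM; exact: ci].
- move=> x t; rewrite GE => /and3P[h1 h2 h3] tt px.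
  have tI : t0 - r ^+ 2 <= t <= t0 by rewrite h3.
  have [_ /andP[fx0 fxB] [d1 hd1 d1B]] := Hf x t h1 tI.
  have [_ /andP[fr0 frB] [d2 hd2 d2B]] := Hf _ t (reflr x h1) tI.
  have zB : z x t <= B by rewrite /z; lra.
  have bz : b x t < z x t by move: px; rewrite /phi subr_gt0.
  have bg := bge x t h1 h2 tt.
  have n2_xc := n2_ge0 (x - c).
  split.
    rewrite GL; apply/and3P; split.
    + rewrite lt_neqAle h1 andbT; apply/eqP => E.
      have : B <= B / r ^+ 2 * (n2 (x - c) + (t0 - t)).
        by rewrite E mulrDr divfK ?gt_eqF// lerDl mulr_ge0 ?(ltW Br0) ?subr_ge0.
      lra.
    + rewrite lt_neqAle h2 andbT; apply/eqP => E.
      have E2 : mirror i a x = x by rewrite /mirror -E subrr mulr0 scale0r addr0.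
      have : 0 <= B / r ^+ 2 * (n2 (x - c) + (t0 - t)).
        by rewrite mulr_ge0 ?(ltW Br0)// addr_ge0// subr_ge0.
      move: bz; rewrite /z E2 subrr; lra.
    + rewrite lt_neqAle h3 andbT; apply/eqP => E.
      have : B <= B / r ^+ 2 * (n2 (x - c) + (t0 - t)).
        have -> : t0 - t = r ^+ 2 by rewrite -E; ring.
        rewrite mulrDr divfK ?gt_eqF// lerDr.
        by rewrite mulr_ge0 ?(ltW Br0).
      lra.
  exists (d1 - d2 - B / r ^+ 2 * (- (2 * N%:R) + lip_const * (r * 0) - lip_const * (- 2) + (- 1))).
    apply: heatB; first by apply: heatB => //; exact: heat_mirror.
    apply: heatZ; apply: heatD; last first.
      apply: (heat_time (m := fun t => t0 - t)).
      by rewrite -[X in is_derive _ _ _ X]sub0r; apply: is_deriveB.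
    apply: heatB; last by apply: heatZ; exact: heat_coord2.
    apply: heatD; first exact: heat_shift_n2.
    by do 2 apply: heatZ; exact: heat_coord.
  have -> : - (2 * N%:R) + lip_const * (r * 0) - lip_const * -2 + -1 = 3 :> R by rewrite /lip_const; ring.
  have := ler_norm d1; have := ler_norm (- d2); rewrite normrN; lra.
- rewrite GE n2h ch lerDl h_ge0/=; apply/andP; split; last by lra.
  by rewrite ler_pXn2r ?nnegrE ?(ltW r0).
Qed.

(** The two points are mirror images in the hyperplane through their midpoint. The opposite
    inequality comes from B - f, which satisfies the same hypotheses. *)
Lemma coord_lipschitz_abs (f : X -> R -> R) p i (dl r B t0 : R) : 0 < r -> 0 < B ->
  r ^+ 2 <= t0 -> `|dl| <= r ->
  (forall x t, n2 (x - (p + (dl / 2) *: ebasis R i)) <= r ^+ 2 ->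
    t0 - r ^+ 2 <= t <= t0 ->
    [/\ {for (x, t), continuous (fun p : X * R => f p.1 p.2)}, 0 <= f x t <= B &
        exists2 d, heat f x t d & `|d| <= B / r ^+ 2]) ->
  `|f (p + dl *: ebasis R i) t0 - f p t0| <= B * (lip_const * (`|dl| / r)).
Proof.
move=> r0 B0 rt0 dlr Hf; set c := p + _ *: _ in Hf.
have K0 : 0 <= lip_const by rewrite /lip_const addr_ge0 ?ler0n.
pose h := `|dl| / 2.
have hI : 0 <= h <= r by rewrite /h divr_ge0//=; have := normr_ge0 dl; lra.
have E1 : p + dl *: ebasis R i = c + (dl / 2) *: ebasis R i.
  by rewrite /c -addrA -scalerDl; congr (_ + _ *: _); field.
have E2 : p = c - (dl / 2) *: ebasis R i by rewrite /c addrK.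
have main := coord_lipschitz i r0 B0 rt0 Hf hI.
have Bh : B * (lip_const * (h / r)) <= B * (lip_const * (`|dl| / r)).
  apply: ler_wpM2l; first exact: ltW.
  apply: ler_wpM2l => //; rewrite ler_pM2r ?invr_gt0// /h.
  by rewrite ler_pdivrMr// ler_peMr// ler1n.
have mainN : f (c - h *: ebasis R i) t0 - f (c + h *: ebasis R i) t0 <= B * (lip_const * (h / r)).
  pose f' x t := B - f x t.
  have := @coord_lipschitz f' c i r B t0 r0 B0 rt0 _ h hI; rewrite /f'.
  have HH : forall x t, n2 (x - c) <= r ^+ 2 -> t0 - r ^+ 2 <= t <= t0 ->
    [/\ {for (x, t), continuous (fun p : X * R => f' p.1 p.2)}, 0 <= f' x t <= B &
        exists2 d, heat f' x t d & `|d| <= B / r ^+ 2].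
    move=> x t xr tI; have [cf /andP[f0 fB] [d hd dB]] := Hf x t xr tI; split.
    - by apply: cvgB; [exact: cvg_cst|exact: cf].
    - by rewrite /f'; apply/andP; split; lra.
    - exists (0 - d); last by rewrite sub0r normrN.
      apply: heatB => //; apply: (heat_time (m := fun=> B)); exact: is_derive_cst.
  by move=> /(_ HH); lra.
rewrite E1 {1}E2 ler_norml; case: (lerP 0 dl) => dl0.
  have hE : h = dl / 2 by rewrite /h ger0_norm.
  by rewrite -hE; apply/andP; split; lra.
have hE : dl / 2 = - h by rewrite /h ltr0_norm// mulNr opprK.
by rewrite hE scaleNr opprK; apply/andP; split; lra.
Qed.

(** x0 is joined to x by changing one coordinate at a time. The midpoints of the steps satisfy |c -
    x0|^2 <= 3 r^2, so the balls of radius r around them lie in |y - x0|^2 <= 8 r^2. *)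
Lemma ball_lipschitz (f : X -> R -> R) x x0 (s r B t0 : R) : 0 < r -> 0 < B ->
  r ^+ 2 <= t0 -> 0 <= s <= r -> n2 (x - x0) <= s ^+ 2 ->
  (forall y t, n2 (y - x0) <= 8 * r ^+ 2 -> t0 - r ^+ 2 <= t <= t0 ->
    [/\ {for (y, t), continuous (fun p : X * R => f p.1 p.2)}, 0 <= f y t <= B &
        exists2 d, heat f y t d & `|d| <= B / r ^+ 2]) ->
  `|f x t0 - f x0 t0| <= N%:R * (B * (lip_const * (s / r))).
Proof.
move=> r0 B0 rt0 /andP[s0 sr] xs Hf.
have K0 : 0 <= lip_const by rewrite /lip_const addr_ge0 ?ler0n.
have sr2 : s ^+ 2 <= r ^+ 2 by rewrite ler_pXn2r ?nnegrE ?(ltW r0).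
pose P k : X := \row_j (if (j < k)%N then x 0 j else x0 0 j).
have PN : P N = x by apply/rowP => j; rewrite mxE ltn_ord.
have P0 : P 0%N = x0 by apply/rowP => j; rewrite mxE ltn0.
have Pd k : n2 (P k - x0) <= s ^+ 2.
  apply: le_trans xs; apply: ler_sum => j _; rewrite !mxE.
  by case: ifP => // _; rewrite subrr expr0n sqr_ge0.
suff main k : (k <= N)%N ->
    `|f (P k) t0 - f x0 t0| <= k%:R * (B * (lip_const * (s / r))).
  by have := main N (leqnn N); rewrite PN.
elim: k => [_|k IH kN]; first by rewrite P0 subrr normr0 mul0r.
pose i := Ordinal kN; pose dl := x 0 i - x0 0 i.
have PS : P k.+1 = P k + dl *: ebasis R i.
  apply/rowP => j; rewrite !mxE eqxx/=; have [->|ji] := eqVneq j i.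
    by rewrite /= ltnSn ltnn mulr1 /dl; ring.
  rewrite mulr0 addr0 ltnS leq_eqVlt; case: eqP => [jk|//].
  by move: ji; rewrite -val_eqE/= jk eqxx.
have dls : `|dl| <= s.
  have := coord_le_n2 (x - x0) i; rewrite !mxE -/dl => h.
  rewrite -(@ler_pXn2r _ 2) ?nnegrE// real_normK ?num_real//.
  exact: le_trans xs.
have step : `|f (P k.+1) t0 - f (P k) t0| <= B * (lip_const * (`|dl| / r)).
  rewrite PS; apply: coord_lipschitz_abs => //; first exact: le_trans sr.
  move=> y t yr tI; apply: Hf => //.
  set c := P k + (dl / 2) *: ebasis R i in yr.
  have n1 : n2 (c - x0) <= 3 * r ^+ 2.
    have -> : c - x0 = (P k - x0) + (dl / 2) *: ebasis R i by rewrite /c addrAC.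
    apply: (le_trans (n2D_le _ _)).
    have -> : n2 ((dl / 2) *: ebasis R i) = (dl / 2) ^+ 2.
      have := n2_line (0 : X) i (dl / 2); rewrite add0r => ->.
      by rewrite mxE mulr0 mul0r /n2 big1 ?add0r// => j _; rewrite mxE expr0n.
    have := Pd k; have : dl ^+ 2 <= s ^+ 2.
      by rewrite -(real_normK (num_real dl)) ler_pXn2r ?nnegrE.
    rewrite expr_div_n; lra.
  have -> : y - x0 = (y - c) + (c - x0) by rewrite addrA subrK.
  apply: (le_trans (n2D_le _ _)); lra.
have dls' : B * (lip_const * (`|dl| / r)) <= B * (lip_const * (s / r)).
  apply: ler_wpM2l; first exact: ltW.
  by apply: ler_wpM2l => //; rewrite ler_pM2r ?invr_gt0.
have -> : f (P k.+1) t0 - f x0 t0 = (f (P k.+1) t0 - f (P k) t0) + (f (P k) t0 - f x0 t0) by ring.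
apply: (le_trans (ler_normD _ _)); have := IH (ltnW kN).
rewrite -natr1; lra.
Qed.

End polynomial_barriers.

(** * Differences of two heat kernels *)

Section bump.
Variables (R : realType) (N : nat).
Notation X := 'rV[R]_N.
Notation hN := (N%:R / 2 : R).
Notation E := (gauss hN 4^-1).
Implicit Types (x y : X) (t s : R).

(* A solution of the heat equation that, at time [t0], is nonpositive away from
   [x0]: the second kernel is older and hence wider. *)
Definition gbump b x0 t0 x t : R :=
  E x0 (t0 - b * t0) x t - 2^-1 * E x0 (t0 - 2 * b * t0) x t.

Lemma hN_ge0 : 0 <= hN.
Proof. by rewrite divr_ge0. Qed.

Lemma heat_E y s x t : s < t -> heat (E y s) x t 0.
Proof.
move=> st; have := heat_gauss hN 4^-1 y x st.
by congr heat; rewrite mulfV ?pnatr_eq0// subrr mulr0 !mul0r addr0 (_ : 2 / 4 * _ = hN) ?addNr ?mulr0//; field.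
Qed.

Lemma heat_bump b x0 t0 x t : 0 < b <= 2^-1 -> 0 < t0 <= t ->
  heat (gbump b x0 t0) x t 0.
Proof.
move=> /andP[b0 b1] /andP[t00 tt].
have bt : 0 < b * t0 by exact: mulr_gt0.
have -> : 0 = 0 - 2^-1 * 0 :> R by ring.
apply: heatB; first by apply: heat_E; lra.
by apply: heatZ; apply: heat_E; lra.
Qed.

Lemma bump_le_E b x0 t0 x t : 0 < b <= 2^-1 -> 0 < t0 <= t ->
  gbump b x0 t0 x t <= E x0 (t0 - b * t0) x t.
Proof.
move=> /andP[b0 b1] /andP[t00 tt]; rewrite /gbump gerBl mulr_ge0// ltW// gauss_gt0//.
have : 0 < b * t0 by exact: mulr_gt0.
lra.
Qed.

Lemma E_le_pow y s x t : s < t -> E y s x t <= (t - s) `^ (- hN).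
Proof.
move=> st; rewrite /gauss ger_pMr ?powR_gt0 ?subr_gt0// -expR0 ler_expR oppr_le0.
by rewrite divr_ge0 ?mulr_ge0 ?n2_ge0 ?invr_ge0// subr_ge0 ltW.
Qed.

Lemma powRN_anti a t s : 0 <= a -> 0 < s -> s <= t -> t `^ (- a) <= s `^ (- a) :> R.
Proof.
move=> a0 s0 st; have t0 := lt_le_trans s0 st.
by rewrite !powRN lef_pV2 ?posrE ?powR_gt0// ge0_ler_powR ?nnegrE ?(ltW s0) ?(ltW t0).
Qed.

Lemma bump_time b t0 t : 0 < b <= 2^-1 -> 0 < t0 <= t ->
  b * t <= t - (t0 - b * t0) <= t.
Proof. by move=> /andP[b0 b1] /andP[t00 tt]; nra. Qed.

Lemma bump_le_pow b x0 t0 x t : 0 < b <= 2^-1 -> 0 < t0 <= t ->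
  gbump b x0 t0 x t <= b `^ (- hN) * t `^ (- hN).
Proof.
move=> bI tI; have [b0 _] := andP bI; have [t00 tt] := andP tI.
have [h1 h2] := andP (bump_time bI tI).
have t_gt0 : 0 < t by exact: lt_le_trans tt.
have bt : 0 < b * t by exact: mulr_gt0.
apply: (le_trans (bump_le_E _ _ bI tI)); apply: (@le_trans _ _ ((t - (t0 - b * t0)) `^ (- hN))).
  by apply: E_le_pow; rewrite -subr_gt0; exact: lt_le_trans h1.
rewrite -powRM ?(ltW b0) ?(ltW t_gt0)//; apply: powRN_anti => //; exact: hN_ge0.
Qed.

(** At time t0 the kernels have ages b t0 and 2 b t0, and the quotient of the younger by the older
    is 2^(N/2) exp(- |x - x0|^2 / (8 b t0)). *)
Lemma bump_le0 b x0 t0 s x : 0 < b <= 2^-1 -> 0 < t0 ->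
  2 `^ hN * expR (- (s / (8 * b))) <= 2^-1 -> s * t0 <= n2 (x - x0) ->
  gbump b x0 t0 x t0 <= 0.
Proof.
move=> /andP[b0 b1] t00 bs xs.
have bt : 0 < b * t0 by exact: mulr_gt0.
rewrite subr_le0 /gauss.
have -> : t0 - (t0 - b * t0) = b * t0 by ring.
have -> : t0 - (t0 - 2 * b * t0) = 2 * (b * t0) by ring.
rewrite (@powRM _ 2) ?ler0n ?(ltW bt)// (powRN 2).
set p := (b * t0) `^ _; have p0 : 0 < p by exact: powR_gt0.
set n := n2 _ in xs *.
set P := 2 `^ _ in bs *; have P0 : 0 < P by exact: powR_gt0.
have key : expR (- (4^-1 * n / (b * t0))) <=
    expR (- (4^-1 * n / (2 * (b * t0)))) * expR (- (s / (8 * b))).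
  rewrite -expRD ler_expR.
  have h3 : s / (8 * b) <= n / (8 * (b * t0)).
    have -> : s / (8 * b) = s * t0 / (8 * (b * t0)) by field; rewrite !gt_eqF.
    by rewrite ler_pM2r// invr_gt0 mulr_gt0.
  have -> : 4^-1 * n / (2 * (b * t0)) = n / (8 * (b * t0)) by field; rewrite !gt_eqF.
  have -> : 4^-1 * n / (b * t0) = 2 * (n / (8 * (b * t0))) by field; rewrite !gt_eqF.
  by move: h3; clear; lra.
set e1 := expR _ in key *; set e2 := expR (- (s / _)) in key bs; set e3 := expR _ in key *.
have e30 : 0 < e3 by exact: expR_gt0.
have -> : 2^-1 * (P^-1 * p * e3) = p * (e3 * (2^-1 / P)) by ring.
rewrite ler_pM2l//; apply: (le_trans key); rewrite ler_pM2l//.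
by rewrite ler_pdivlMr// mulrC.
Qed.

(** The function y^-a exp(- k / y) increases as long as a y <= k; here this follows from 1 + z <=
    exp z with z = t / y - 1. *)
Lemma powexp_mono (a k y t : R) : 0 <= a -> 0 < y -> y <= t -> a * t <= k ->
  y `^ (- a) * expR (- (k / y)) <= t `^ (- a) * expR (- (k / t)) :> R.
Proof.
move=> a0 y0 yt atk; have t0 := lt_le_trans y0 yt.
have h1 : (t / y) `^ a <= expR ((t / y - 1) * a).
  rewrite expRM; apply: ge0_ler_powR => //; rewrite ?nnegrE ?expR_ge0//.
    by rewrite divr_ge0 ?(ltW t0) ?(ltW y0).
  by apply: le_trans (expR_ge1Dx _); rewrite addrC subrK.
have h2 : (t / y - 1) * a <= k / y - k / t.
  have -> : k / y - k / t = (t / y - 1) * (k / t) by field; rewrite !gt_eqF.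
  apply: ler_wpM2l; first by rewrite subr_ge0 ler_pdivlMr// mul1r.
  by rewrite ler_pdivlMr.
have ya : 0 < y `^ a by exact: powR_gt0.
have ta : 0 < t `^ a by exact: powR_gt0.
have ty : t `^ a = (t / y) `^ a * y `^ a.
  by rewrite -powRM ?divfK ?gt_eqF ?divr_ge0 ?(ltW t0) ?(ltW y0).
have W0 : 0 < (t / y) `^ a by rewrite powR_gt0 ?divr_gt0.
have E0 := expR_gt0 (- (k / y)).
rewrite !powRN ty.
have -> : expR (- (k / t)) = expR (- (k / y)) * expR (k / y - k / t).
  by rewrite -expRD; congr expR; ring.
have -> : ((t / y) `^ a * y `^ a)^-1 * (expR (- (k / y)) * expR (k / y - k / t)) =
    (y `^ a)^-1 * expR (- (k / y)) * (expR (k / y - k / t) / (t / y) `^ a).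
  by field; rewrite !gt_eqF.
apply: ler_peMr; first by rewrite mulr_ge0 ?(ltW E0)// invr_ge0 ltW.
rewrite ler_pdivlMr// mul1r; apply: (le_trans h1); by rewrite ler_expR.
Qed.

(** Once t is large against t0 the two ages are nearly equal: the older kernel is at most 3 / 2 of
    the younger, and its factor 1 / 2 leaves a quarter of the latter. A bump concentrated near x0 at
    time t0 thus becomes a bound of order t^-(N/2) on a whole paraboloid. *)
Lemma bump_lower b x0 t0 r x t : 0 < b <= 2^-1 -> 0 < t0 -> 0 < r ->
  n2 x0 <= r * t0 -> n2 x <= r * t -> 2 * t0 <= t -> 12 * r * t0 <= t ->
  expR (- (2 * r)) / 4 * t `^ (- hN) <= gbump b x0 t0 x t.
Proof.
move=> bI t00 r0 x0r xr tt t12.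
have tI : 0 < t0 <= t by rewrite t00; move: t00 tt; clear; lra.
have t_gt0 : 0 < t by case/andP: tI => h1 h2; exact: lt_le_trans h2.
have [b0 b1] := andP bI.
have [_ s1t] := andP (bump_time bI tI).
have bt : 0 < b * t0 by exact: mulr_gt0.
have bt0 : b * t0 <= 2^-1 * t0 by rewrite ler_pM2r.
set y1 := t - (t0 - b * t0) in s1t *.
pose y2 := t - (t0 - 2 * b * t0).
have y1t : t / 2 <= y1 by rewrite /y1; move: tt bt; clear; lra.
have y12 : y2 = y1 + b * t0 by rewrite /y1 /y2; ring.
have y10 : 0 < y1 by move: y1t t_gt0; clear; lra.
have y20 : 0 < y2 by rewrite y12 addr_gt0.
pose n := n2 (x - x0).
have n0 : 0 <= n by exact: n2_ge0.
have nr : n <= 4 * r * t.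
  rewrite /n; apply: (le_trans (n2D_le _ _)); rewrite n2N.
  have : r * t0 <= r * t by rewrite ler_pM2l//; case/andP: tI.
  by move: x0r xr; clear; lra.
have G1ge : expR (- (2 * r)) * t `^ (- hN) <= E x0 (t0 - b * t0) x t.
  rewrite /gauss -/y1 mulrC; apply: ler_pM; rewrite ?powR_ge0 ?expR_ge0//.
    by apply: powRN_anti => //; exact: hN_ge0.
  rewrite ler_expR lerN2 -/n ler_pdivrMr// mulrC.
  have : r * (t / 2) <= r * y1 by rewrite ler_pM2l.
  by move: nr; clear; lra.
have G2le : E x0 (t0 - 2 * b * t0) x t <= 3 / 2 * E x0 (t0 - b * t0) x t.
  rewrite /gauss -/y1 -/y2 -/n.
  have h1 : y2 `^ (- hN) <= y1 `^ (- hN).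
    by apply: powRN_anti; rewrite ?hN_ge0// y12 lerDl ltW.
  have h2 : expR (- (4^-1 * n / y2)) <= 3 / 2 * expR (- (4^-1 * n / y1)).
    have z3 : 4^-1 * n / y1 - 4^-1 * n / y2 <= 3^-1.
      have -> : 4^-1 * n / y1 - 4^-1 * n / y2 = n * (b * t0) / (4 * y1 * y2).
        have y1n : y1 != 0 by rewrite gt_eqF.
        have y2n : y2 != 0 by rewrite gt_eqF.
        by rewrite (_ : b * t0 = y2 - y1); [field; rewrite y1n y2n|rewrite y12; ring].
      rewrite ler_pdivrMr ?mulr_gt0//.
      have a1 : n * (b * t0) <= 4 * r * t * (2^-1 * t0).
        by apply: ler_pM => //; exact: ltW.
      have a2 : t / 2 * (t / 2) <= y1 * y2.
        have t20 : 0 <= t / 2 by move: t_gt0; clear; lra.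
        by apply: ler_pM => //; rewrite y12; move: y1t bt; clear; lra.
      have a3 : 12 * r * t0 * t <= t * t by rewrite ler_pM2r.
      have -> : 3^-1 * (4 * y1 * y2) = 4 / 3 * (y1 * y2) by field.
      have a4 : 0 <= t * t by rewrite mulr_ge0// ltW.
      by move: a1 a2 a3 a4; move: (y1 * y2) (n * (b * t0)) => P1 P2; clear; lra.
    have -> : expR (- (4^-1 * n / y2)) =
        expR (4^-1 * n / y1 - 4^-1 * n / y2) * expR (- (4^-1 * n / y1)).
      by rewrite -expRD; congr expR; ring.
    rewrite ler_pM2r ?expR_gt0//.
    set z := _ - _ in z3 *.
    (* From (1 - z) exp z <= 1 and z <= 1 / 3 follows exp z <= 3 / 2. *)
    have e1 := expR_ge1Dx (- z); have e2 := expR_gt0 z.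
    have e3 : expR z * expR (- z) = 1 by rewrite -expRD subrr expR0.
    have e4 : expR z * (2 / 3) <= expR z * expR (- z).
      by rewrite ler_pM2l//; move: z3 e1; clear; lra.
    by move: e4; rewrite e3; clear; lra.
  have -> : 3 / 2 * (y1 `^ (- hN) * expR (- (4^-1 * n / y1))) =
    y1 `^ (- hN) * (3 / 2 * expR (- (4^-1 * n / y1))) by ring.
  by apply: ler_pM; rewrite ?powR_ge0 ?expR_ge0.
by rewrite /gbump; move: G1ge G2le; clear; lra.
Qed.

End bump.

(** * Comparison with a damped bump *)

Section bump_comparison.
Variables (R : realType) (N : nat) (alpha q : R).
Hypotheses (alpha_gt : -1 < alpha) (q_gt1 : 1 < q).
Hypothesis gN : N%:R / 2 < decay_exp alpha q.
Notation X := 'rV[R]_N.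
Notation g := (decay_exp alpha q).
Notation A := (absorb alpha q).
Notation hN := (N%:R / 2 : R).
Variables (rho T : R).
Hypotheses (rho_gt0 : 0 < rho) (TM : T <= c0 * rho / g).
Notation edge := (gauss_edge alpha q rho).
Implicit Types (x : X) (t : R).

Ltac slra := clear -alpha_gt q_gt1 gN rho_gt0 TM; lra.

Lemma absorb_bump m t (F th : R) : 0 < t -> 0 < m -> 0 < F -> 0 < th ->
  F <= m * t `^ (- hN) ->
  A t (th * F) <= m `^ (q - 1) * t `^ (alpha - hN * (q - 1)) * th `^ q * F.
Proof.
move=> t0 m0 F0 th0 Fm; have q10 : 0 < q - 1 by rewrite subr_gt0.
have q0 : 0 < q by apply: lt_trans q_gt1.
rewrite absorbM ?(ltW th0) ?(ltW F0)// /absorb -(@mulr_powRB1 _ F q) ?(ltW F0)//.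
have h1 : F `^ (q - 1) <= m `^ (q - 1) * t `^ (- (hN * (q - 1))).
  have -> : t `^ (- (hN * (q - 1))) = (t `^ (- hN)) `^ (q - 1) by rewrite -powRrM mulNr.
  rewrite -powRM ?(ltW m0) ?powR_ge0//; apply: ge0_ler_powR => //.
  - exact: ltW.
  - by rewrite nnegrE ltW.
  - by rewrite nnegrE mulr_ge0 ?(ltW m0) ?powR_ge0.
have -> : t `^ (alpha - hN * (q - 1)) = t `^ alpha * t `^ (- (hN * (q - 1))).
  by rewrite powRD// (gt_eqF t0) implybT.
have -> : th `^ q * (t `^ alpha * (F * F `^ (q - 1))) =
  (th `^ q * t `^ alpha * F) * F `^ (q - 1) by ring.
have -> : m `^ (q - 1) * (t `^ alpha * t `^ (- (hN * (q - 1)))) * th `^ q * F =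
  (th `^ q * t `^ alpha * F) * (m `^ (q - 1) * t `^ (- (hN * (q - 1)))) by ring.
by apply: ler_wpM2l => //; rewrite !mulr_ge0 ?powR_ge0 ?(ltW F0).
Qed.

(** The case iota = 1 is for a solution with absorption, where the decreasing factor [th] pays for
    the absorption of the bump; iota = 0 is for a function with positive heat operator. The factor m
    b^(N/2) keeps the bump below m t^-(N/2), hence below u at time t0 on |x - x0|^2 <= s t0;
    elsewhere the bump is nonpositive at that time. The term [Q * edge] covers the sphere |x|^2 =
    rho. *)
Lemma bump_comparison (iota m b s Q t0 : R) x0 (th dth : R -> R) (u : X -> R -> R) :
  0 < b <= 2^-1 -> 0 < t0 -> 0 < m -> 0 <= iota -> 0 <= Q ->
  2 `^ hN * expR (- (s / (8 * b))) <= 2^-1 -> n2 x0 <= rho / 4 ->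
  (forall x t, t0 <= t <= T -> n2 x <= rho ->
    [/\ {for (x, t), continuous (fun p : X * R => u p.1 p.2)}, 0 <= u x t &
      exists2 d, heat u x t d & forall y, u x t < y -> - (iota * A t y) < d]) ->
  (forall x, n2 (x - x0) <= s * t0 -> n2 x <= rho -> m * t0 `^ (- hN) <= u x t0) ->
  (forall t, t0 <= t <= T -> [/\ is_derive t 1 th (dth t), 0 < th t <= 1 &
    dth t <= - (iota * (m `^ (q - 1) * t `^ (alpha - hN * (q - 1)) * th t `^ q))]) ->
  (forall t, t0 <= t <= T -> m * b `^ hN * th t * t `^ (- hN) <= Q * t `^ (- g)) ->
  forall x t, t0 <= t <= T -> n2 x <= rho ->
    m * b `^ hN * th t * gbump b x0 t0 x t <= u x t + Q * edge t.
Proof.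
move=> bI t00 m0 iota0 Q0 bs x0r Hu Hu0 Hth HQ x t1 /andP[t01 t1T] xr.
have [b0 b1] := andP bI.
have q10 : 0 < q - 1 by rewrite subr_gt0.
pose a := m * b `^ hN; have a0 : 0 < a by rewrite mulr_gt0 ?powR_gt0.
pose F x t := a * gbump b x0 t0 x t.
pose psi x t := th t * F x t.
have psiE y t : m * b `^ hN * th t * gbump b x0 t0 y t = psi y t.
  by rewrite /psi /F /a; ring.
have F_le y t : t0 <= t -> F y t <= m * t `^ (- hN).
  move=> tt; have tI : 0 < t0 <= t by rewrite t00.
  apply: (@le_trans _ _ (a * (b `^ (- hN) * t `^ (- hN)))).
    by rewrite ler_pM2l//; exact: bump_le_pow.
  rewrite /a powRN le_eqVlt; apply/orP; left; apply/eqP; field.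
  by rewrite gt_eqF// powR_gt0.
have heatF y t : t0 <= t -> heat F y t 0.
  move=> tt; rewrite -(mulr0 a); apply: heatZ; apply: heat_bump => //.
  by rewrite t00.
have contF y t : t0 <= t -> {for (y, t), continuous (fun p : X * R => F p.1 p.2)}.
  move=> tt; have bt : 0 < b * t0 by exact: mulr_gt0.
  apply: cvgM; first exact: cvg_cst.
  apply: cvgB; last apply: cvgM; [|exact: cvg_cst|].
    by apply: gauss_continuous; move: bt tt; slra.
  by apply: gauss_continuous; move: bt tt; slra.
pose phi x t := psi x t - u x t - Q * edge t.
rewrite psiE; suff : phi x t1 <= 0 by rewrite /phi; slra.
pose G x t := Num.max (n2 x - rho) (t0 - t).
have GE y t : G y t <= 0 = (n2 y <= rho) && (t0 <= t).
  by rewrite /G !ge_max !subr_le0.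
have GL y t : G y t < 0 = (n2 y < rho) && (t0 < t).
  by rewrite /G !gt_max !subr_lt0.
apply: (@maxprin _ _ G phi rho t1) => //.
- move=> p; apply: continuous_maxr.
  + by apply: cvgB; [exact: continuous_n2p|exact: cvg_cst].
  + by apply: cvgB; [exact: cvg_cst|exact: continuous_snd].
- move=> y t; rewrite GE => /andP[h1 h2] _; split=> //.
  exact: le_trans (ltW t00) h2.
- move=> y t; rewrite GE => /andP[yr tt] tt1.
  have tI : t0 <= t <= T by rewrite tt (le_trans tt1).
  have t_gt0 : 0 < t by exact: lt_le_trans tt.
  have [cu _ _] := Hu y t tI yr; have [dt _ _] := Hth t tI.
  apply: cvgB.
    apply: cvgB; last exact: cu.
    by apply: cvgM; [apply: cont_time; exact: is_derive_continuous dt|exact: contF].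
  by apply: cvgM; [exact: cvg_cst|exact: continuous_gauss_edge].
- move=> y t; rewrite GE => /andP[yr tt] tt1 py.
  have tI : t0 <= t <= T by rewrite tt (le_trans tt1).
  have [_ tT] := andP tI.
  have t_gt0 : 0 < t by exact: lt_le_trans tt.
  have [cu u0 [du hu du_gt]] := Hu y t tI yr; have [dt /andP[th0 th1] dt_le] := Hth t tI.
  have M0 := gauss_edge_gt0 alpha q rho t_gt0.
  have QM0 : 0 <= Q * edge t by rewrite mulr_ge0// ltW.
  have py' : 0 < psi y t - u y t - Q * edge t by [].
  have psi0 : u y t + Q * edge t < psi y t by move: py'; slra.
  have psi_u : u y t < psi y t by move: psi0 QM0; slra.
  have psi_gt0 : 0 < psi y t by exact: le_lt_trans psi_u.
  have F0 : 0 < F y t by move: psi_gt0; rewrite /psi pmulr_rgt0.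
  split.
    rewrite GL; apply/andP; split.
    + rewrite lt_neqAle yr andbT; apply/eqP => yE.
      have [y1b y1t] := andP (bump_time bI (introT andP (conj t00 tt))).
      have y10 : 0 < t - (t0 - b * t0).
        by apply: lt_le_trans y1b; exact: mulr_gt0.
      suff : psi y t <= Q * edge t by move: psi0 u0; slra.
      have n4 : rho / 4 <= n2 (y - x0).
        have := n2D_le (y - x0) x0; rewrite subrK yE; move: x0r; slra.
      (* On the sphere |y - x0|^2 / 4 >= rho / 16 exceeds c0 rho; monotonicity in the age then
         allows replacing the age of the kernel by t. *)
      have e1 : gbump b x0 t0 y t <= t `^ (- hN) * expR (- (c0 * rho / t)).
        apply: (le_trans (bump_le_E _ _ bI (introT andP (conj t00 tt)))).
        apply: (@le_trans _ _ ((t - (t0 - b * t0)) `^ (- hN) * expR (- (c0 * rho / (t - (t0 - b * t0)))))).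
          rewrite /gauss ler_pM2l ?powR_gt0// ler_expR lerN2 ler_pM2r ?invr_gt0//.
          by move: n4 rho_gt0; rewrite /c0; slra.
        apply: powexp_mono => //.
        have g0 : 0 < g by exact: decay_exp_gt0.
        have gt1 : t * g <= c0 * rho by rewrite -ler_pdivlMr// (le_trans tT).
        have : hN * t <= g * t by rewrite ler_pM2r// ltW.
        by move: gt1; slra.
      have := HQ t tI; rewrite -/a => HQt.
      apply: (@le_trans _ _ (a * th t * (t `^ (- hN) * expR (- (c0 * rho / t))))).
        by rewrite /psi /F mulrCA mulrA; rewrite ler_pM2l// mulr_gt0.
      rewrite mulrA [leRHS]mulrA; apply: ler_wpM2r => //; exact: expR_ge0.
    + rewrite lt_neqAle tt andbT; apply/eqP => tE.
      have [ys|/ltW ys] := leP (n2 (y - x0)) (s * t0).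
        have h1 := Hu0 y ys yr; have h2 := F_le y t tt.
        have : psi y t <= F y t by rewrite /psi ger_pMl.
        by move: h1 h2 psi_u; rewrite -tE; slra.
      have hb := @bump_le0 _ _ b x0 t0 s y bI t00 bs ys.
      by move: F0; rewrite -tE /F pmulr_rgt0// ltNge hb.
  have [dM hM dM0] := heat_gauss_edge alpha_gt q_gt1 TM y t_gt0 tT.
  exists (dth t * F y t + th t * 0 - du - Q * dM).
    apply: heatB; last exact: heatZ.
    by apply: heatB => //; apply: heatM => //; exact: heatF.
  have Ab := absorb_bump t_gt0 m0 F0 th0 (F_le y t tt).
  rewrite -/(psi y t) in Ab.
  have h1 := ler_wpM2l iota0 Ab.
  have h2 := du_gt _ psi_u.
  have h3 : dth t * F y t <= - (iota * (m `^ (q - 1) * t `^ (alpha - hN * (q - 1)) * th t `^ q)) * F y t.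
    by rewrite ler_pM2r.
  have h4 : 0 <= Q * dM by rewrite mulr_ge0.
  by move: h1 h2 h3 h4; slra.
- by rewrite GE xr.
Qed.

End bump_comparison.

(** * The damping factor *)

Section damping.
Variables (R : realType) (beta q : R).
Hypotheses (beta_gt0 : 0 < beta) (q_gt1 : 1 < q).
Implicit Types k t e : R.

(** Solution, equal to 1 at t = 0, of the Bernoulli equation th' = - k beta / (q - 1) t^(beta - 1)
    th^q. For large k t^beta it is of order (k t^beta)^(-1/(q-1)); with k proportional to m^(q-1)
    the product of m and this power does not depend on m. *)
Definition damp k t : R := (1 + k * t `^ beta) `^ (- (q - 1)^-1).

Lemma is_derive_damp k t : 0 <= k -> 0 < t ->
  is_derive t 1 (damp k) (- (k * beta / (q - 1) * t `^ (beta - 1) * damp k t `^ q)).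
Proof.
move=> k0 t0; have q10 : 0 < q - 1 by rewrite subr_gt0.
have y0 : 0 < 1 + k * t `^ beta.
  by rewrite ltr_pwDl// mulr_ge0// powR_ge0.
have d1 := @is_derive1_powR R beta t t0.
have d2 : is_derive t 1 (fun t => 1 + k * t `^ beta) (k * (beta * t `^ (beta - 1))).
  by apply: is_derive_eq; rewrite /GRing.scale/=; ring.
have d3 := @is_derive1_comp R (fun y => y `^ (- (q - 1)^-1)) _ t _ _ (is_derive1_powR _ y0) d2.
have -> : - (k * beta / (q - 1) * t `^ (beta - 1) * damp k t `^ q) =
  - (q - 1)^-1 * (1 + k * t `^ beta) `^ (- (q - 1)^-1 - 1) * (k * (beta * t `^ (beta - 1))); last exact: d3.
rewrite /damp -powRrM (_ : - (q - 1)^-1 * q = - (q - 1)^-1 - 1); first by ring.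
have n0 : q - 1 != 0 by rewrite gt_eqF.
by field.
Qed.

Lemma damp_gt0 k t : 0 <= k -> 0 < damp k t.
Proof. by move=> k0; rewrite powR_gt0// ltr_pwDl// mulr_ge0// powR_ge0. Qed.

Lemma damp_le1 k t : 0 <= k -> damp k t <= 1.
Proof.
move=> k0; rewrite /damp powRN invf_le1; last first.
  by rewrite powR_gt0// ltr_pwDl// mulr_ge0// powR_ge0.
have h : 1 <= 1 + k * t `^ beta by rewrite lerDl mulr_ge0// powR_ge0.
rewrite -[leLHS](powRr0 (1 + k * t `^ beta)); apply: (ler_powR h).
by rewrite invr_ge0 subr_ge0 ltW.
Qed.

Lemma damp_near1 k e : 0 <= k -> 0 < e ->
  exists2 tau, 0 < tau & forall t, 0 < t <= tau -> 1 - e <= damp k t.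
Proof.
move=> k0 e0; have q10 : 0 < q - 1 by rewrite subr_gt0.
pose p := (q - 1)^-1; have p0 : 0 < p by rewrite invr_gt0.
have kp : 0 < k * p + 1 by rewrite ltr_pwDr// mulr_ge0// ltW.
pose y := e / (k * p + 1); have y0 : 0 < y by rewrite divr_gt0.
exists (y `^ beta^-1) => [|t /andP[t0 tt]]; first exact: powR_gt0.
have tb : t `^ beta <= y.
  have -> : y = (y `^ beta^-1) `^ beta by rewrite -powRrM mulVf ?gt_eqF// powRr1// ltW.
  by apply: ge0_ler_powR; rewrite ?nnegrE ?powR_ge0 ?(ltW t0) ?(ltW beta_gt0).
have tb0 : 0 <= t `^ beta by exact: powR_ge0.
have h1 : expR (- (p * (k * t `^ beta))) <= damp k t.
  rewrite /damp powRN -/p expRN lef_pV2 ?posrE ?expR_gt0//; last first.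
    by rewrite powR_gt0// ltr_pwDl// mulr_ge0.
  rewrite (mulrC p) expRM; apply: ge0_ler_powR; rewrite ?nnegrE ?expR_ge0 ?(ltW p0)//.
    by rewrite addr_ge0// mulr_ge0.
  exact: expR_ge1Dx.
apply: le_trans h1; apply: le_trans (expR_ge1Dx _).
rewrite lerD2l lerN2 mulrA (mulrC p).
apply: (@le_trans _ _ (k * p * y)).
  by apply: ler_wpM2l => //; rewrite mulr_ge0// ltW.
rewrite /y mulrA ler_pdivrMr// mulrC ler_pM2l// lerDl//.
Qed.

Lemma damp_ge k t : 0 < k -> 0 < t -> 1 <= k * t `^ beta ->
  (2 * (k * t `^ beta)) `^ (- (q - 1)^-1) <= damp k t.
Proof.
move=> k0 t0 h; rewrite /damp !powRN lef_pV2 ?posrE ?powR_gt0//; last 2 first.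
- by move: h; set z := _ * _; lra.
- by move: h; set z := _ * _; lra.
apply: ge0_ler_powR; rewrite ?nnegrE ?invr_ge0 ?subr_ge0 ?(ltW q_gt1)//.
- by move: h; set z := _ * _; lra.
- by move: h; set z := _ * _; lra.
- by move: h; set z := _ * _; lra.
Qed.

Lemma damp_le k t : 0 < k -> 0 < t ->
  damp k t <= (k * t `^ beta) `^ (- (q - 1)^-1).
Proof.
move=> k0 t0; have tb : 0 < k * t `^ beta by rewrite mulr_gt0 ?powR_gt0.
rewrite /damp !powRN lef_pV2 ?posrE ?powR_gt0//; last by rewrite addr_gt0.
apply: ge0_ler_powR; rewrite ?nnegrE ?invr_ge0 ?subr_ge0 ?(ltW q_gt1) ?(ltW tb)//.
- by rewrite addr_ge0// ltW.
- by rewrite lerDr.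
Qed.

End damping.

Section parabolic_lipschitz.
Variables (R : realType) (N : nat).
Notation X := 'rV[R]_N.

(** [ball_lipschitz] in parabolic scaling: r^2 = 3 t0 / 4 yields the time window from t0 / 4 to t0
    and the ball 8 r^2 = 6 t0. Enlarging B to B (1 + M) puts the bound M B / t0 on the heat operator
    into the form required there. *)
Lemma parabolic_lipschitz (M : R) : 0 <= M -> exists2 L : R, 0 < L &
  forall (f : X -> R -> R) x0 (t0 B sg : R), 0 < t0 -> 0 < B -> 0 <= sg <= 1 ->
  (forall y t, n2 (y - x0) <= 6 * t0 -> t0 / 4 <= t <= t0 ->
    [/\ {for (y, t), continuous (fun p : X * R => f p.1 p.2)}, 0 <= f y t <= B &
      exists2 d, heat f y t d & `|d| <= M * B / t0]) ->
  forall x, n2 (x - x0) <= sg ^+ 2 * (3 / 4 * t0) -> `|f x t0 - f x0 t0| <= L * sg * B.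
Proof.
move=> M0; have K0 : 0 < lip_const R N by rewrite /lip_const ltr_pwDr// ler0n.
exists (N%:R * lip_const R N * (1 + M) + 1).
  by rewrite ltr_pwDr// !mulr_ge0 ?ler0n ?(ltW K0)// addr_ge0.
move=> f x0 t0 B sg t00 B0 /andP[sg0 sg1] Hf x xs.
pose r := Num.sqrt (3 / 4 * t0).
have r2 : r ^+ 2 = 3 / 4 * t0 by rewrite sqr_sqrtr//; move: t00; lra.
have r0 : 0 < r by rewrite sqrtr_gt0; move: t00; lra.
have B'0 : 0 < B * (1 + M) by rewrite mulr_gt0// ltr_pwDl.
have BB : B <= B * (1 + M) by rewrite ler_pMr// lerDl.
have h : `|f x t0 - f x0 t0| <= N%:R * (B * (1 + M) * (lip_const R N * (sg * r / r))).
  apply: (ball_lipschitz r0 B'0 (t0 := t0) (s := sg * r)).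
  - by rewrite r2; move: t00; lra.
  - by rewrite mulr_ge0 ?(ltW r0)//= ger_pMl.
  - by rewrite exprMn r2.
  - move=> y t; rewrite r2 => yx /andP[t1 t2].
    have [||cf /andP[f0 fB] [d hd dB]] := Hf y t.
    + by move: yx; lra.
    + by apply/andP; split; move: t1 t2; lra.
    split=> //; first by rewrite f0 (le_trans fB).
    exists d => //; apply: (le_trans dB).
    have it0 : 0 < t0^-1 by rewrite invr_gt0.
    have -> : B * (1 + M) / (3 / 4 * t0) = 4 / 3 * (B + M * B) * t0^-1 by field; rewrite gt_eqF.
    rewrite ler_pM2r//.
    have : 0 <= M * B by rewrite mulr_ge0// ltW.
    by move: B0; lra.
rewrite mulfK ?gt_eqF// in h; apply: (le_trans h).
have : 0 <= sg * B by rewrite mulr_ge0// ltW.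
move=> h1; have -> : N%:R * (B * (1 + M) * (lip_const R N * sg)) =
  N%:R * lip_const R N * (1 + M) * sg * B by ring.
by rewrite mulrDl mul1r mulrDl lerDl.
Qed.

End parabolic_lipschitz.

(** * Lower bound of order t^-g in the unbounded case *)

Section lower_bound.
Variables (R : realType) (N : nat) (alpha q : R).
Hypotheses (alpha_gt : -1 < alpha) (q_gt1 : 1 < q).
Hypothesis gN : N%:R / 2 < decay_exp alpha q.
Notation X := 'rV[R]_N.
Notation g := (decay_exp alpha q).
Notation A := (absorb alpha q).
Notation hN := (N%:R / 2 : R).
Variables (rho T R2 : R).
Hypotheses (rho_gt0 : 0 < rho) (T_gt0 : 0 < T) (TM : T <= c0 * rho / g)
  (R2_ge : g + 1 <= c0 * (1 - 4 * c0) * R2).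
Notation edge := (gauss_edge alpha q rho).
Implicit Types (x : X) (t : R).

Ltac slra := clear -alpha_gt q_gt1 gN rho_gt0 T_gt0 TM R2_ge; lra.

Lemma absorption_bound C t y : 0 < t -> 0 < y -> 0 <= C -> t `^ g * y <= C ->
  A t y <= C `^ (q - 1) * y / t.
Proof.
move=> t0 y0 C0 h; rewrite (absorb_scale alpha q_gt1 t0 y0).
have -> : C `^ (q - 1) * y / t = y / t * C `^ (q - 1) by ring.
rewrite ler_pM2l ?divr_gt0//; apply: ge0_ler_powR => //.
- by rewrite subr_ge0 ltW.
- by rewrite nnegrE mulr_ge0 ?powR_ge0// ltW.
Qed.

Lemma compact_box_max (f : X -> R -> R) (tau t1 : R) (p0 : X * R) : 0 < tau ->
  n2 p0.1 <= rho -> tau <= p0.2 <= t1 ->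
  (forall y t, n2 y <= rho -> tau <= t <= t1 ->
    {for (y, t), continuous (fun p : X * R => f p.1 p.2)}) ->
  exists x0 t0, [/\ n2 x0 <= rho, tau <= t0 <= t1 &
    forall y t, n2 y <= rho -> tau <= t <= t1 -> f y t <= f x0 t0].
Proof.
move=> tau0 p0r /andP[p01 p02] cf.
pose G (x : X) t := Num.max (n2 x - rho) (tau - t).
have GE y t : G y t <= 0 = (n2 y <= rho) && (tau <= t).
  by rewrite /G !ge_max !subr_le0.
have cK := @maxprin_compact R N G rho t1.
have [|||[x0 t0] h1 h2] := @compact_EVT_max _ _ (fun p : X * R => f p.1 p.2)
  [set p : X * R | G p.1 p.2 <= 0 /\ p.2 <= t1].
- by exists p0; split=> //; rewrite GE p0r.
- apply: cK.
    move=> p; apply: continuous_maxr.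
    + by apply: cvgB; [exact: continuous_n2p|exact: cvg_cst].
    + by apply: cvgB; [exact: cvg_cst|exact: continuous_snd].
  move=> y t; rewrite GE => /andP[h1 h2] _; split=> //.
  exact: le_trans (ltW tau0) h2.
- apply: continuous_in_subspaceT => -[y t]; rewrite inE => -[/=].
  by rewrite GE => /andP[h1 h2] h3; apply: cf => //; rewrite h2.
exists x0, t0; move: h1; rewrite inE /= GE => -[/andP[a1 a2] a3].
split=> //; first by rewrite a2.
move=> y t yr /andP[t1' t2']; apply: (h2 (y, t)).
by rewrite inE /=; split=> //; rewrite GE yr.
Qed.

(** The Lipschitz estimate is useful only where f on the preceding time window is controlled by its
    value at the point. Such points are maxima of f / Z with Z = t^-(g+1) exp(- c0 |x|^2 / (2 t)).
    The quotient is at most C t exp(- c0 |x|^2 / (2 t)), so the maximum is neither approached as t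
    -> 0 nor, because f is large at (xn, tn), attained on the sphere. Beyond |x|^2 = 2 R2 t the
    function Z is a supersolution and f cannot touch a multiple of it from below. *)
Lemma good_point C f : gauss_sol alpha q rho T C f -> 0 <= C ->
  (forall L tau, 0 < L -> 0 < tau -> exists x t, [/\ 0 < t <= tau,
     n2 x <= R2 * t & L * t `^ (- hN) < f x t]) ->
  forall L tau, 0 < L -> 0 < tau -> exists x0 t0, [/\ 0 < t0 <= tau,
    n2 x0 <= 2 * R2 * t0, L * t0 `^ (- hN) <= f x0 t0 &
    forall y t, n2 y <= rho -> t0 / 4 <= t <= t0 ->
      f y t <= 4 `^ (g + 1) * expR (c0 * R2) * f x0 t0].
Proof.
move=> Hf C0 unb L tau L0 tau_gt0.
have g0 : 0 < g by exact: decay_exp_gt0.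
have R20 : 0 < R2 by have := R2_gt0 alpha_gt q_gt1 R2_ge.
have c00 := @c0_gt0 R.
pose c1 : R := c0 / 2; have c10 : 0 < c1 by rewrite divr_gt0.
have c1r : 0 < c1 * rho by rewrite mulr_gt0.
have gN0 : 0 <= g - hN by rewrite subr_ge0 ltW.
have e00 : 0 < (2 * (C + 1))^-1 by rewrite invr_gt0 mulr_gt0// ltr_pwDr.
have [taue taue0 He] := powexp_small gN0 c1r e00.
pose tau1 := Num.min (Num.min tau T) (Num.min taue (rho / R2)).
have tau10 : 0 < tau1 by rewrite !lt_min tau_gt0 T_gt0 taue0 divr_gt0.
(* The exponential compensates the spatial weight of Z at the maximum point; the lower bound 1
   serves to exclude the sphere. *)
pose L' := Num.max 1 L * expR (c0 * R2).
have L'0 : 0 < L' by rewrite mulr_gt0 ?expR_gt0// lt_max ltr01.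
have [xn [tn [/andP[tn0 tnt] xnR fn]]] := unb L' tau1 L'0 tau10.
move: tnt; rewrite !le_min => /andP[/andP[tn_tau tnT] /andP[tn_e tn_r]].
have tnT' t : 0 < t -> t <= tn -> 0 < t <= T by move=> -> h; exact: le_trans tnT.
have xnr : n2 xn <= rho.
  by apply: (le_trans xnR); rewrite mulrC -ler_pdivlMr.
pose Z : X -> R -> R := gauss (g + 1) c1 0 0.
have Z0 y t : 0 < t -> 0 < Z y t by move=> t0; exact: gauss_gt0.
have Zle y t : 0 < t -> Z y t <= t `^ (- (g + 1)).
  by move=> t0; apply: gauss_le_pow => //; exact: ltW.
have gZ y t : 0 < t -> gauss g c0 0 0 y t = t * expR (- (c1 * n2 y / t)) * Z y t.
  move=> t0; rewrite /Z !gauss0E powR_opp_succ//.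
  have -> : expR (- (c0 * n2 y / t)) = expR (- (c1 * n2 y / t)) * expR (- (c1 * n2 y / t)).
    by rewrite -expRD; congr expR; rewrite /c1; field; rewrite gt_eqF.
  by field; rewrite gt_eqF.
pose W y t := f y t / Z y t.
have WE y t : 0 < t -> f y t = W y t * Z y t.
  by move=> t0; rewrite /W divfK// gt_eqF// Z0.
have Wub y t : n2 y <= rho -> 0 < t -> t <= tn -> W y t <= C * (t * expR (- (c1 * n2 y / t))).
  move=> yr t0 tt; have [_ f0 _ fC] := Hf y t (tnT' t t0 tt) yr.
  by rewrite /W ler_pdivrMr ?Z0// -[leRHS]mulrA -gZ.
have WC y t : n2 y <= rho -> 0 < t -> t <= tn -> W y t <= C * t.
  move=> yr t0 tt; apply: (le_trans (Wub y t yr t0 tt)); apply: ler_wpM2l => //.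
  rewrite ger_pMr// -expR0 ler_expR oppr_le0.
  by rewrite divr_ge0 ?(ltW t0)// mulr_ge0 ?n2_ge0// ltW.
pose Wn := W xn tn.
have Wn_ge : L' * tn `^ (g + 1 - hN) <= Wn.
  rewrite /Wn /W ler_pdivlMr ?Z0//; apply: le_trans (ltW fn).
  have -> : L' * tn `^ (- hN) = L' * tn `^ (g + 1 - hN) * tn `^ (- (g + 1)).
    rewrite -mulrA -powRD ?(gt_eqF tn0) ?implybT//.
    by congr (_ * _ `^ _); ring.
  rewrite ler_pM2l ?Zle//; by rewrite mulr_gt0 ?powR_gt0.
have Wn0 : 0 < Wn by apply: lt_le_trans Wn_ge; rewrite mulr_gt0 ?powR_gt0.
(* For t <= tau' the quotient is at most C t <= Wn, so these times cannot beat (xn, tn) and the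
   maximum may be sought on a compact set. *)
pose tau' := Num.min tn (Wn / (2 * (C + 1))).
have tau'0 : 0 < tau' by rewrite lt_min tn0 mulr_gt0.
have tau'tn : tau' <= tn by rewrite ge_min lexx.
have Ctau' : C * tau' <= Wn.
  have : tau' <= Wn / (2 * (C + 1)) by rewrite ge_min lexx orbT.
  rewrite ler_pdivlMr ?mulr_gt0 ?ltr_pwDr// => h.
  have : 0 <= C * tau' by rewrite mulr_ge0// ltW.
  by move: h tau'0; slra.
have [|||x0 [t0 [x0r /andP[t01 t02] Wmax]]] := @compact_box_max W tau' tn (xn, tn) tau'0.
- exact: xnr.
- by rewrite /= tau'tn lexx.
- move=> y t yr /andP[t1 t2]; have t_gt0 : 0 < t by exact: lt_le_trans t1.
  have [cf _ _ _] := Hf y t (tnT' t t_gt0 t2) yr.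
  apply: cvgM; first exact: cf.
  by apply: cvgV; [rewrite /= gt_eqF// Z0|exact: gauss_continuous].
have t00 : 0 < t0 by exact: lt_le_trans t01.
have WnW0 : Wn <= W x0 t0 by apply: Wmax => //; rewrite tau'tn lexx.
have {}Wmax y t : n2 y <= rho -> 0 < t -> t <= tn -> W y t <= W x0 t0.
  move=> yr t_gt0 tt; have [ht|/ltW ht] := leP tau' t.
    by apply: Wmax => //; rewrite ht.
  apply: le_trans WnW0; apply: le_trans Ctau'; apply: (le_trans (WC y t yr t_gt0 tt)).
  exact: ler_wpM2l.
pose W0 := W x0 t0; have W00 : 0 < W0 by exact: lt_le_trans WnW0.
have tI := tnT' t0 t00 t02.
have [cf f0 hf fC] := Hf x0 t0 tI x0r.
have x0lt : n2 x0 < rho.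
  rewrite lt_neqAle x0r andbT; apply/eqP => xE.
  have h1 := Wub x0 t0 x0r t00 t02; rewrite xE in h1.
  have h2 : expR (- (c1 * rho / t0)) <= expR (- (c1 * rho / tn)).
    by rewrite ler_expR lerN2 ler_pM2l// lef_pV2.
  have h3 := He tn (introT andP (conj tn0 tn_e)).
  have h4 : expR (- (c1 * rho / tn)) <= (2 * (C + 1))^-1 * tn `^ (g - hN).
    by rewrite powRN mulrC ler_pdivrMr ?powR_gt0 in h3.
  have h5 : tn * tn `^ (g - hN) = tn `^ (g + 1 - hN).
    rewrite -{1}(powRr1 (ltW tn0)) -powRD ?(gt_eqF tn0) ?implybT//.
    by congr (_ `^ _); ring.
  have P0 : 0 < tn `^ (g + 1 - hN) by exact: powR_gt0.
  have h6 : C * (t0 * expR (- (c1 * rho / t0))) <= C * ((2 * (C + 1))^-1 * tn `^ (g + 1 - hN)).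
    apply: ler_wpM2l => //; rewrite -h5 mulrCA; apply: ler_pM => //; rewrite ?expR_ge0 ?(ltW t00)//.
    exact: le_trans h4.
  have h7 : C * ((2 * (C + 1))^-1 * tn `^ (g + 1 - hN)) < tn `^ (g + 1 - hN).
    rewrite mulrA gtr_pMl// mulrC ltr_pdivrMl ?mulr_gt0 ?ltr_pwDr//.
    by move: C0; slra.
  have h8 : tn `^ (g + 1 - hN) <= L' * tn `^ (g + 1 - hN).
    rewrite ler_peMl ?(ltW P0)// /L' -[X in X <= _]mulr1; apply: ler_pM => //.
      by rewrite le_max lexx.
    by rewrite -expR0 ler_expR mulr_ge0 ?(ltW R20) ?(ltW c00).
  have := lt_le_trans (le_lt_trans h6 h7) (le_trans h8 (le_trans Wn_ge WnW0)).
  by move/(le_lt_trans h1); rewrite ltxx.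
(* Otherwise f - W0 Z attains its maximum 0 at (x0, t0), while its heat operator there is - A f - W0
   dZ < 0. *)
have x0R : n2 x0 <= 2 * R2 * t0.
  rewrite leNgt; apply/negP => xR.
  pose phi y t := f y t - W0 * Z y t.
  have phi_le y t : n2 y <= rho -> 0 < t -> t <= tn -> phi y t <= 0.
    by move=> yr t_gt0 tt; rewrite /phi subr_le0 (WE y t t_gt0) ler_pM2r ?Z0// Wmax.
  have phi0 : phi x0 t0 = 0 by rewrite /phi (WE x0 t0 t00) subrr.
  have hZ := heat_gauss (g + 1) c1 (0 : X) x0 t00.
  set dZ := (X in heat _ _ _ X) in hZ.
  have dZ0 : 0 <= dZ.
    rewrite /dZ !subr0; apply: mulr_ge0.
      by rewrite divr_ge0 ?(ltW t00)// ltW// gauss_gt0.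
    have cN : 0 <= 2 * c1 * N%:R :> R.
      by apply: mulr_ge0 => //; apply: mulr_ge0 => //; exact: ltW.
    have h1 : c1 * (1 - 4 * c1) * (2 * R2) <= c1 * (1 - 4 * c1) * n2 x0 / t0.
      rewrite -[leRHS]mulrA; apply: ler_wpM2l; last by rewrite ler_pdivlMr// ltW.
      by rewrite /c1 /c0; slra.
    have h2 : c0 * (1 - 4 * c0) * R2 <= c1 * (1 - 4 * c1) * (2 * R2).
      by rewrite /c1 /c0; move: R20; slra.
    by move: h1 h2 cN R2_ge; slra.
  have hphi : heat phi x0 t0 (- A t0 (f x0 t0) - W0 * dZ).
    by apply: heatB => //; exact: heatZ.
  have : 0 <= - A t0 (f x0 t0) - W0 * dZ.
    apply: (heat_touch hphi).
    - move=> i.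
      have cn : (fun h : R => n2 (x0 + h *: ebasis R i)) @ 0 --> n2 x0.
        rewrite (_ : (fun h => _) = (fun h => n2 x0 + 2 * x0 0 i * h + h ^+ 2)); last first.
          by apply/funext => h; rewrite n2_line.
        rewrite -[X in _ --> X]addr0 -[X in _ --> X + _]addr0.
        apply: cvgD.
          apply: cvgD; first exact: cvg_cst.
          by rewrite -[X in _ --> X](mulr0 (2 * x0 0 i)); apply: cvgM; [exact: cvg_cst|exact: cvg_id].
        by rewrite -[X in _ --> X](expr0n R 2); apply: cvgM; exact: cvg_id.
      have : \forall h \near 0, n2 (x0 + h *: ebasis R i) < rho by apply: (cvgr_lt _ cn).
      by apply: filterS => h h1; rewrite phi0; apply: phi_le => //; exact: ltW.
    - near=> h; rewrite phi0; apply: phi_le => //.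
        by rewrite subr_gt0; near: h; exact: nbhs_right_lt.
      have : 0 < h by near: h; exact: nbhs_right_gt.
      by move: t02; slra.
  have := absorb_gt0 alpha q t00 f0.
  have : 0 <= W0 * dZ by rewrite mulr_ge0// ltW.
  by slra.
have expX : expR (c1 * n2 x0 / t0) <= expR (c0 * R2).
  rewrite ler_expR ler_pdivrMr//.
  have := ler_wpM2l (ltW c10) x0R.
  by rewrite /c1; slra.
have fE : f x0 t0 * expR (c1 * n2 x0 / t0) = W0 * t0 `^ (- (g + 1)).
  rewrite (WE x0 t0 t00) /Z gauss0E expRN -/W0.
  by field; rewrite gt_eqF// expR_gt0.
exists x0, t0; split=> //.
- by rewrite t00 (le_trans t02).
(* The lower bound on Wn carries the positive power g + 1 - N / 2 of tn, so it persists when tn is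
   replaced by the smaller t0. *)
- have h1 : L' * t0 `^ (- hN) <= W0 * t0 `^ (- (g + 1)).
    have -> : t0 `^ (- hN) = t0 `^ (g + 1 - hN) * t0 `^ (- (g + 1)).
      by rewrite -powRD ?(gt_eqF t00) ?implybT//; congr (_ `^ _); ring.
    rewrite mulrA ler_pM2r ?powR_gt0//; apply: le_trans (le_trans Wn_ge WnW0).
    rewrite ler_pM2l//; apply: ge0_ler_powR; rewrite ?nnegrE ?(ltW t00) ?(ltW tn0)//.
    by move: gN0; slra.
  have eR : 0 < expR (c0 * R2) by exact: expR_gt0.
  rewrite -(ler_pM2r eR); apply: (@le_trans _ _ (L' * t0 `^ (- hN))).
    rewrite mulrAC ler_pM2r ?powR_gt0// ler_pM2r// le_max lexx orbT//.
  by apply: (le_trans h1); rewrite -fE ler_pM2l.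
- move=> y t yr /andP[t1 t2].
  have t_gt0 : 0 < t by apply: lt_le_trans t1; rewrite divr_gt0.
  have ttn : t <= tn by exact: le_trans t02.
  rewrite (WE y t t_gt0); apply: (@le_trans _ _ (W0 * t `^ (- (g + 1)))).
    apply: ler_pM; rewrite ?Zle ?Wmax ?(ltW (Z0 _ _ t_gt0))//.
    have [_ f0' _ _] := Hf y t (tnT' t t_gt0 ttn) yr.
    by rewrite /W divr_ge0 ?(ltW f0') ?(ltW (Z0 _ _ t_gt0)).
  have h1 : t `^ (- (g + 1)) <= 4 `^ (g + 1) * t0 `^ (- (g + 1)).
    apply: (@le_trans _ _ ((t0 / 4) `^ (- (g + 1)))).
      by apply: powRN_anti => //; rewrite ?divr_gt0 ?addr_ge0 ?(ltW g0).
    rewrite powRM ?(ltW t00) ?invr_ge0//.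
    have -> : (4^-1 : R) `^ (- (g + 1)) = 4 `^ (g + 1).
      by rewrite -(powR_inv1 (ler0n _ 4)) -powRrM mulN1r opprK.
    by rewrite mulrC.
  apply: (@le_trans _ _ (W0 * (4 `^ (g + 1) * t0 `^ (- (g + 1))))).
    by rewrite ler_pM2l.
  rewrite mulrCA -fE -[leRHS]mulrA; apply: ler_wpM2l; first exact: powR_ge0.
  by rewrite mulrC ler_pM2r.
Unshelve. all: by end_near. Qed.

Lemma bump_width s : 0 < s ->
  exists2 b : R, 0 < b <= 2^-1 & 2 `^ hN * expR (- (s / (8 * b))) <= 2^-1.
Proof.
move=> s0; have P0 : 0 < 2 `^ hN :> R by exact: powR_gt0.
have e0 : 0 < 2^-1 / 2 `^ hN :> R by rewrite divr_gt0// invr_gt0.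
have s80 : 0 < s / 8 by rewrite divr_gt0.
have [tau tau0 H] := expR_small s80 e0.
exists (Num.min 2^-1 tau); first by rewrite lt_min invr_gt0 ltr0n tau0 ge_min lexx.
set b := Num.min _ _; have b0 : 0 < b by rewrite lt_min invr_gt0 ltr0n.
have := H b b0; rewrite ge_min lexx orbT => /(_ isT).
rewrite ler_pdivlMr// mulrC; congr (_ * expR (- _) <= _).
by field; rewrite gt_eqF.
Qed.

(** The bound t^g f <= C makes the absorption an admissible source: it is at most C^(q-1) f / t, and
    t >= t0 / 4 accounts for the factor 4 in M. *)
Lemma sol_parabolic_lipschitz C f : gauss_sol alpha q rho T C f -> 0 <= C ->
  exists2 L, 0 < L & forall x0 t0 B sg, 0 < t0 <= T -> 0 < B -> 0 <= sg <= 1 ->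
    12 * t0 + 2 * n2 x0 <= rho ->
    (forall y t, n2 (y - x0) <= 6 * t0 -> n2 y <= rho -> t0 / 4 <= t <= t0 -> f y t <= B) ->
    forall x, n2 (x - x0) <= sg ^+ 2 * (3 / 4 * t0) ->
      `|f x t0 - f x0 t0| <= L * sg * B.
Proof.
move=> Hf C0; pose M := 4 * C `^ (q - 1).
have M0 : 0 <= M by rewrite mulr_ge0// powR_ge0.
have [L L0 HL] := @parabolic_lipschitz R N M M0.
exists L => // x0 t0 B sg /andP[t00 t0T] B0 sgI x0r HB; apply: HL => //.
move=> y t yx /andP[t1 t2].
have t_gt0 : 0 < t by apply: lt_le_trans t1; rewrite divr_gt0.
have yr : n2 y <= rho.
  have := n2D_le (y - x0) x0; rewrite subrK.
  by move: yx x0r; slra.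
have tI : 0 < t <= T by rewrite t_gt0 (le_trans t2).
have [cf f0 hf fC] := Hf y t tI yr.
have fB : f y t <= B by apply: HB => //; rewrite t1.
split=> //; first by rewrite ltW.
exists (- A t (f y t)) => //; rewrite normrN ger0_norm; last exact: absorb_ge0.
have tf : t `^ g * f y t <= C.
  have := ler_wpM2l (powR_ge0 t g) fC => h; apply: (le_trans h).
  rewrite mulrCA -[leRHS]mulr1; apply: ler_wpM2l => //.
  rewrite -(powg_mul alpha q t_gt0); apply: ler_wpM2l; first exact: powR_ge0.
  by apply: gauss_le_pow => //; exact/ltW/c0_gt0.
apply: (le_trans (absorption_bound t_gt0 f0 C0 tf)).
have -> : M * B / t0 = C `^ (q - 1) * B * (4 / t0) by rewrite /M; ring.
apply: ler_pM.
- by rewrite mulr_ge0 ?powR_ge0// ltW.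
- by rewrite invr_ge0 ltW.
- by apply: ler_wpM2l => //; exact: powR_ge0.
- by rewrite -[leRHS]invrK lef_pV2 ?posrE ?invr_gt0 ?divr_gt0// invfM invrK mulrC.
Qed.

(** The value of beta for which the weight t^(beta - 1) of the damping equation is t^(alpha -
    (N/2)(q-1)), the one produced by the absorption of m t^-(N/2). *)
Definition bexp := (g - hN) * (q - 1).

Lemma bexp_gt0 : 0 < bexp.
Proof. by rewrite mulr_gt0 ?subr_gt0. Qed.

Lemma bexpE : bexp - 1 = alpha - hN * (q - 1).
Proof.
rewrite /bexp mulrBl /decay_exp divfK; first by ring.
by rewrite subr_eq0 gt_eqF.
Qed.

Lemma bexp_div : - bexp / (q - 1) - hN = - g.
Proof.
have q0 : q - 1 != 0 by rewrite subr_eq0 gt_eqF.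
by rewrite /bexp mulNr mulfK//; ring.
Qed.

(** For given (x, t) a bump is started at a good point (x0, t0) with t0 much smaller than t. Its
    strength m may be huge, but by [kpow] the asymptotic form of the damped bump is Q t^-g whatever
    m is. Hence the final constant is uniform although x0, t0 and m vary with (x, t). *)
Theorem lower_of_unbounded C f : gauss_sol alpha q rho T C f -> 0 <= C ->
  (forall L tau, 0 < L -> 0 < tau -> exists x t, [/\ 0 < t <= tau,
     n2 x <= R2 * t & L * t `^ (- hN) < f x t]) ->
  forall r, 0 < r -> exists2 c, 0 < c & exists2 tau, 0 < tau &
    forall x t, 0 < t <= tau -> n2 x <= r * t -> c * t `^ (- g) <= f x t.
Proof.
move=> Hf C0 unb r r0.
have g0 : 0 < g by exact: decay_exp_gt0.
have R20 : 0 < R2 by have := R2_gt0 alpha_gt q_gt1 R2_ge.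
have q10 : 0 < q - 1 by rewrite subr_gt0.
have be0 := bexp_gt0; have beE := bexpE; have beD := bexp_div.
set be := bexp in be0 beE beD; clearbody be.
have c00 := @c0_gt0 R.
have [La La0 HLa] := sol_parabolic_lipschitz Hf C0.
pose Kb := 4 `^ (g + 1) * expR (c0 * R2).
have Kb0 : 0 < Kb by rewrite mulr_gt0 ?powR_gt0 ?expR_gt0.
have Hgood := good_point Hf C0 unb; rewrite -/Kb in Hgood.
clearbody Kb.
(* The oscillation of f on the ball |y - x0|^2 <= s t0 is at most La sg Kb f(x0, t0), so f stays
   above f(x0, t0) / 2 there. *)
have [sg /andP[sg0 sg1] sgL] : exists2 sg, 0 < sg <= 1 & La * sg * Kb <= 2^-1.
  exists (Num.min 1 (2 * La * Kb)^-1).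
    by rewrite lt_min ltr01 invr_gt0 !mulr_gt0// ge_min lexx.
  set sg := Num.min _ _; have : sg <= (2 * La * Kb)^-1 by rewrite ge_min lexx orbT.
  rewrite -[_^-1]mul1r ler_pdivlMr ?mulr_gt0//.
  by slra.
pose s := sg ^+ 2 * (3 / 4); have s0 : 0 < s by rewrite mulr_gt0 ?exprn_gt0.
have [b bI bs] := bump_width s0; have [b0 b1] := andP bI.
pose r' := Num.max r (2 * R2); have r'0 : 0 < r' by rewrite lt_max r0.
pose Q := b `^ hN * ((q - 1) / be) `^ (- (q - 1)^-1).
have Q0 : 0 < Q by rewrite mulr_gt0 ?powR_gt0 ?divr_gt0.
pose c1 := b `^ hN * (2 * ((q - 1) / be)) `^ (- (q - 1)^-1) * (expR (- (2 * r')) / 4).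
have c10 : 0 < c1 by rewrite !mulr_gt0 ?powR_gt0 ?mulr_gt0 ?divr_gt0 ?expR_gt0 ?invr_gt0.
have cr0 : 0 < c0 * rho by rewrite mulr_gt0.
have e0 : 0 < c1 / (2 * Q) by rewrite divr_gt0// mulr_gt0.
have [tau1 tau10 Htau1] := expR_small cr0 e0.
exists (c1 / 2); first by rewrite divr_gt0.
exists (Num.min (Num.min T tau1) (rho / r)).
  by rewrite !lt_min T_gt0 tau10 divr_gt0.
move=> x t /andP[t_gt0]; rewrite !le_min => /andP[/andP[tT ttau1] tr] xr.
have xrho : n2 x <= rho by apply: (le_trans xr); rewrite mulrC -ler_pdivlMr.
have tb0 : 0 < t `^ be by exact: powR_gt0.
(* With this L, depending on t, the strength m >= L / 2 satisfies k t^be >= 1: by time t the damping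
   has reached its asymptotic regime. *)
pose L := 2 * (be / ((q - 1) * t `^ be)) `^ (q - 1)^-1.
have L0 : 0 < L by rewrite mulr_gt0 ?powR_gt0 ?divr_gt0 ?mulr_gt0.
have D0 : 0 < 2 + 12 * r' by rewrite addr_gt0 ?mulr_gt0.
have D1 : 0 < 12 + 8 * R2 by rewrite addr_gt0 ?mulr_gt0.
have tau00 : 0 < Num.min (t / (2 + 12 * r')) (rho / (12 + 8 * R2)).
  by rewrite lt_min !divr_gt0.
have [x0 [t0 [/andP[t00]]]] := Hgood L _ L0 tau00.
rewrite le_min !ler_pdivlMr// => /andP[t0t t0r] x0R f0L f0max.
have R2t0 : 0 < R2 * t0 by rewrite mulr_gt0.
have r't0 : 0 < r' * t0 by rewrite mulr_gt0.
have t02 : 2 * t0 <= t.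
  by move: t0t r't0; slra.
have t012 : 12 * r' * t0 <= t.
  by move: t0t t00; slra.
have t0t' : t0 <= t.
  by move: t02 t00; slra.
have t0T : t0 <= T by exact: le_trans tT.
have x0r4 : n2 x0 <= rho / 4.
  by move: x0R t0r t00; slra.
have x0rho : 12 * t0 + 2 * n2 x0 <= rho.
  by move: x0R t0r R2t0; slra.
have x0rho' : n2 x0 <= rho.
  by move: x0r4 (rho_gt0); slra.
have [_ f0 _ _] := Hf x0 t0 (introT andP (conj t00 t0T)) x0rho'.
pose m := t0 `^ hN * f x0 t0 / 2.
have p0 : 0 < t0 `^ hN by exact: powR_gt0.
have m0 : 0 < m by rewrite !mulr_gt0// invr_gt0.
have mE : m * t0 `^ (- hN) = f x0 t0 / 2.
  by rewrite /m powRN; field; rewrite gt_eqF.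
have mL : L / 2 <= m.
  have : L * t0 `^ (- hN) * t0 `^ hN <= f x0 t0 * t0 `^ hN by rewrite ler_pM2r.
  rewrite powRN mulfVK ?gt_eqF// /m.
  by slra.
pose k := m `^ (q - 1) * ((q - 1) / be).
have k0 : 0 < k by apply: mulr_gt0; [exact: powR_gt0|exact: divr_gt0].
have kt : 1 <= k * t `^ be.
  have h1 : be / ((q - 1) * t `^ be) <= m `^ (q - 1).
    have -> : be / ((q - 1) * t `^ be) = (L / 2) `^ (q - 1).
      rewrite /L mulrAC mulfV ?pnatr_eq0// mul1r -powRrM mulVf ?gt_eqF//.
      by rewrite powRr1// divr_ge0 ?mulr_ge0 ?(ltW be0) ?(ltW q10) ?(ltW tb0).
    by apply: ge0_ler_powR => //; rewrite ?nnegrE ?(ltW q10) ?(ltW m0) ?divr_ge0 ?(ltW L0).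
  rewrite /k; move: h1; rewrite ler_pdivrMr ?mulr_gt0// => h1.
  rewrite -(ler_pM2l be0) mulr1; apply: (le_trans h1).
  by rewrite le_eqVlt; apply/orP; left; apply/eqP; field; rewrite gt_eqF.
have fhalf y : n2 (y - x0) <= s * t0 -> n2 y <= rho -> m * t0 `^ (- hN) <= f y t0.
  move=> yx yr; have t0I : 0 < t0 <= T by rewrite t00.
  have B0 : 0 < Kb * f x0 t0 by exact: mulr_gt0.
  have sgI : 0 <= sg <= 1 by rewrite sg1 (ltW sg0).
  have := HLa x0 t0 (Kb * f x0 t0) sg t0I B0 sgI x0rho _ y _.
  have hy : n2 (y - x0) <= sg ^+ 2 * (3 / 4 * t0) by rewrite mulrA.
  move=> /(_ (fun z t' _ zr tI' => f0max z t' zr tI') hy).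
  have h1 : La * sg * (Kb * f x0 t0) <= 2^-1 * f x0 t0 by rewrite mulrA ler_pM2r.
  rewrite ler_norml => /andP[h2 _]; rewrite mE.
  by move: h1 h2; slra.
have mp : m `^ (q - 1) `^ (- (q - 1)^-1) = m^-1.
  by rewrite -powRrM mulrN mulfV ?gt_eqF// powR_inv1// ltW.
have tp (t' : R) : t' `^ be `^ (- (q - 1)^-1) = t' `^ (- be / (q - 1)).
  by rewrite -powRrM mulrN mulNr.
have w0 : 0 < (q - 1) / be by exact: divr_gt0.
have kpow (t' : R) : 0 < t' -> m * b `^ hN * (k * t' `^ be) `^ (- (q - 1)^-1) * t' `^ (- hN) =
    Q * t' `^ (- g).
  move=> t'0; rewrite powRM ?powR_ge0 ?(ltW k0)// tp /k powRM ?powR_ge0 ?(ltW w0)// mp -beD.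
  rewrite powRD ?(gt_eqF t'0) ?implybT// /Q.
  by field; rewrite gt_eqF.
have damp_low : c1 * t `^ (- g) <= m * b `^ hN * damp be q k t * (expR (- (2 * r')) / 4 * t `^ (- hN)).
  have h1 := @damp_ge R be q q_gt1 k t k0 t_gt0 kt.
  have kt0 : 0 <= k * t `^ be by apply: le_trans kt.
  have E1 : (2 * (k * t `^ be)) `^ (- (q - 1)^-1) =
      2 `^ (- (q - 1)^-1) * (k * t `^ be) `^ (- (q - 1)^-1).
    by rewrite powRM.
  have E2 : c1 = 2 `^ (- (q - 1)^-1) * Q * (expR (- (2 * r')) / 4).
    by rewrite /c1 /Q powRM ?(ltW w0)//; ring.
  have E3 : c1 * t `^ (- g) = m * b `^ hN * (2 * (k * t `^ be)) `^ (- (q - 1)^-1) *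
     (expR (- (2 * r')) / 4 * t `^ (- hN)).
    rewrite E2 E1; have K := kpow t t_gt0.
    transitivity (2 `^ (- (q - 1)^-1) * (Q * t `^ (- g)) * (expR (- (2 * r')) / 4)); first by ring.
    by rewrite -K; ring.
  rewrite E3; apply: ler_wpM2r.
    by apply: mulr_ge0; rewrite ?powR_ge0// divr_ge0// expR_ge0.
  by rewrite ler_pM2l// mulr_gt0// powR_gt0.
have Hbump : expR (- (2 * r')) / 4 * t `^ (- hN) <= gbump b x0 t0 x t.
  apply: (bump_lower bI t00 r'0 _ _ t02 t012).
  - by apply: (le_trans x0R); rewrite ler_pM2r// le_max lexx orbT.
  - by apply: (le_trans xr); rewrite ler_pM2r// le_max lexx.
have main : m * b `^ hN * damp be q k t * gbump b x0 t0 x t <= f x t + Q * edge t.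
  refine (@bump_comparison R N alpha q alpha_gt q_gt1 gN rho T rho_gt0 TM 1 m b s Q t0 x0
    (damp be q k) (fun t => - (k * be / (q - 1) * t `^ (be - 1) * damp be q k t `^ q)) f
    bI t00 m0 ler01 (ltW Q0) bs x0r4 _ _ _ _ x t _ _).
  - move=> y t' /andP[t1 t2] yr.
    have t'0 : 0 < t' by exact: lt_le_trans t1.
    have [cf f0' hf _] := Hf y t' (introT andP (conj t'0 t2)) yr.
    split=> //; first exact: ltW.
    exists (- A t' (f y t')) => // z fz; rewrite mul1r ltrN2.
    by apply: absorb_lt => //; exact: ltW.
  - exact: fhalf.
  - move=> t' /andP[t1 t2]; have t'0 : 0 < t' by exact: lt_le_trans t1.
    split.
    + by apply: is_derive_damp => //; exact: ltW.
    + by rewrite damp_gt0 ?damp_le1 ?(ltW k0).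
    + rewrite mul1r beE (_ : k * be / (q - 1) = m `^ (q - 1))//.
      by rewrite /k; field; rewrite !gt_eqF.
  - move=> t' /andP[t1 t2]; have t'0 : 0 < t' by exact: lt_le_trans t1.
    rewrite -kpow//; apply: ler_wpM2r; first exact: powR_ge0.
    rewrite ler_pM2l; last by rewrite mulr_gt0// powR_gt0.
    exact: damp_le.
  - by rewrite t0t'.
  - exact: xrho.
have P0 : 0 < m * b `^ hN * damp be q k t.
  by rewrite mulr_gt0 ?damp_gt0 ?(ltW k0)// mulr_gt0// powR_gt0.
have h1 := ler_wpM2l (ltW P0) Hbump.
have h2 : Q * edge t <= c1 / 2 * t `^ (- g).
  have h3 := Htau1 t t_gt0 ttau1.
  have -> : Q * edge t = Q * expR (- (c0 * rho / t)) * t `^ (- g) by rewrite /gauss_edge; ring.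
  rewrite ler_pM2r ?powR_gt0//; have := ler_wpM2l (ltW Q0) h3.
  have -> : Q * (c1 / (2 * Q)) = c1 / 2 by field; rewrite gt_eqF.
  by [].
by move: h1 h2 damp_low main; slra.
Qed.

End lower_bound.

(** * Convergence to a multiple of the heat kernel *)

Section bounded_case.
Variables (R : realType) (N : nat) (alpha q : R).
Hypotheses (alpha_gt : -1 < alpha) (q_gt1 : 1 < q).
Hypothesis gN : N%:R / 2 < decay_exp alpha q.
Notation X := 'rV[R]_N.
Notation g := (decay_exp alpha q).
Notation A := (absorb alpha q).
Notation hN := (N%:R / 2 : R).
Variables (rho T R2 : R).
Hypotheses (rho_gt0 : 0 < rho) (T_gt0 : 0 < T) (TM : T <= c0 * rho / g)
  (R2_ge : g + 1 <= c0 * (1 - 4 * c0) * R2).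
Notation edge := (gauss_edge alpha q rho).
Notation E := (gauss hN 4^-1 (0 : X) 0).
Implicit Types (x : X) (t : R).

Ltac slra := clear -alpha_gt q_gt1 gN rho_gt0 T_gt0 TM R2_ge; lra.

Lemma gauss_edge_le_pow e : 0 < e ->
  exists2 tau, 0 < tau & forall t, 0 < t <= tau -> edge t <= e * t `^ (- hN).
Proof.
move=> e0; have gN0 : 0 <= g - hN by rewrite subr_ge0 ltW.
have cr0 : 0 < c0 * rho by rewrite mulr_gt0// c0_gt0.
have [tau tau0 H] := powexp_small gN0 cr0 e0.
exists tau => // t tI; have [t0 _] := andP tI.
have -> : edge t = t `^ (- (g - hN)) * expR (- (c0 * rho / t)) * t `^ (- hN).
  rewrite /gauss_edge [RHS]mulrAC -powRD ?(gt_eqF t0) ?implybT//.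
  by congr (_ `^ _ * _); ring.
by rewrite ler_pM2r ?powR_gt0// H.
Qed.

Lemma gauss_edge_le_E e : 0 < e ->
  exists2 tau, 0 < tau & forall x t, 0 < t <= tau -> n2 x <= c0 * rho -> edge t <= e * E x t.
Proof.
move=> e0; have gN0 : 0 <= g - hN by rewrite subr_ge0 ltW.
have cr0 : 0 < 3 / 4 * (c0 * rho) by rewrite !mulr_gt0// c0_gt0.
have [tau tau0 H] := powexp_small gN0 cr0 e0.
exists tau => // x t tI xr; have [t0 _] := andP tI.
have -> : edge t = t `^ (- (g - hN)) * expR (- (3 / 4 * (c0 * rho) / t)) *
    (t `^ (- hN) * expR (- (4^-1 * (c0 * rho) / t))).
  rewrite /gauss_edge (_ : - g = - (g - hN) + - hN); last by ring.
  rewrite powRD ?(gt_eqF t0) ?implybT//.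
  rewrite (_ : - (c0 * rho / t) = - (3 / 4 * (c0 * rho) / t) + - (4^-1 * (c0 * rho) / t)); last by field; rewrite gt_eqF.
  by rewrite expRD; ring.
apply: ler_pM; rewrite ?mulr_ge0 ?powR_ge0 ?expR_ge0 ?H//.
by apply: gauss_ge_pow.
Qed.

Lemma E_ge x t r : 0 < t -> n2 x <= r * t -> expR (- (r / 4)) * t `^ (- hN) <= E x t.
Proof.
move=> t0 xr; have := @gauss_ge_pow R N hN 4^-1 x t (r * t) t0 _ xr.
rewrite invr_ge0 ler0n => /(_ isT); rewrite mulrC.
by congr (expR (- _) * _ <= _); field; rewrite gt_eqF.
Qed.

Lemma outer_upper C f K tau : gauss_sol alpha q rho T C f -> 0 <= C -> 0 <= K -> 0 < tau <= T ->
  (forall x t, 0 < t <= tau -> n2 x <= R2 * t -> f x t <= K * E x t) ->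
  forall x t, 0 < t <= tau -> n2 x <= rho -> f x t <= K * E x t + C * edge t.
Proof.
move=> Hf C0 K0 /andP[tau0 tauT] HK x t tI xr.
have tauM : tau <= c0 * rho / g by exact: le_trans TM.
have TI t' : 0 < t' <= tau -> 0 < t' <= T.
  by move=> /andP[-> /le_trans]; apply.
have [h|h] := leP (n2 x) (R2 * t).
  apply: (le_trans (HK x t tI h)); rewrite lerDl mulr_ge0// ltW// gauss_edge_gt0//.
  by case/andP: tI.
apply: (@outer_comparison R N alpha q alpha_gt q_gt1 rho tau R2 tauM R2_ge C f
  (fun x t => K * E x t)) => //.
- move=> y t' t'I /andP[_ yr]; have [cf f0 hf fC] := Hf y t' (TI _ t'I) yr.
  by split=> //; exists (- A t' (f y t')).
- move=> y t' /andP[t'0 _] _; split.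
  + by apply: cvgM; [exact: cvg_cst|exact: gauss_continuous].
  + by rewrite mulr_ge0// ltW// gauss_gt0.
  + exists (K * 0); first by apply: heatZ; exact: heat_E.
    by rewrite mulr0 oppr_le0 absorb_ge0.
- by move=> y t' t'I yR _; apply: HK => //; rewrite yR.
- by rewrite xr ltW.
Qed.

Lemma damp_E_subsol K x t : 0 < K -> 0 < t ->
  let k := K `^ (q - 1) * ((q - 1) / bexp N alpha q) in
  exists2 d, heat (fun x t => damp (bexp N alpha q) q k t * (K * E x t)) x t d &
    d <= - A t (damp (bexp N alpha q) q k t * (K * E x t)).
Proof.
move=> K0 t0 k; have be0 := bexp_gt0 q_gt1 gN; have beE := bexpE N alpha q_gt1.
set be := bexp N alpha q in k be0 beE *.
have q10 : 0 < q - 1 by rewrite subr_gt0.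
have k0 : 0 < k by apply: mulr_gt0; [exact: powR_gt0|exact: divr_gt0].
have E0 : 0 < E x t by exact: gauss_gt0.
have KE0 : 0 < K * E x t by exact: mulr_gt0.
exists (- (k * be / (q - 1) * t `^ (be - 1) * damp be q k t `^ q) * (K * E x t) + damp be q k t * (K * 0)).
  apply: heatM; last by apply: heatZ; exact: heat_E.
  by apply: is_derive_damp => //; exact: ltW.
have th0 : 0 < damp be q k t by rewrite damp_gt0// ltW.
have Em : K * E x t <= K * t `^ (- hN).
  by rewrite ler_pM2l//; apply: gauss_le_pow.
have := absorb_bump alpha q_gt1 t0 K0 KE0 th0 Em.
rewrite beE (_ : k * be / (q - 1) = K `^ (q - 1)); last first.
  by rewrite /k; field; rewrite !gt_eqF.
by rewrite !mulr0 addr0 mulNr lerN2.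
Qed.

(** A multiple of E is not a subsolution of the equation with absorption, but its damped version is,
    and the damping tends to 1 as t -> 0, whence the loss d. For t <= 1 the kernel lies below
    [gauss g c0], as g > N / 2 and c0 < 1 / 4. *)
Lemma outer_lower C f K tau : gauss_sol alpha q rho T C f -> 0 < K -> 0 < tau <= T -> tau <= 1 ->
  (forall x t, 0 < t <= tau -> n2 x <= R2 * t -> K * E x t <= f x t) ->
  forall d, 0 < d -> exists2 tau', 0 < tau' & forall x t, 0 < t <= tau' -> n2 x <= c0 * rho ->
    (K - d) * E x t <= f x t.
Proof.
move=> Hf K0 /andP[tau0 tauT] tau1 HK d d0.
have tauM : tau <= c0 * rho / g by exact: le_trans TM.
have TI t' : 0 < t' <= tau -> 0 < t' <= T.
  by move=> /andP[-> /le_trans]; apply.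
have be0 := bexp_gt0 q_gt1 gN.
set be := bexp N alpha q in be0.
have q10 : 0 < q - 1 by rewrite subr_gt0.
pose k := K `^ (q - 1) * ((q - 1) / be).
have k0 : 0 < k by apply: mulr_gt0; [exact: powR_gt0|exact: divr_gt0].
pose w x t := damp be q k t * (K * E x t).
have EG y t : 0 < t -> t <= 1 -> E y t <= gauss g c0 0 0 y t.
  move=> t0 t1; rewrite !gauss0E; apply: ler_pM; rewrite ?powR_ge0 ?expR_ge0//.
    by apply: ger_powR; rewrite ?t0// lerN2 ltW.
  rewrite ler_expR lerN2 ler_pM2r ?invr_gt0// ler_wpM2r ?n2_ge0// /c0.
  by slra.
have w_le y t : 0 < t -> w y t <= K * E y t.
  move=> t0; have KE0 : 0 < K * E y t by rewrite mulr_gt0// gauss_gt0.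
  by rewrite ger_pMl// damp_le1// ltW.
have low x t : 0 < t <= tau -> n2 x <= rho -> w x t <= f x t + K * edge t.
  move=> tI xr; have [t0 tt] := andP tI.
  have [h|h] := leP (n2 x) (R2 * t).
    apply: (le_trans (w_le x t t0)); apply: (le_trans (HK x t tI h)).
    by rewrite lerDl mulr_ge0// ltW// gauss_edge_gt0.
  apply: (@outer_comparison R N alpha q alpha_gt q_gt1 rho tau R2 tauM R2_ge K w f) => //.
  - exact: ltW.
  - move=> y t' t'I _; have [t'0 t't] := andP t'I; split.
    + apply: cvgM; last by apply: cvgM; [exact: cvg_cst|exact: gauss_continuous].
      apply: cont_time; have := is_derive_damp be q_gt1 (ltW k0) t'0.
      exact: is_derive_continuous.
    + exact: damp_E_subsol.
    + apply: (le_trans (w_le y t' t'0)); rewrite ler_pM2l//; apply: EG => //.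
      exact: le_trans tau1.
  - move=> y t' t'I /andP[_ yr]; have [cf f0 hf fC] := Hf y t' (TI _ t'I) yr.
    by split=> //; [exact: ltW|exists (- A t' (f y t'))].
  - move=> y t' t'I yR _; apply: (le_trans (w_le y t' _)); first by case/andP: t'I.
    by apply: HK => //; rewrite yR.
  - by rewrite xr ltW.
have e0 : 0 < d / (2 * K) by rewrite divr_gt0// mulr_gt0.
have [taud taud0 Hd] := damp_near1 be0 q_gt1 (ltW k0) e0.
have [taum taum0 Hm] := gauss_edge_le_E e0.
exists (Num.min tau (Num.min taud taum)); first by rewrite !lt_min tau0 taud0.
move=> x t /andP[t0]; rewrite !le_min => /and3P[t1 t2 t3] xr.
have xr' : n2 x <= rho.
  by apply: (le_trans xr); rewrite ger_pMl// /c0 invf_le1 ?ler1n ?ltr0n.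
have E0 : 0 < E x t by exact: gauss_gt0.
have h1 := low x t (introT andP (conj t0 t1)) xr'.
have h2 := Hd t (introT andP (conj t0 t2)).
have h3 := Hm x t (introT andP (conj t0 t3)) xr.
have h4 : (1 - d / (2 * K)) * (K * E x t) <= w x t.
  by apply: ler_wpM2r => //; rewrite mulr_ge0// ltW.
have h5 := ler_wpM2l (ltW K0) h3.
have h6 : (1 - d / (2 * K)) * (K * E x t) = K * E x t - d / 2 * E x t.
  by field; rewrite gt_eqF.
have h7 : K * (d / (2 * K) * E x t) = d / 2 * E x t by field; rewrite gt_eqF.
rewrite mulrBl; move: h1 h4 h5 h6 h7; slra.
Qed.

(** If f were below (K0 - d) E at points with arbitrarily small times, the deficit K E + C edge - f
    would be at least m t1^-(N/2) near such a point. Its heat operator is positive, so an undamped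
    bump carries the deficit to all later small times. This gives f <= (K - c2 / 2) E on
    paraboloids, where K < K0 + c2 / 4, contradicting the minimality of K0. *)
Lemma inner_lower C f K0 : gauss_sol alpha q rho T C f -> 0 <= C -> 0 <= K0 ->
  (forall e, 0 < e -> exists2 K, K0 <= K < K0 + e & exists2 tau, 0 < tau &
     forall x t, 0 < t <= tau -> n2 x <= R2 * t -> f x t <= K * E x t) ->
  (forall K tau, 0 < tau ->
     (forall x t, 0 < t <= tau -> n2 x <= R2 * t -> f x t <= K * E x t) -> K0 <= K) ->
  forall d, 0 < d -> exists2 tau, 0 < tau & forall x t, 0 < t <= tau ->
    n2 x <= R2 * t -> (K0 - d) * E x t <= f x t.
Proof.
move=> Hf C0 K00 Kup Klow d d0.
have g0 : 0 < g by exact: decay_exp_gt0.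
have R20 : 0 < R2 by have := R2_gt0 alpha_gt q_gt1 R2_ge.
apply: contrapT => bad.
have {}bad tau : 0 < tau -> exists x t, [/\ 0 < t <= tau, n2 x <= R2 * t & f x t < (K0 - d) * E x t].
  move=> tau0; apply: contrapT => H; apply: bad; exists tau => // x t tI xR.
  by rewrite leNgt; apply/negP => h; apply: H; exists x, t.
have [L1 L10 HL1] := sol_parabolic_lipschitz q_gt1 Hf C0.
have [L2 L20 HL2] := @parabolic_lipschitz R N 0 (lexx _).
(* At the bad point the deficit is at least d E >= 2 m t1^-(N/2); the choice of [sg] below limits
   the oscillations of f and of K E together to m t1^-(N/2). *)
pose m := d * expR (- (R2 / 4)) / 2.
have m0 : 0 < m by rewrite divr_gt0// mulr_gt0// expR_gt0.
have [S SE] : exists S, S = (K0 + 1) * L2 * 4 `^ hN + L1 * ((K0 + 1 + C) * 4 `^ hN) by eexists.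
have p4 : 0 < 4 `^ hN :> R by exact: powR_gt0.
have K10 : 0 < K0 + 1 by rewrite ltr_wpDl.
have KC0 : 0 < K0 + 1 + C by rewrite ltr_wpDr.
have S0 : 0 < S.
  by rewrite SE addr_gt0// !mulr_gt0.
have [sg /andP[sg0 sg1] sgS] : exists2 sg, 0 < sg <= 1 & sg * S <= m.
  exists (Num.min 1 (m / S)); first by rewrite lt_min ltr01 divr_gt0// ge_min lexx.
  by rewrite -ler_pdivlMr// ge_min lexx orbT.
pose s := sg ^+ 2 * (3 / 4); have s0 : 0 < s by rewrite mulr_gt0 ?exprn_gt0.
have [b bI bs] := @bump_width R N s s0; have [b0 b1] := andP bI.
pose c2 := m * b `^ hN * (expR (- (2 * R2)) / 4).
have c20 : 0 < c2 by rewrite !mulr_gt0 ?powR_gt0 ?expR_gt0.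
pose Q := m * b `^ hN; have Q0 : 0 < Q by rewrite mulr_gt0 ?powR_gt0.
have e0 : 0 < Num.min 1 (c2 / 4) by rewrite lt_min ltr01 divr_gt0.
have [K /andP[K0K KK0] [tau1 tau10 HK]] := Kup _ e0.
have K1 : K <= K0 + 1 by apply: (le_trans (ltW KK0)); rewrite lerD2l ge_min lexx.
have Kc2 : K < K0 + c2 / 4 by apply: (lt_le_trans KK0); rewrite lerD2l ge_min lexx orbT.
have Kge0 : 0 <= K by exact: le_trans K0K.
have [taua taua0 Ha] := gauss_edge_le_pow ltr01.
have CQ0 : 0 < C + Q by rewrite ltr_wpDl.
have e1 : 0 < c2 / (2 * (C + Q)) by rewrite divr_gt0// mulr_gt0.
have [taub taub0 Hb] := gauss_edge_le_pow e1.
pose tau := Num.min (Num.min (Num.min T 1) (Num.min tau1 taua)) taub.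
have tau0 : 0 < tau by rewrite !lt_min T_gt0 ltr01 tau10 taua0.
have [tauT tau_1 tau_tau1 tau_a tau_b] : [/\ tau <= T, tau <= 1, tau <= tau1, tau <= taua & tau <= taub].
  by rewrite /tau; split; rewrite !ge_min lexx ?orbT.
clearbody tau.
have tauM : tau <= c0 * rho / g by exact: le_trans TM.
have fup x t : 0 < t <= tau -> n2 x <= rho -> f x t <= K * E x t + C * edge t.
  apply: outer_upper => //; first by rewrite tau0.
  by move=> y t' /andP[t'0 t't] yR; apply: HK => //; rewrite t'0 (le_trans t't).
have E_le y t : 0 < t -> E y t <= t `^ (- hN) by move=> t0; apply: gauss_le_pow.
suff : K0 <= K - c2 / 2 by move: Kc2 c20; slra.
(* The bad point is chosen after (x, t), but tau' and c2 do not depend on it, as minimality of K0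
   requires. *)
pose tau' := Num.min tau (rho / R2).
have tau'0 : 0 < tau' by rewrite lt_min tau0 divr_gt0.
apply: (Klow _ tau' tau'0) => x t /andP[t0]; rewrite le_min => /andP[tt tr] xR.
have xrho : n2 x <= rho by apply: (le_trans xR); rewrite mulrC -ler_pdivlMr.
have D0 : 0 < 2 + 12 * R2 by rewrite addr_gt0 ?mulr_gt0.
have D1 : 0 < 12 + 8 * R2 by rewrite addr_gt0 ?mulr_gt0.
have tau00 : 0 < Num.min (t / (2 + 12 * R2)) (rho / (12 + 8 * R2)).
  by rewrite lt_min !divr_gt0.
have [x0 [t1 [/andP[t10]]]] := bad _ tau00.
rewrite le_min !ler_pdivlMr// => /andP[t1t t1r] x0R fbad.
have R2t1 : 0 < R2 * t1 by rewrite mulr_gt0.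
have t12 : 2 * t1 <= t.
  by move: t1t R2t1; slra.
have t112 : 12 * R2 * t1 <= t.
  by move: t1t t10; slra.
have t1t' : t1 <= t.
  by move: t12 t10; slra.
have t1tau : t1 <= tau by exact: le_trans tt.
have t1T : t1 <= T by exact: le_trans tauT.
have x0r4 : n2 x0 <= rho / 4.
  by move: x0R t1r t10 R2t1; slra.
have x0rho : 12 * t1 + 2 * n2 x0 <= rho.
  by move: x0R t1r R2t1; slra.
(* Adding [C * edge] makes u nonnegative on the whole ball, by [fup], and does not spoil the sign of
   the heat operator. *)
pose u (y : X) t' := K * E y t' + C * edge t' - f y t'.
pose P := t1 `^ (- hN); have P0 : 0 < P by exact: powR_gt0.
have pow4 t' : t1 / 4 <= t' -> t' `^ (- hN) <= 4 `^ hN * P.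
  move=> h; apply: (@le_trans _ _ ((t1 / 4) `^ (- hN))).
    by apply: powRN_anti => //; exact: divr_gt0.
  rewrite powRM ?(ltW t10) ?invr_ge0// (_ : (4^-1 : R) `^ (- hN) = 4 `^ hN) 1?mulrC//.
  by rewrite -(powR_inv1 (ler0n _ 4)) -powRrM mulN1r opprK.
have ulow y : n2 (y - x0) <= s * t1 -> n2 y <= rho -> m * t1 `^ (- hN) <= u y t1.
  move=> yx yr; rewrite -/P.
  have hy : n2 (y - x0) <= sg ^+ 2 * (3 / 4 * t1) by rewrite mulrA.
  have sgI : 0 <= sg <= 1 by rewrite sg1 (ltW sg0).
  have t1I : 0 < t1 <= T by rewrite t10.
  have B10 : 0 < (K0 + 1 + C) * 4 `^ hN * P.
    by rewrite !mulr_gt0.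
  have B20 : 0 < 4 `^ hN * P by rewrite mulr_gt0.
  have A1 : `|f y t1 - f x0 t1| <= L1 * sg * ((K0 + 1 + C) * 4 `^ hN * P).
    apply: (HL1 x0 t1 _ sg t1I B10 sgI x0rho _ y hy) => z t' _ zr /andP[t'1 t't].
    have t'0 : 0 < t' by apply: lt_le_trans t'1; rewrite divr_gt0.
    have t'tau : t' <= tau by exact: le_trans t1tau.
    apply: (le_trans (fup z t' _ zr)); first by rewrite t'0.
    have h1 := Ha t' (introT andP (conj t'0 (le_trans t'tau tau_a))).
    rewrite mul1r in h1.
    have h2 := le_trans (E_le z t' t'0) (pow4 t' t'1).
    have h3 := le_trans h1 (pow4 t' t'1).
    have h4 : K * E z t' <= (K0 + 1) * (4 `^ hN * P).
      by apply: ler_pM => //; rewrite ltW// gauss_gt0.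
    have h5 := ler_wpM2l C0 h3.
    by move: h4 h5; slra.
  have A2 : `|E y t1 - E x0 t1| <= L2 * sg * (4 `^ hN * P).
    apply: (HL2 E x0 t1 _ sg t10 B20 sgI _ y hy) => z t' _ /andP[t'1 t't].
    have t'0 : 0 < t' by apply: lt_le_trans t'1; rewrite divr_gt0.
    split; first exact: gauss_continuous.
      by rewrite ltW ?gauss_gt0//= (le_trans (E_le z t' t'0))// pow4.
    by exists 0; [exact: heat_E|rewrite normr0 mul0r mul0r].
  have A3 : d * (expR (- (R2 / 4)) * P) <= d * E x0 t1.
    by rewrite ler_pM2l//; exact: E_ge.
  have A4 : K * (L2 * sg * (4 `^ hN * P)) <= (K0 + 1) * (L2 * sg * (4 `^ hN * P)).
    by apply: ler_wpM2r => //; rewrite !mulr_ge0// ltW.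
  have A5 : sg * S * P <= m * P by rewrite ler_pM2r.
  have A6 : 2 * m * P = d * (expR (- (R2 / 4)) * P) by rewrite /m; field.
  have A7 : K0 * E x0 t1 <= K * E x0 t1 by rewrite ler_pM2r// gauss_gt0.
  have A8 : 0 <= C * edge t1 by rewrite mulr_ge0// ltW// gauss_edge_gt0.
  have A9 : - (L2 * sg * (4 `^ hN * P)) * K <= (E y t1 - E x0 t1) * K.
    by apply: ler_wpM2r => //; move: A2; rewrite ler_norml => /andP[].
  move: A1; rewrite ler_norml => /andP[_ A1].
  move: A1 A3 A4 A5 A6 A7 A8 A9 fbad; rewrite /u SE.
  move: (E x0 t1) (E y t1) (f y t1) (f x0 t1) (edge t1) (4 `^ hN) (expR _) => v1 v2 v3 v4 v5 v6 v7.
  by slra.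
have Hbump : expR (- (2 * R2)) / 4 * t `^ (- hN) <= gbump b x0 t1 x t.
  by apply: (bump_lower bI t10 R20 x0R xR t12 t112).
have main : m * b `^ hN * 1 * gbump b x0 t1 x t <= u x t + Q * edge t.
  refine (@bump_comparison R N alpha q alpha_gt q_gt1 gN rho tau rho_gt0 tauM 0 m b s Q t1 x0
    (fun=> 1) (fun=> 0) u bI t10 m0 (lexx _) (ltW Q0) bs x0r4 _ ulow _ _ x t _ xrho).
  - move=> y t' /andP[t'1 t'2] yr.
    have t'0 : 0 < t' by exact: lt_le_trans t'1.
    have [cf f0' hf _] := Hf y t' (introT andP (conj t'0 (le_trans t'2 tauT))) yr.
    have [dM hM dM0] := heat_gauss_edge alpha_gt q_gt1 tauM y t'0 t'2.
    split.
    + apply: cvgB; last exact: cf.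
      apply: cvgD; first by apply: cvgM; [exact: cvg_cst|exact: gauss_continuous].
      by apply: cvgM; [exact: cvg_cst|exact: continuous_gauss_edge].
    + by rewrite subr_ge0; apply: fup => //; rewrite t'0.
    + exists (K * 0 + C * dM - (- A t' (f y t'))).
        by apply: heatB => //; apply: heatD; apply: heatZ => //; exact: heat_E.
      move=> z _; have := absorb_gt0 alpha q t'0 f0'; have := mulr_ge0 C0 dM0.
      by slra.
  - by move=> t' _; split; rewrite ?ltr01 ?lexx ?mul0r ?oppr0//; exact: is_derive_cst.
  - move=> t' /andP[t'1 t'2]; have t'0 : 0 < t' by exact: lt_le_trans t'1.
    rewrite mulr1 ler_pM2l//; apply: ger_powR; rewrite ?t'0 ?(le_trans t'2)//.
    by rewrite lerN2 ltW.
  - by rewrite t1t'.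
have h1 := ler_wpM2l (ltW Q0) Hbump.
have h2 := Hb t (introT andP (conj t0 (le_trans tt tau_b))).
have h3 : (C + Q) * edge t <= c2 / 2 * t `^ (- hN).
  have := ler_wpM2l (ltW CQ0) h2.
  have -> : (C + Q) * (c2 / (2 * (C + Q)) * t `^ (- hN)) = c2 / 2 * t `^ (- hN).
    by field; rewrite gt_eqF.
  by [].
have h4 : c2 / 2 * E x t <= c2 / 2 * t `^ (- hN).
  by rewrite ler_pM2l ?divr_gt0//; exact: E_le.
have h5 : Q * (expR (- (2 * R2)) / 4 * t `^ (- hN)) = c2 * t `^ (- hN) by rewrite /Q /c2; ring.
move: main h1 h3 h4; rewrite h5 mulr1 -/Q /u.
by slra.
Qed.

Theorem bounded_asymptotics C f : gauss_sol alpha q rho T C f -> 0 <= C ->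
  (exists L : R, exists2 tau, 0 < tau & forall x t, 0 < t <= tau -> n2 x <= R2 * t ->
     f x t <= L * t `^ (- hN)) ->
  exists2 K, 0 <= K & forall d, 0 < d -> exists2 tau, 0 < tau &
    forall x t, 0 < t <= tau -> n2 x <= c0 * rho -> `|f x t - K * E x t| <= d * E x t.
Proof.
move=> Hf C0 [L [tauL tauL0 HL]].
have g0 : 0 < g by exact: decay_exp_gt0.
have R20 : 0 < R2 by have := R2_gt0 alpha_gt q_gt1 R2_ge.
have cr0 : 0 < c0 * rho by rewrite mulr_gt0// c0_gt0.
pose adm K := exists2 tau, 0 < tau & forall x t, 0 < t <= tau -> n2 x <= R2 * t -> f x t <= K * E x t.
have adm_ge0 K : adm K -> 0 <= K.
  move=> [tau tau0 H]; pose t := Num.min tau T.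
  have t0 : 0 < t by rewrite lt_min tau0.
  have tT : t <= T by rewrite ge_min lexx orbT.
  have ttau : t <= tau by rewrite ge_min lexx.
  have r0' : n2 (0 : X) <= rho by rewrite n2_0 ltW.
  have [_ f0 _ _] := Hf 0 t (introT andP (conj t0 tT)) r0'.
  have := H 0 t (introT andP (conj t0 ttau)); rewrite n2_0 => /(_ (ltW (mulr_gt0 R20 t0))) h.
  have := lt_le_trans f0 h; rewrite pmulr_lgt0 ?gauss_gt0//; exact: ltW.
have adm_ne : [set K | adm K] !=set0.
  exists (`|L| * expR (R2 / 4)); exists tauL => // x t tI xR; have [t0 _] := andP tI.
  apply: (le_trans (HL x t tI xR)); apply: (@le_trans _ _ (`|L| * t `^ (- hN))).
    by rewrite ler_pM2r ?powR_gt0// ler_norm.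
  rewrite -mulrA; apply: ler_wpM2l => //.
  have := E_ge t0 xR; rewrite expRN mulrC ler_pdivrMr ?expR_gt0// => h.
  by rewrite [leRHS]mulrC.
have adm_lb : has_lbound [set K | adm K] by exists 0 => K /adm_ge0.
pose K0 := inf [set K | adm K].
have K00 : 0 <= K0 by apply: lb_le_inf => // K /adm_ge0.
have K0lb K : adm K -> K0 <= K by move=> ?; apply: ge_inf.
have adm_near e : 0 < e -> exists2 K, K0 <= K < K0 + e & adm K.
  move=> e0; have [|K HK KK] := @inf_adherent _ [set K | adm K] e e0; first by split.
  by exists K => //; rewrite K0lb.
have low := inner_lower Hf C0 K00 adm_near (fun K tau h H => K0lb K (ex_intro2 _ _ tau h H)).
exists K0 => // d d0; have d20 : 0 < d / 2 by rewrite divr_gt0.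
have up : exists2 tau, 0 < tau & forall x t, 0 < t <= tau -> n2 x <= c0 * rho ->
    f x t <= (K0 + d) * E x t.
  have [K /andP[K1 K2] [tau tau0 HK]] := adm_near _ d20.
  have C10 : 0 < d / 2 / (C + 1) by rewrite divr_gt0// ltr_wpDl.
  have [tau' tau'0 Hm] := gauss_edge_le_E C10.
  exists (Num.min (Num.min T tau) tau'); first by rewrite !lt_min T_gt0 tau0.
  move=> x t /andP[t0]; rewrite !le_min => /andP[/andP[t1 t2] t3] xr.
  have xr' : n2 x <= rho.
    by apply: (le_trans xr); rewrite ger_pMl// /c0 invf_le1 ?ler1n ?ltr0n.
  have tI : 0 < Num.min T tau <= T by rewrite lt_min T_gt0 tau0 ge_min lexx.
  have h1 : f x t <= K * E x t + C * edge t.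
    apply: (outer_upper Hf C0 (le_trans K00 K1) tI) => //; last by rewrite t0 le_min t1.
    move=> y t' /andP[t'0]; rewrite le_min => /andP[_ t'2] yR; apply: HK => //.
    by rewrite t'0.
  have h2 := Hm x t (introT andP (conj t0 t3)) xr.
  have h3 : C * edge t <= d / 2 * E x t.
    have := ler_wpM2l (addr_ge0 C0 ler01) h2.
    have -> : (C + 1) * (d / 2 / (C + 1) * E x t) = d / 2 * E x t.
      by field; rewrite gt_eqF// ltr_wpDl.
    have := gauss_edge_gt0 alpha q rho t0.
    by slra.
  have h4 : K * E x t <= (K0 + d / 2) * E x t by rewrite ler_pM2r ?gauss_gt0// ltW.
  by move: h1 h3 h4; slra.
have dn : exists2 tau, 0 < tau & forall x t, 0 < t <= tau -> n2 x <= c0 * rho ->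
    (K0 - d) * E x t <= f x t.
  (* [outer_lower] asks for a positive constant; if K0 <= d / 2, positivity of f is enough. *)
  have [h|h] := leP (K0 - d / 2) 0.
    exists T => // x t tI xr; have [t0 _] := andP tI.
    have xr' : n2 x <= rho.
      by apply: (le_trans xr); rewrite ger_pMl// /c0 invf_le1 ?ler1n ?ltr0n.
    have [_ f0 _ _] := Hf x t tI xr'.
    apply: le_trans (ltW f0); rewrite pmulr_lle0 ?gauss_gt0//.
    by move: h d0; slra.
  have [tau tau0 Hlow] := low _ d20.
  have tI : 0 < Num.min (Num.min T tau) 1 <= T.
    by rewrite !lt_min T_gt0 tau0 ltr01 !ge_min lexx.
  have t1 : Num.min (Num.min T tau) 1 <= 1 by rewrite ge_min lexx orbT.
  have [|tau' tau'0 H] := outer_lower Hf h tI t1 _ d20.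
    move=> x t /andP[t0]; rewrite !le_min => /andP[/andP[_ t2] _] xR.
    by apply: Hlow => //; rewrite t0.
  exists tau' => // x t tI' xr; apply: le_trans (H x t tI' xr).
  by rewrite (_ : K0 - d / 2 - d / 2 = K0 - d)//; field.
have [[tau1 tau10 H1] [tau2 tau20 H2]] := (up, dn).
exists (Num.min tau1 tau2); first by rewrite lt_min tau10.
move=> x t /andP[t0]; rewrite le_min => /andP[t1 t2] xr.
have := H1 x t (introT andP (conj t0 t1)) xr; have := H2 x t (introT andP (conj t0 t2)) xr.
rewrite ler_norml mulrBl mulrDl.
by move=> h1 h2; apply/andP; split; move: h1 h2; slra.
Qed.

End bounded_case.

Lemma maxprin_bound (R : realType) (N : nat) (G f : 'rV[R]_N -> R -> R) (B t1 : R) :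
  continuous (fun p : 'rV[R]_N * R => G p.1 p.2) ->
  (forall x t, G x t <= 0 -> t <= t1 -> n2 x <= B /\ 0 <= t) ->
  (forall x t, G x t <= 0 -> t <= t1 ->
    {for (x, t), continuous (fun p : 'rV[R]_N * R => f p.1 p.2)}) ->
  exists2 M, 0 <= M & forall x t, G x t <= 0 -> t <= t1 -> f x t <= M.
Proof.
move=> cG GB cf; pose K := [set p : 'rV[R]_N * R | G p.1 p.2 <= 0 /\ p.2 <= t1].
have [/set0P[p0 Kp0]|K0] := pselect (K != set0); last first.
  exists 0 => // x t Gx tt; exfalso; apply: K0.
  by apply/set0P; exists (x, t).
have [|||[x0 t0] h1 h2] := @compact_EVT_max _ _ (fun p : 'rV[R]_N * R => f p.1 p.2) K.
- by exists p0.
- exact: maxprin_compact GB.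
- by apply: continuous_in_subspaceT => -[y t]; rewrite inE => -[/= h1 h2]; apply: cf.
exists (Num.max 0 (f x0 t0)) => [|x t Gx tt]; first by rewrite le_max lexx.
by rewrite le_max (h2 (x, t)) ?orbT// inE.
Qed.

(** * A barrier on balls away from the origin *)

Section bowl.
Variables (R : realType) (N : nat) (alpha q : R).
Hypotheses (alpha_gt : -1 < alpha) (q_gt1 : 1 < q).
Notation X := 'rV[R]_N.
Notation g := (decay_exp alpha q).
Notation A := (absorb alpha q).
Implicit Types (x y : X) (t r : R).

Ltac slra := clear -alpha_gt q_gt1; lra.

(** On the sphere |x - y|^2 = r it equals t^-g, the size of the universal bound; at the centre it is
    t^-g exp(- r / (32 t)), which tends to 0 with t. For r = |y|^2 / 4 the latter is the Gaussian
    with constant c0 = 1 / 128. *)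
Definition bowl y r x t : R :=
  t `^ (- g) * expR (- (32^-1 * (r - n2 (x - y)) ^+ 2 / r / t)).

Lemma bowl_gt0 y r x t : 0 < t -> 0 < bowl y r x t.
Proof. by move=> t0; rewrite mulr_gt0 ?powR_gt0 ?expR_gt0. Qed.

Lemma bowl_continuous y r x t : 0 < t ->
  {for (x, t), continuous (fun p : X * R => bowl y r p.1 p.2)}.
Proof.
move=> t0.
have c2 : {for (x, t), continuous (fun p : X * R => p.2 `^ (- g))}.
  apply: (@cont_time _ _ (fun t => t `^ (- g))).
  exact: is_derive_continuous (is_derive1_powR _ t0).
apply: cvgM; first exact: c2.
apply: (@continuous_comp _ _ _ (fun p : X * R => - (32^-1 * (r - n2 (p.1 - y)) ^+ 2 / r / p.2)) expR);
  last exact: continuous_expR.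
have c3 : {for (x, t), continuous (fun p : X * R => r - n2 (p.1 - y))}.
  by apply: cvgB; [exact: cvg_cst|exact: continuous_n2_sub].
apply: cvgN; apply: cvgM; first apply: cvgM; first apply: cvgM.
- exact: cvg_cst.
- by apply: cvgM; exact: c3.
- exact: cvg_cst.
- by apply: cvgV; [rewrite /= gt_eqF|exact: continuous_snd].
Qed.

Lemma heat_bowl y r x t : 0 < t -> 0 < r -> n2 (x - y) <= r ->
  exists2 d, heat (bowl y r) x t d &
    bowl y r x t / t * (64^-1 * ((r - n2 (x - y)) ^+ 2 / r / t) - (g + N%:R / 8)) <= d.
Proof.
move=> t0 r0 nr; set z := x - y; set n := n2 z.
have n0 : 0 <= n by exact: n2_ge0.
pose D := bowl y r x t; have D0 : 0 < D by exact: bowl_gt0.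
pose k := 32^-1 * (r - n) ^+ 2 / r.
exists (D / t * (- g + k / t) - \sum_(i < N) D * ((4 / 32 * (r - n) * z 0 i / r / t) ^+ 2 +
   2 / 32 / r / t * (2 * (r - n) - 4 * z 0 i ^+ 2))).
  exists (D / t * (- g + k / t)), (fun i => D * ((4 / 32 * (r - n) * z 0 i / r / t) ^+ 2 +
   2 / 32 / r / t * (2 * (r - n) - 4 * z 0 i ^+ 2))); split=> //.
    exact: is_derive_powexp.
  move=> i; rewrite /sd /bowl /D /bowl -mulrA; apply: sdiffZ.
  pose p h := - (32^-1 * (r - (n + 2 * z 0 i * h + h ^+ 2)) ^+ 2 / r / t).
  pose p1 h := 2 / 32 * (r - (n + 2 * z 0 i * h + h ^+ 2)) * (2 * z 0 i + 2 * h) / r / t.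
  have -> : (fun h => expR (- (32^-1 * (r - n2 (x + h *: ebasis R i - y)) ^+ 2 / r / t))) = (fun h => expR (p h)).
    by apply/funext => h; rewrite /p -n2_line -addrA (addrC _ (- y)) addrA.
  have -> : expR (- (32^-1 * (r - n2 (x - y)) ^+ 2 / r / t)) = expR (p 0).
    by rewrite /p mulr0 expr0n !addr0.
  have -> : 4 / 32 * (r - n) * z 0 i / r / t = p1 0.
    by rewrite /p1 expr0n !mulr0 !addr0; field; rewrite !gt_eqF.
  apply: (@sdiff_exp _ p p1).
    by move=> h; rewrite /p /p1; apply: is_derive_eq; rewrite /GRing.scale/=; ring.
  by rewrite /p1; apply: is_derive_eq; rewrite /GRing.scale/=; ring.
rewrite -mulr_sumr big_split/= -mulr_sumr.
rewrite (eq_bigr (fun i => (4 / 32 * (r - n) / r / t) ^+ 2 * z 0 i ^+ 2)); last by move=> i _; ring.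
rewrite -mulr_sumr sumrB -!mulr_sumr -/(n2 z) -/n sumr_const card_ord -[(r - n) *+ N]mulr_natl.
rewrite -/D.
have -> : D / t * (- g + k / t) - D * ((4 / 32 * (r - n) / r / t) ^+ 2 * n +
    2 / 32 / r / t * (2 * (N%:R * (r - n)) - 4 * n)) =
  D / t * (32^-1 * ((r - n) ^+ 2 / r / t) - 64^-1 * ((r - n) ^+ 2 / r / t) * (n / r) - g
     - N%:R / 8 * ((r - n) / r) + 4^-1 * (n / r)).
  by rewrite /k; field; rewrite !gt_eqF.
apply: ler_wpM2l; first by rewrite divr_ge0 ?(ltW D0) ?(ltW t0).
set Z := (r - n) ^+ 2 / r / t.
have Z0 : 0 <= Z by rewrite !divr_ge0 ?sqr_ge0 ?(ltW r0) ?(ltW t0).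
have w0 : 0 <= n / r by rewrite divr_ge0// ltW.
have w1 : n / r <= 1 by rewrite ler_pdivrMr// mul1r.
have -> : (r - n) / r = 1 - n / r by field; rewrite gt_eqF.
have hZ : Z * (n / r) <= Z by rewrite ler_piMr.
have hN : 0 <= N%:R * (n / r) by rewrite mulr_ge0.
move: hZ hN w0 w1; move: (n / r) => w.
by slra.
Qed.

(** Put S = g + N / 8 and Z = (r - |x - y|^2)^2 / (r t). Where Z >= 64 S the heat operator is
    already nonnegative; elsewhere exp(- Z / 32) >= exp(- 2 S), and the absorption of a large
    multiple K compensates. *)
Lemma bowl_super K y r x t : 0 < t -> 0 < r -> n2 (x - y) <= r -> 0 < K ->
  g + N%:R / 8 <= (K * expR (- (2 * (g + N%:R / 8)))) `^ (q - 1) ->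
  exists2 d, heat (fun x t => K * bowl y r x t) x t d & - A t (K * bowl y r x t) <= d.
Proof.
move=> t0 r0 nr K0 HK; have [d hd dge] := heat_bowl t0 r0 nr.
have q10 : 0 < q - 1 by rewrite subr_gt0.
exists (K * d); first exact: heatZ.
have W0 := bowl_gt0 y r x t0; have KW0 : 0 < K * bowl y r x t by exact: mulr_gt0.
set S := g + _ in HK dge.
rewrite (absorb_scale alpha q_gt1 t0 KW0).
have -> : t `^ g * (K * bowl y r x t) =
    K * expR (- (32^-1 * ((r - n2 (x - y)) ^+ 2 / r / t))).
  rewrite /bowl mulrCA [_ `^ g * _]mulrA powg_mul// mul1r; congr (_ * expR (- _)).
  by rewrite !mulrA.
set Z := _ / r / t in dge *.
have dge' := ler_wpM2l (ltW K0) dge; apply: le_trans dge'.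
set W := bowl _ _ _ _ in W0 KW0 *; clearbody W.
rewrite -mulrN (_ : K * (W / t * (64^-1 * Z - S)) = K * W / t * (64^-1 * Z - S)); last by ring.
apply: ler_wpM2l; first by rewrite divr_ge0 ?(ltW t0) ?(ltW KW0).
set P := _ `^ _.
have P0 : 0 <= P by exact: powR_ge0.
have [h|h] := leP (64 * S) Z.
  by move: P0 h; slra.
have Z0 : 0 <= Z by rewrite !divr_ge0 ?sqr_ge0 ?(ltW r0) ?(ltW t0).
suff : S <= P by move: Z0; slra.
apply: (le_trans HK); apply: ge0_ler_powR; rewrite ?nnegrE ?(ltW q10)//.
- by rewrite mulr_ge0 ?expR_ge0 ?(ltW K0).
- by rewrite mulr_ge0 ?expR_ge0 ?(ltW K0).
by rewrite ler_pM2l// ler_expR lerN2; move: h; slra.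
Qed.

End bowl.

(** * A priori bounds: t^-g and its Gaussian refinement *)

Section apriori.
Variables (R : realType) (N : nat) (alpha q : R).
Hypotheses (alpha_gt : -1 < alpha) (q_gt1 : 1 < q).
Notation X := 'rV[R]_N.
Notation g := (decay_exp alpha q).
Notation A := (absorb alpha q).
Variables (r T : R) (f : X -> R -> R).
Hypotheses (r_gt0 : 0 < r) (T_gt0 : 0 < T).
Hypothesis f_sol : forall x t, 0 < t <= T -> n2 x <= r ->
  [/\ {for (x, t), continuous (fun p : X * R => f p.1 p.2)}, 0 < f x t &
    heat f x t (- A t (f x t))].
Hypothesis f_init : forall d e : R, 0 < d -> 0 < e ->
  exists2 tau : R, 0 < tau & forall x t, 0 < t <= tau -> d <= n2 x <= r -> f x t <= e.
Implicit Types (x y : X) (t : R).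

Ltac slra := clear -alpha_gt q_gt1 r_gt0 T_gt0 f_sol f_init; lra.

Lemma lateral_bound : exists2 M, 0 <= M &
  forall x t, 0 < t <= T -> n2 x = r -> f x t <= M.
Proof.
have [tau tau0 Ht] := f_init r_gt0 ltr01.
pose G x t := Num.max (Num.max (n2 x - r) (r - n2 x)) (tau - t).
have GE x t : G x t <= 0 = [&& n2 x <= r, r <= n2 x & tau <= t].
  by rewrite /G !ge_max !subr_le0 andbA.
have [|||M M0 HM] := @maxprin_bound R N G f r T.
- move=> p; apply: continuous_maxr; [apply: continuous_maxr|].
  + by apply: cvgB; [exact: continuous_n2p|exact: cvg_cst].
  + by apply: cvgB; [exact: cvg_cst|exact: continuous_n2p].
  + by apply: cvgB; [exact: cvg_cst|exact: continuous_snd].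
- move=> x t; rewrite GE => /and3P[h1 _ h2] _; split=> //.
  exact: le_trans (ltW tau0) h2.
- move=> x t; rewrite GE => /and3P[h1 _ h2] tT.
  by have [] := f_sol (introT andP (conj (lt_le_trans tau0 h2) tT)) h1.
exists (M + 1) => [|x t /andP[t0 tT] xE]; first exact: addr_ge0.
have [h|h] := leP tau t.
  by apply: (@le_trans _ _ M); [apply: HM; rewrite // GE xE lexx|rewrite lerDl].
apply: (@le_trans _ _ 1); last by rewrite lerDr.
by apply: Ht; rewrite ?t0 ?(ltW h)// xE lexx.
Qed.

(** The comparison function is M + h, where M bounds f on the sphere and h is the spatially constant
    solution of h' = - t^alpha h^q that blows up when t^(1+alpha) = s. The blow-up occurs at a
    positive time before t1, so h dominates f whatever f does near t = 0; s = t1^(1+alpha) / 2 makes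
    h(t1) a multiple of t1^-g. *)
Lemma universal_bound : exists2 C, 0 <= C &
  forall x t, 0 < t <= T -> n2 x <= r -> f x t <= C * t `^ (- g).
Proof.
have [M M0 HM] := lateral_bound.
have g0 : 0 < g by exact: decay_exp_gt0.
have q10 : 0 < q - 1 by rewrite subr_gt0.
have a10 : 0 < 1 + alpha by rewrite -ltrBlDl sub0r.
pose p := (q - 1)^-1; have p0 : 0 < p by rewrite invr_gt0.
exists (M * T `^ g + g `^ p * 2 `^ p).
  by rewrite addr_ge0// ?mulr_ge0// ?powR_ge0.
move=> x1 t1 /andP[t10 t1T] x1r.
pose s := t1 `^ (1 + alpha) / 2.
have s0 : 0 < s by rewrite divr_gt0// powR_gt0.
pose h t := g `^ p * (t `^ (1 + alpha) - s) `^ (- p).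
have h_t1 : h t1 = g `^ p * 2 `^ p * t1 `^ (- g).
  rewrite /h (_ : _ - s = 2^-1 * t1 `^ (1 + alpha)); last by rewrite /s; field.
  rewrite (@powRM _ 2^-1) ?powR_ge0 ?invr_ge0//.
  have -> : (2^-1 : R) `^ (- p) = 2 `^ p.
    by rewrite -(powR_inv1 (ler0n _ 2)) -powRrM mulN1r opprK.
  rewrite -powRrM mulrA.
  by congr (_ * _ `^ _); rewrite /decay_exp /p; ring.
suff main : f x1 t1 <= M + h t1.
  apply: (le_trans main); rewrite h_t1 mulrDl lerD2r -mulrA ler_peMr//.
  rewrite powRN ler_pdivlMr ?powR_gt0// mul1r; apply: ge0_ler_powR;
    by rewrite ?nnegrE ?(ltW g0) ?(ltW t10) ?(ltW T_gt0).
have inv_time (y : R) : 0 < y -> (y `^ (1 + alpha)^-1) `^ (1 + alpha) = y.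
  by move=> y0; rewrite -powRrM mulVf ?gt_eqF// powRr1// ltW.
pose s' := s `^ (1 + alpha)^-1; have s'0 : 0 < s' by exact: powR_gt0.
pose G0 (x : X) t := Num.max (n2 x - r) (s' - t).
have cG z : continuous (fun p : X * R => Num.max (n2 p.1 - r) (z - p.2)).
  move=> w; apply: continuous_maxr.
    by apply: cvgB; [exact: continuous_n2p|exact: cvg_cst].
  by apply: cvgB; [exact: cvg_cst|exact: continuous_snd].
have G0E x t : G0 x t <= 0 = (n2 x <= r) && (s' <= t).
  by rewrite /G0 !ge_max !subr_le0.
have [|||M1 M10 HM1] := @maxprin_bound R N G0 f r T.
- exact: cG.
- move=> x t; rewrite G0E => /andP[h1 h2] _; split=> //.
  exact: le_trans (ltW s'0) h2.
- move=> x t; rewrite G0E => /andP[h1 h2] tT.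
  by have [] := f_sol (introT andP (conj (lt_le_trans s'0 h2) tT)) h1.
have M11 : 0 < M1 + 1 by rewrite ltr_wpDl.
(* At [tau], slightly after the blow-up time s', h still exceeds M1 + 1, where M1 bounds f at all
   times from s' on; e <= s ensures tau <= t1. *)
pose e := Num.min s (g * (M1 + 1) `^ (- (q - 1))).
have e0 : 0 < e by rewrite lt_min s0 mulr_gt0// powR_gt0.
have he : M1 + 1 <= g `^ p * e `^ (- p).
  have ee : e <= g * (M1 + 1) `^ (- (q - 1)) by rewrite ge_min lexx orbT.
  have h1 : e `^ p <= g `^ p * (M1 + 1)^-1.
    have -> : (M1 + 1)^-1 = ((M1 + 1) `^ (- (q - 1))) `^ p.
      by rewrite -powRrM mulNr mulfV ?gt_eqF// powR_inv1// ltW.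
    rewrite -powRM ?(ltW g0) ?powR_ge0//; apply: ge0_ler_powR; rewrite ?nnegrE ?(ltW p0) ?(ltW e0)//.
    by rewrite mulr_ge0 ?(ltW g0) ?powR_ge0.
  rewrite powRN ler_pdivlMr ?powR_gt0//.
  by rewrite mulrC; move: h1; rewrite ler_pdivlMr.
pose tau := (s + e) `^ (1 + alpha)^-1.
have se0 : 0 < s + e by rewrite addr_gt0.
have tau0 : 0 < tau by exact: powR_gt0.
have tauE : tau `^ (1 + alpha) = s + e by exact: inv_time.
have s'tau : s' <= tau.
  apply: ge0_ler_powR; rewrite ?nnegrE ?invr_ge0 ?(ltW a10) ?(ltW s0) ?(ltW se0)//.
  by rewrite lerDl ltW.
have taut1 : tau <= t1.
  have -> : t1 = (t1 `^ (1 + alpha)) `^ (1 + alpha)^-1.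
    by rewrite -powRrM mulfV ?gt_eqF// powRr1// ltW.
  apply: ge0_ler_powR; rewrite ?nnegrE ?invr_ge0 ?(ltW a10) ?powR_ge0 ?(ltW se0)//.
  have : e <= s by rewrite ge_min lexx.
  rewrite /s; set P := _ `^ _; slra.
have h_tau : M1 + 1 <= h tau by rewrite /h tauE (_ : s + e - s = e)//; ring.
have pos t : tau <= t -> 0 < t `^ (1 + alpha) - s.
  move=> tt; rewrite subr_gt0; apply: (@lt_le_trans _ _ (s + e)).
    by rewrite ltrDl.
  rewrite -tauE; apply: ge0_ler_powR => //; rewrite ?nnegrE ?(ltW a10) ?(ltW tau0)//.
  exact: le_trans (ltW tau0) tt.
have dh t : tau <= t -> is_derive t 1 h (- A t (h t)).
  move=> tt; have t0 := lt_le_trans tau0 tt; have y0 := pos t tt.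
  have d1 := @is_derive1_powR R (1 + alpha) t t0.
  have d2 : is_derive t 1 (fun t => t `^ (1 + alpha) - s) ((1 + alpha) * t `^ (1 + alpha - 1)).
    by apply: is_derive_eq; rewrite subr0.
  have d3 := @is_derive1_comp R (fun y : R => y `^ (- p)) _ t _ _ (is_derive1_powR _ y0) d2.
  have d4 := is_deriveZ (g `^ p) d3.
  apply: (is_derive_eq d4); rewrite /GRing.scale/= /absorb /h.
  rewrite powRM ?powR_ge0// -!powRrM.
  have pq : p * q = p + 1 by rewrite /p; field; rewrite gt_eqF.
  rewrite (mulNr p q) pq opprD (_ : 1 + alpha - 1 = alpha); last by ring.
  rewrite (_ : g `^ (p + 1) = g `^ p * g); last first.
    by rewrite powRD ?(gt_eqF g0) ?implybT// powRr1// ltW.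
  by rewrite /decay_exp -/p; ring.
have h0 t : 0 <= h t by rewrite mulr_ge0 ?powR_ge0.
pose G (x : X) t := Num.max (n2 x - r) (tau - t).
have GE x t : G x t <= 0 = (n2 x <= r) && (tau <= t).
  by rewrite /G !ge_max !subr_le0.
have GL x t : G x t < 0 = (n2 x < r) && (tau < t).
  by rewrite /G !gt_max !subr_lt0.
pose phi x t := f x t - (M + h t).
suff : phi x1 t1 <= 0 by rewrite /phi subr_le0.
apply: (@maxprin _ _ G phi r t1) => //.
- exact: cG.
- move=> x t; rewrite GE => /andP[h1 h2] _; split=> //.
  exact: le_trans (ltW tau0) h2.
- move=> x t; rewrite GE => /andP[h1 h2] tt1.
  have tI : 0 < t <= T by rewrite (lt_le_trans tau0 h2) (le_trans tt1).
  have [cf _ _] := f_sol tI h1.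
  apply: cvgB; first exact: cf.
  apply: cvgD; first exact: cvg_cst.
  apply: cont_time; exact: is_derive_continuous (dh t h2).
- move=> x t; rewrite GE => /andP[h1 h2] tt1; rewrite {1}/phi subr_gt0 => fh.
  have t0 := lt_le_trans tau0 h2.
  have tI : 0 < t <= T by rewrite t0 (le_trans tt1).
  have [cf f0 hf] := f_sol tI h1.
  split.
    rewrite GL; apply/andP; split.
    + rewrite lt_neqAle h1 andbT; apply/eqP => xE.
      have := HM x t tI xE; have := h0 t; move: fh.
      by slra.
    + rewrite lt_neqAle h2 andbT; apply/eqP => tE.
      have : f x t <= M1.
        by apply: HM1; rewrite ?G0E ?h1 ?(le_trans s'tau h2)//; case/andP: tI.
      move: fh h_tau; rewrite tE.
      by move: M0; slra.
  exists (- A t (f x t) - (0 - A t (h t))).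
    apply: heatB => //; apply: (@heatD _ _ (fun _ _ => M) (fun _ => h)); apply: heat_time; last exact: dh.
  have hf' : h t < f x t.
    by move: fh M0; slra.
  have := absorb_lt alpha q_gt1 t0 (h0 t) hf'.
  by slra.
- by rewrite GE x1r.
Qed.

(** The ball |x - x1|^2 <= |x1|^2 / 4 avoids the origin, so f is as small as desired there at small
    times. The universal bound puts f below the bowl on the sphere, and the value of the bowl at the
    centre x1 is the Gaussian. The condition |x1|^2 <= r / 4 keeps these balls inside |x|^2 <= r. *)
Theorem gaussian_bound : exists2 C, 0 <= C & gauss_sol alpha q (r / 4) T C f.
Proof.
have [C1 C10 HC1] := universal_bound.
have g0 : 0 < g by exact: decay_exp_gt0.
have q10 : 0 < q - 1 by rewrite subr_gt0.
pose S := g + N%:R / 8; have S0 : 0 < S by rewrite ltr_pwDl// divr_ge0.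
pose K := Num.max C1 (expR (2 * S) * S `^ (q - 1)^-1).
have K1 : C1 <= K by rewrite le_max lexx.
have K2 : expR (2 * S) * S `^ (q - 1)^-1 <= K by rewrite le_max lexx orbT.
have K0 : 0 < K by apply: lt_le_trans K2; rewrite mulr_gt0 ?expR_gt0 ?powR_gt0.
have KS : S <= (K * expR (- (2 * S))) `^ (q - 1).
  have SE : (S `^ (q - 1)^-1) `^ (q - 1) = S.
    by rewrite -powRrM mulVf ?gt_eqF// powRr1// ltW.
  rewrite -[leLHS]SE; apply: ge0_ler_powR; rewrite ?nnegrE ?powR_ge0 ?mulr_ge0 ?(ltW K0) ?(ltW q10) ?expR_ge0//.
  by rewrite expRN ler_pdivlMr ?expR_gt0// mulrC.
exists K; first exact: ltW.
move=> x1 t1 /andP[t10 t1T] x1r.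
have x1r' : n2 x1 <= r by move: x1r r_gt0; slra.
have t1I : 0 < t1 <= T by rewrite t10.
have [cf f0 hf] := f_sol t1I x1r'.
split=> //.
have [x0|xn0] := eqVneq (n2 x1) 0.
  rewrite gauss0E x0 mulr0 mul0r oppr0 expR0 mulr1.
  by apply: (le_trans (HC1 x1 t1 t1I x1r')); rewrite ler_pM2r ?powR_gt0.
have nx0 : 0 < n2 x1 by rewrite lt_neqAle eq_sym xn0 n2_ge0.
pose r2 := n2 x1 / 4; have r20 : 0 < r2 by rewrite divr_gt0.
have near x : n2 (x - x1) <= r2 -> r2 <= n2 x <= r.
  move=> xx; apply/andP; split.
    have := n2D_le (x1 - x) x; rewrite subrK -(n2N (x1 - x)) opprB.
    by move: xx; rewrite /r2; slra.
  have := n2D_le (x - x1) x1; rewrite subrK.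
  by move: xx x1r (r_gt0); rewrite /r2; slra.
have -> : gauss g c0 0 0 x1 t1 = bowl alpha q x1 r2 x1 t1.
  rewrite gauss0E /bowl subrr n2_0.
  by congr (_ * expR (- _)); rewrite /r2 /c0; field; rewrite !gt_eqF.
apply/ler_addgt0Pr => e e0.
have [tau tau0 Ht] := f_init r20 e0.
pose tau1 := Num.min tau t1.
have tau10 : 0 < tau1 by rewrite lt_min tau0.
pose B x t := K * bowl alpha q x1 r2 x t + e.
pose G x t := Num.max (n2 (x - x1) - r2) (tau1 - t).
have GE x t : G x t <= 0 = (n2 (x - x1) <= r2) && (tau1 <= t).
  by rewrite /G !ge_max !subr_le0.
have GL x t : G x t < 0 = (n2 (x - x1) < r2) && (tau1 < t).
  by rewrite /G !gt_max !subr_lt0.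
pose phi x t := f x t - B x t.
suff : phi x1 t1 <= 0 by rewrite /phi subr_le0.
apply: (@maxprin _ _ G phi r t1) => //.
- move=> w; apply: continuous_maxr.
    by apply: cvgB; [exact: continuous_n2_sub|exact: cvg_cst].
  by apply: cvgB; [exact: cvg_cst|exact: continuous_snd].
- move=> x t; rewrite GE => /andP[h1 h2] _; split.
    by case/andP: (near x h1).
  exact: le_trans (ltW tau10) h2.
- move=> x t; rewrite GE => /andP[h1 h2] tt1.
  have t0 := lt_le_trans tau10 h2.
  have tI : 0 < t <= T by rewrite t0 (le_trans tt1).
  have [_ xr] := andP (near x h1).
  have [cf' _ _] := f_sol tI xr.
  apply: cvgB; first exact: cf'.
  apply: cvgD; last exact: cvg_cst.
  by apply: cvgM; [exact: cvg_cst|exact: bowl_continuous].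
- move=> x t; rewrite GE => /andP[h1 h2] tt1; rewrite {1}/phi subr_gt0 => fB.
  have t0 := lt_le_trans tau10 h2.
  have tI : 0 < t <= T by rewrite t0 (le_trans tt1).
  have [xr2 xr] := andP (near x h1).
  have [cf' f0' hf'] := f_sol tI xr.
  have W0 := bowl_gt0 alpha q x1 r2 x t0.
  have KW0 : 0 < K * bowl alpha q x1 r2 x t by exact: mulr_gt0.
  split.
    rewrite GL; apply/andP; split.
    + rewrite lt_neqAle h1 andbT; apply/eqP => xE.
      have := HC1 x t tI xr; have : C1 * t `^ (- g) <= K * t `^ (- g) by rewrite ler_pM2r ?powR_gt0.
      move: fB; rewrite /B /bowl xE subrr expr0n mulr0 !mul0r oppr0 expR0 mulr1.
      by move: e0; slra.
    + rewrite lt_neqAle h2 andbT; apply/eqP => tE.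
      have : f x t <= e.
        by apply: Ht; rewrite ?t0 ?xr ?xr2//= -tE ge_min lexx.
      by move: fB KW0; rewrite /B; slra.
  have [d hd dge] := bowl_super q_gt1 t0 r20 h1 K0 KS.
  exists (- A t (f x t) - (d + 0)).
    apply: heatB => //; apply: (@heatD _ _ _ (fun _ _ => e)) => //; apply: heat_time; exact: is_derive_cst.
  have h3 : K * bowl alpha q x1 r2 x t < f x t.
    by apply: lt_trans fB; rewrite ltrDl.
  have := absorb_lt alpha q_gt1 t0 (ltW KW0) h3; move: dge.
  by slra.
- rewrite GE subrr n2_0.
  by rewrite (ltW r20) ge_min lexx orbT.
Qed.

End apriori.

Section lines.
Variables (R : realType) (W : normedModType R).

Lemma is_derive_line (f : W -> R) (y v : W) (s : R) : derivable f (y + s *: v) v ->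
  is_derive s 1 (fun s : R => f (y + s *: v)) ('D_v f (y + s *: v)).
Proof.
have E : (fun h : R => h^-1 *: (((fun s : R => f (y + s *: v)) \o shift s) (h *: 1) - f (y + s *: v))) =
    (fun h : R => h^-1 *: ((f \o shift (y + s *: v)) (h *: v) - f (y + s *: v))).
  by apply/funext => h /=; rewrite [h *: 1]mulr1 scalerDl addrCA addrC addrAC.
move=> df; apply: DeriveDef; first by rewrite /derivable E; exact: df.
by rewrite /derive E.
Qed.

End lines.

(** * Functions with continuous directional derivatives *)

Section C1.
Variables (R : realType) (N : nat).
Notation X := 'rV[R]_N.
Implicit Types (f : X -> R) (p x w : X).

Lemma laplacian_sd f x i : has_laplacian f x ->
  sdiff (fun h => f (x + h *: ebasis R i)) ('D_(ebasis R i) ('D_(ebasis R i) f) x).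
Proof.
move=> /(_ i)[h1 h2].
have cl : (fun h : R => x + h *: ebasis R i) @ 0 --> x.
  rewrite -[X in _ --> X]addr0; apply: cvgD; first exact: cvg_cst.
  rewrite -[X in _ --> X](scale0r (ebasis R i)); apply: cvgZl; exact: cvg_id.
apply: (@sdiff_of_derive _ _ (fun s => 'D_(ebasis R i) f (x + s *: ebasis R i))).
  have h3 : \forall s \near (0 : R), derivable f (x + s *: ebasis R i) (ebasis R i) by exact: (cl _ h1).
  by apply: filterS h3 => s; exact: is_derive_line.
have := @is_derive_line _ _ ('D_(ebasis R i) f) x (ebasis R i) 0.
by rewrite scale0r addr0 => K; exact: K.
Qed.

(** [C1_on] speaks of directional derivatives; the mean value theorem along a path of coordinate
    steps from p to w gives total differentiability. This yields continuity and the formula for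
    ['D_x f], used to differentiate V (x / sqrt t) in time. *)
Lemma C1_expand f p e : C1_on [set: X] f -> 0 < e -> \forall w \near p,
  `|f w - f p - \sum_(i < N) (w - p) 0 i * 'D_(ebasis R i) f p| <=
    e * \sum_(i < N) `|(w - p) 0 i|.
Proof.
move=> fC1 e0.
have : \forall w \near p, forall i : 'I_N, `|'D_(ebasis R i) f w - 'D_(ebasis R i) f p| <= e.
  apply: (@filter_forall _ _ _ (nbhs p)) => i; have [_ /cvgrPdist_le/(_ e e0)] := fC1 (ebasis R i) p I.
  by apply: filterS => w; rewrite distrC.
move=> /nbhs_ballP[r /= r0 Hr]; apply/nbhs_ballP; exists r => //= w pw.
pose y k : X := \row_(i < N) (if (i < k)%N then w 0 i else p 0 i).
have yE (k : 'I_N) : y k.+1 = y k + (w - p) 0 k *: ebasis R k.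
  apply/rowP => i; rewrite !mxE eqxx /= ltnS leq_eqVlt.
  have [->|ik] := eqVneq i k; first by rewrite eqxx /= ltnn mulr1; ring.
  by rewrite val_eqE (negbTE ik) /= mulr0 addr0.
have y0 : y 0%N = p by apply/rowP => i; rewrite mxE.
have yN : y N = w by apply/rowP => i; rewrite mxE ltn_ord.
have pE i : `|p 0 i - w 0 i| < r by case: pw => _ pw; exact: (pw 0 i).
have -> : f w - f p = \sum_(k < N) (f (y k.+1) - f (y k)).
  by rewrite -(big_mkord xpredT (fun k => f (y k.+1) - f (y k))) telescope_sumr// y0 yN.
rewrite -sumrB mulr_sumr; apply: le_trans (ler_norm_sum _ _ _) _.
apply: ler_sum => k _; set c := (w - p) 0 k.
have dF (s : R) : is_derive s 1 (fun s => f (y k + (s * c) *: ebasis R k))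
    ('D_(ebasis R k) f (y k + (s * c) *: ebasis R k) * c).
  have d1 : is_derive s 1 (fun s => s * c) c.
    by apply: is_derive_eq; rewrite /GRing.scale/=; ring.
  have [df _] := fC1 (ebasis R k) (y k + (s * c) *: ebasis R k) I.
  exact: (@is_derive1_comp R (fun s => f (y k + s *: ebasis R k)) (fun s => s * c) s _ _ (is_derive_line df) d1).
have [|s] := @MVT_segment R _ _ 0 1 ler01 (fun s _ => dF s).
  by apply: derivable_within_continuous => s _; have [] := dF s.
rewrite in_itv/= => /andP[s0 s1]; rewrite subr0 mulr1 mul1r mul0r scale0r addr0 -yE => ->.
rewrite (mulrC c) -mulrBl normrM; apply: ler_wpM2r => //.
apply: Hr; split=> // i0 j; rewrite (ord1 i0) !mxE eqxx /=.
have [->|jk] := eqVneq j k.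
  rewrite ltnn mulr1 /ball/= opprD addrA subrr sub0r normrN /c !mxE normrM ger0_norm//.
  apply: le_lt_trans (pE k); rewrite distrC; exact: ler_piMl.
rewrite mulr0 addr0; case: ifP => _; first exact: pE.
by rewrite /ball/= subrr normr0.
Qed.

Lemma C1_continuous f : C1_on [set: X] f -> continuous f.
Proof.
move=> fC1 p; apply/(@cvgrPdist_le _ _ _ (nbhs p)) => e e0.
pose D := 1 + \sum_(i < N) `|'D_(ebasis R i) f p|.
have D0 : 0 < D by rewrite ltr_pwDl// sumr_ge0.
pose d := e / (D * (N%:R + 1)); have N0 : 0 < N%:R + 1 :> R by rewrite ltr_wpDl.
have d0 : 0 < d by rewrite divr_gt0// mulr_gt0.
have : \forall w \near p, forall i : 'I_N, `|(w - p) 0 i| <= d.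
  apply/nbhs_ballP; exists d => //= w pw i.
  by case: pw => _ pw; have h : `|p 0 i - w 0 i| < d := pw 0 i; rewrite !mxE distrC ltW.
move=> Hd; near=> w.
have h1 : forall i : 'I_N, `|(w - p) 0 i| <= d by near: w.
have h2 : `|f w - f p - \sum_(i < N) (w - p) 0 i * 'D_(ebasis R i) f p| <=
    1 * \sum_(i < N) `|(w - p) 0 i| by near: w; exact: C1_expand.
rewrite distrC -[X in `|X|](subrK (\sum_(i < N) (w - p) 0 i * 'D_(ebasis R i) f p)).
apply: (le_trans (ler_normD _ _)); apply: (@le_trans _ _ (N%:R * d + d * \sum_(i < N) `|'D_(ebasis R i) f p|)).
  apply: lerD.
    apply: (le_trans h2); rewrite mul1r; apply: (@le_trans _ _ (\sum_(i < N) d)).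
      by apply: ler_sum => i _.
    by rewrite sumr_const card_ord mulr_natl.
  apply: (le_trans (ler_norm_sum _ _ _)); rewrite mulr_sumr; apply: ler_sum => i _.
  by rewrite normrM; apply: ler_wpM2r.
apply: (@le_trans _ _ (d * (D * (N%:R + 1)))); last by rewrite /d divfK// gt_eqF// mulr_gt0.
rewrite (mulrC N%:R) -mulrDr; apply: ler_wpM2l; first exact: ltW.
rewrite /D; set S := \sum_(i < N) _; have S0 : 0 <= S by rewrite sumr_ge0.
have : 0 <= N%:R * S by rewrite mulr_ge0.
by lra.
Unshelve. all: by end_near. Qed.

Lemma C1_derive_sum f p x : C1_on [set: X] f ->
  'D_x f p = \sum_(i < N) x 0 i * 'D_(ebasis R i) f p.
Proof.
move=> fC1; have [df _] := fC1 x p I.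
apply: cvg_lim => //; apply/cvgrPdist_le => e e0.
pose S := 1 + \sum_(i < N) `|x 0 i|.
have S0 : 0 < S by rewrite ltr_pwDl// sumr_ge0.
have eS : 0 < e / S by exact: divr_gt0.
have cl : (fun h : R => h *: x + p) @ 0 --> p.
  rewrite -[X in _ --> X]add0r; apply: cvgD; last exact: cvg_cst.
  rewrite -[X in _ --> X](scale0r x); apply: cvgZl; exact: cvg_id.
have H := cl _ (@C1_expand f p _ fC1 eS).
near=> h; have h0 : h != 0 by near: h; exact: nbhs_dnbhs_neq.
have : `|f (h *: x + p) - f p - \sum_(i < N) (h *: x + p - p) 0 i * 'D_(ebasis R i) f p| <=
    e / S * \sum_(i < N) `|(h *: x + p - p) 0 i|.
  by near: h; apply: cvg_within; exact: H.
rewrite addrK => K; rewrite distrC /=.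
have -> : h^-1 *: (f (h *: x + p) - f p) - \sum_(i < N) x 0 i * 'D_(ebasis R i) f p =
    h^-1 * (f (h *: x + p) - f p - \sum_(i < N) (h *: x) 0 i * 'D_(ebasis R i) f p).
  rewrite mulrBr mulr_sumr; congr (_ - _); apply: eq_bigr => i _.
  by rewrite mxE; field.
rewrite normrM normfV ler_pdivrMl ?normr_gt0//; apply: (le_trans K).
have -> : \sum_(i < N) `|(h *: x) 0 i| = `|h| * \sum_(i < N) `|x 0 i|.
  by rewrite mulr_sumr; apply: eq_bigr => i _; rewrite mxE normrM.
rewrite mulrCA; apply: ler_wpM2l => //.
rewrite mulrAC ler_pdivrMr//; apply: ler_wpM2l; first exact: ltW.
by rewrite /S lerDr.
Unshelve. all: by end_near. Qed.

End C1.

(** * The very singular solution *)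

Section profile.
Variables (R : realType) (N : nat) (alpha q : R) (V : 'rV[R]_N -> R).
Hypotheses (alpha_gt : -1 < alpha) (q_gt1 : 1 < q).
Hypothesis V_profile : is_profile alpha q V.
Notation X := 'rV[R]_N.
Notation g := (decay_exp alpha q).
Notation A := (absorb alpha q).
Notation v := (very_singular alpha q V).
Implicit Types (x : X) (t : R).

Lemma enorm2 x : enorm x ^+ 2 = n2 x.
Proof. by rewrite /enorm sqr_sqrtr// n2_ge0. Qed.

Lemma n2Z (k : R) x : n2 (k *: x) = k ^+ 2 * n2 x.
Proof. by rewrite /n2 mulr_sumr; apply: eq_bigr => i _; rewrite mxE exprMn. Qed.

Lemma very_singular_gt0 x t : 0 < t -> 0 < v x t.
Proof. by case: V_profile => V0 _ _ _ t0; rewrite mulr_gt0// powR_gt0. Qed.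

(** With eta = x / sqrt t the time derivative is t^(-g-1) (- g V - eta . grad V / 2), and the
    Laplacian and the absorption carry the same power of t; what remains is the profile equation at
    eta. *)
Lemma heat_very_singular x t : 0 < t -> heat v x t (- A t (v x t)).
Proof.
move=> t0; have [V0 [VC1 VC2] Veq _] := V_profile.
pose s (t : R) := (Num.sqrt t)^-1.
have st0 : 0 < Num.sqrt t by rewrite sqrtr_gt0.
have sE : s t ^+ 2 = t^-1 by rewrite /s exprVn sqr_sqrtr// ltW.
pose y := s t *: x.
pose D i := 'D_(ebasis R i) V y; pose D2 i := 'D_(ebasis R i) ('D_(ebasis R i) V) y.
have ds : is_derive t 1 s (- (2^-1 * t^-1 * s t)).
  have d1 := is_derive1_sqrt t0.
  have d2 : is_derive t 1 s (- (Num.sqrt t) ^- 2 *: (2 * Num.sqrt t)^-1).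
    by apply: is_deriveV; rewrite gt_eqF.
  apply: (is_derive_eq d2); rewrite /GRing.scale/= sqr_sqrtr ?(ltW t0)//.
  by rewrite /s invfM; ring.
have dV : is_derive t 1 (fun t => V (s t *: x)) (- (2^-1 * t^-1) * \sum_(i < N) y 0 i * D i).
  have [dx _] := VC1 x (0 + s t *: x) I.
  have d1 := @is_derive1_comp R (fun s => V (0 + s *: x)) s t _ _ (is_derive_line dx) ds.
  rewrite (_ : (fun t => V (s t *: x)) = (fun s => V (0 + s *: x)) \o s); last first.
    by apply/funext => z /=; rewrite add0r.
  apply: (is_derive_eq d1); rewrite (C1_derive_sum _ _ VC1) add0r.
  have -> : \sum_(i < N) y 0 i * D i = s t * \sum_(i < N) x 0 i * 'D_(ebasis R i) V (s t *: x).
    by rewrite mulr_sumr; apply: eq_bigr => i _; rewrite mxE mulrA.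
  by ring.
exists (t `^ (- g) / t * (- g * V y - 2^-1 * \sum_(i < N) y 0 i * D i)), (fun i => t `^ (- g) * (t^-1 * D2 i)).
split.
- have d1 := @is_derive1_powR R (- g) t t0.
  have d2 : is_derive t 1 (v x) (t `^ (- g) *: (- (2^-1 * t^-1) * \sum_(i < N) y 0 i * D i) +
      V (s t *: x) *: (- g * t `^ (- g - 1))) by exact: is_deriveM.
  apply: (is_derive_eq d2); rewrite /GRing.scale/= -/y -opprD powR_opp_succ//.
  by ring.
- move=> i; rewrite /sd /very_singular -/(decay_exp alpha q); apply: sdiffZ.
  pose c : R := s t.
  have -> : (fun h : R => V ((Num.sqrt t)^-1 *: (x + h *: ebasis R i))) =
      (fun h => V (y + (h * c) *: ebasis R i)).
    by apply/funext => h; rewrite scalerDr scalerA mulrC.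
  have dc (h : R) : is_derive h 1 (fun h => h * c) c.
    by apply: is_derive_eq; rewrite /GRing.scale/=; ring.
  apply: (@sdiff_of_derive _ _ (fun h => 'D_(ebasis R i) V (y + (h * c) *: ebasis R i) * c)).
    apply: filterE => h; have [df _] := VC1 (ebasis R i) (y + (h * c) *: ebasis R i) I.
    exact: (@is_derive1_comp R (fun s => V (y + s *: ebasis R i)) (fun s => s * c) h _ _ (is_derive_line df) (dc h)).
  have [df _] := VC2 (ebasis R i) (ebasis R i) (y + (0 * c) *: ebasis R i) I.
  have d1 := @is_derive1_comp R (fun s => 'D_(ebasis R i) V (y + s *: ebasis R i)) (fun s => s * c) 0 _ _ (is_derive_line df) (dc 0).
  have d2 : is_derive (0 : R) 1 (cst c) 0 by exact: is_derive_cst.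
  have d3 := is_deriveM d1 d2.
  apply: (is_derive_eq d3); rewrite /GRing.scale/= -sE /D2 -/c.
  rewrite (_ : y + (0 * c) *: ebasis R i = y); first by ring.
  by rewrite mul0r scale0r addr0.
- have vt := very_singular_gt0 x t0.
  rewrite (absorb_scale alpha q_gt1 t0 vt).
  have -> : t `^ g * v x t = V y by rewrite /very_singular mulrA powg_mul// mul1r.
  have -> : v x t = t `^ (- g) * V y by [].
  have Vq : V y * V y `^ (q - 1) = V y `^ q.
    by rewrite mulr_powRB1 ?(ltW (V0 y))// (lt_trans ltr01).
  have := Veq y; rewrite -/(decay_exp alpha q) -Vq /laplacian.
  rewrite (eq_bigr D2)// [X in _ - _ * X - _](eq_bigr (fun i => y 0 i * D i))//.
  rewrite -mulr_sumr -mulr_sumr.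
  set S2 := \sum_(i < N) D2 i; set S1 := \sum_(i < N) _ => E.
  have -> : - (t `^ (- g) * V y / t * V y `^ (q - 1)) = - (t `^ (- g) / t * (V y * V y `^ (q - 1))) by ring.
  rewrite (_ : V y * V y `^ (q - 1) = S2 + 2^-1 * S1 + g * V y); first by ring.
  by move: E; move: (V y * _) => z E; apply/eqP; rewrite -subr_eq0 -E; apply/eqP; ring.
Qed.

Lemma very_singular_continuous x t : 0 < t ->
  {for (x, t), continuous (fun p : X * R => v p.1 p.2)}.
Proof.
move=> t0; have [V0 [VC1 VC2] Veq _] := V_profile.
have st0 : 0 < Num.sqrt t by rewrite sqrtr_gt0.
apply: cvgM.
  apply: (@cont_time _ _ (fun t => t `^ (- g))).
  exact: is_derive_continuous (is_derive1_powR _ t0).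
apply: (@continuous_comp _ _ _ (fun p : X * R => (Num.sqrt p.2)^-1 *: p.1) V); last exact: C1_continuous.
apply: cvgZ; last exact: cvg_fst.
apply: (@cont_time _ _ (fun t => (Num.sqrt t)^-1)).
by apply: cvgV; [rewrite gt_eqF|exact: sqrt_continuous].
Qed.

(** |x|^(2g) v(x, t) = |eta|^(2g) V(eta) with eta = x / sqrt t: the decay of the profile is the
    vanishing of v at t = 0 off the origin. *)
Lemma very_singular_init (r d e : R) : 0 < d -> 0 < e ->
  exists2 tau : R, 0 < tau & forall x t, 0 < t <= tau -> d <= n2 x <= r -> v x t <= e.
Proof.
move=> d0 e0; have [V0 _ _ /cvgrPdist_le Vdec] := V_profile.
have g0 : 0 < g by exact: decay_exp_gt0.
have de0 : 0 < e * d `^ g by rewrite mulr_gt0// powR_gt0.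
have [M _ HM] := Vdec _ de0.
pose M1 := `|M| + 1; have M10 : 0 < M1 by rewrite ltr_wpDl.
exists (d / (M1 ^+ 2 + 1)) => [|x t /andP[t0]].
  by rewrite divr_gt0// ltr_wpDl// sqr_ge0.
rewrite ler_pdivlMr ?ltr_wpDl ?sqr_ge0// => tM /andP[dx _].
have st0 : 0 < Num.sqrt t by rewrite sqrtr_gt0.
pose y := (Num.sqrt t)^-1 *: x.
have yE : n2 y = n2 x / t by rewrite /y n2Z exprVn sqr_sqrtr ?(ltW t0)// mulrC.
have yM : M < enorm y.
  apply: (le_lt_trans (ler_norm M)); apply: (@lt_le_trans _ _ M1); first by rewrite ltrDl.
  rewrite -(ler_pXn2r (ltn0Sn 1)) ?nnegrE ?(ltW M10) ?sqrtr_ge0// enorm2 yE ler_pdivlMr//.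
  apply: le_trans dx; apply: le_trans tM; rewrite mulrC ler_pM2l// lerDl//.
have := HM y yM; rewrite sub0r normrN ger0_norm; last by rewrite mulr_ge0 ?powR_ge0// ltW.
have -> : enorm y `^ (2 * (1 + alpha) / (q - 1)) = n2 x `^ g * t `^ (- g).
  have -> : 2 * (1 + alpha) / (q - 1) = 2 * g by rewrite /decay_exp; ring.
  rewrite powRrM (_ : enorm y `^ 2 = n2 y); last by rewrite powR_mulrn ?sqrtr_ge0// enorm2.
  rewrite yE powRM ?n2_ge0 ?invr_ge0 ?(ltW t0)//; congr (_ * _).
  by rewrite -(powR_inv1 (ltW t0)) -powRrM mulN1r.
rewrite -mulrA -/(v x t) => h.
have dg : 0 < d `^ g by exact: powR_gt0.
have h1 : d `^ g * v x t <= n2 x `^ g * v x t.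
  apply: ler_wpM2r; first exact/ltW/very_singular_gt0.
  by apply: ge0_ler_powR; rewrite ?nnegrE ?(ltW g0) ?(ltW d0) ?n2_ge0.
rewrite -(ler_pM2l dg) [leRHS]mulrC.
by apply: (le_trans h1).
Qed.

Lemma very_singular_lower (r : R) : 0 < r -> exists2 c, 0 < c & exists2 tau : R, 0 < tau &
  forall x t, 0 < t <= tau -> n2 x <= r * t -> c * t `^ (- g) <= v x t.
Proof.
move=> r0; have [V0 [VC1 VC2] Veq _] := V_profile.
pose G (x : X) (t : R) := Num.max (n2 x - r) (- t).
have GE x t : G x t <= 0 = (n2 x <= r) && (0 <= t).
  by rewrite /G !ge_max subr_le0 oppr_le0.
(* An upper bound for 1 / V on a ball, the ball being the slice at the single time 0 of a space-time
   domain. *)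
have [|||M M0 HM] := @maxprin_bound R N G (fun x _ => (V x)^-1) r 0.
- move=> p; apply: continuous_maxr.
    by apply: cvgB; [exact: continuous_n2p|exact: cvg_cst].
  by apply: cvgN; exact: continuous_snd.
- by move=> x t; rewrite GE => /andP[].
- move=> x t _ _; apply: (@cont_space _ _ (fun x => (V x)^-1)).
  have cV : V @ nbhs x --> V x by exact: C1_continuous.
  by apply: (cvgV _ cV); exact: lt0r_neq0.
have M10 : 0 < M + 1 by rewrite ltr_wpDl.
exists (M + 1)^-1; first by rewrite invr_gt0.
exists 1 => // x t /andP[t0 _] xr.
rewrite mulrC /very_singular ler_pM2l ?powR_gt0//.
have yr : n2 ((Num.sqrt t)^-1 *: x) <= r.
  by rewrite n2Z exprVn sqr_sqrtr ?(ltW t0)// mulrC ler_pdivrMr.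
have := HM ((Num.sqrt t)^-1 *: x) 0; rewrite GE yr lexx => /(_ isT isT) h.
rewrite -[leRHS]invrK lef_pV2 ?posrE ?invr_gt0//; apply: (le_trans h).
by rewrite lerDl.
Qed.

Theorem very_singular_gauss_sol (r T : R) : 0 < r -> 0 < T ->
  exists2 C, 0 <= C & gauss_sol alpha q (r / 4) T C v.
Proof.
move=> r0 T0; apply: gaussian_bound => //.
- move=> x t /andP[t0 _] _; split; [exact: very_singular_continuous|exact: very_singular_gt0|exact: heat_very_singular].
- by move=> d e d0 e0; exact: very_singular_init.
Qed.

End profile.

(** * Measurability and integration over R^N *)

Section measurability.
Variables (R : realType) (N : nat).
Notation X := 'rV[R]_N.
Notation Y := (N.-tuple (measurableTypeR R)).

(** Cubes with rational centre and size are measurable coordinate by coordinate, and an open set is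
    the countable union of those it contains. *)
Lemma measurable_row_open (U : set X) : open U -> measurable (@row_of_tuple R N @^-1` U : set Y).
Proof.
move=> oU.
pose box (c : 'rV[rat]_N * rat) : set X := [set x | forall i, `|x 0 i - ratr (c.1 0 i)| < ratr c.2].
have mbox c : measurable (@row_of_tuple R N @^-1` box c : set Y).
  rewrite (_ : _ @^-1` _ = \bigcap_(i in [set: 'I_N])
      ((fun y : Y => tnth y i) @^-1` `]ratr (c.1 0 i) - ratr c.2, ratr (c.1 0 i) + ratr c.2[)).
    apply: fin_bigcap_measurable => [|i _]; first exact: finite_finset.
    rewrite -[X in measurable X]setTI; exact: (@measurable_tnth _ (measurableTypeR R) N i measurableT _ (measurable_itv _)).
  apply/seteqP; split=> y /= H i.
    move=> _; have := H i; rewrite /row_of_tuple mxE /= in_itv/= ltr_norml => /andP[a1 a2].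
    by apply/andP; split; lra.
  have := H i I; rewrite /row_of_tuple mxE /= in_itv/= ltr_norml => /andP[a1 a2].
  by apply/andP; split; lra.
pose F (c : 'rV[rat]_N * rat) : set Y := if `[< box c `<=` U >] then @row_of_tuple R N @^-1` box c else set0.
rewrite (_ : (@row_of_tuple R N @^-1` U : set Y) = \bigcup_c F c).
  apply: countable_bigcupT_measurable; first exact: countableP.
  by move=> c; rewrite /F; case: ifP => _.
apply/seteqP; split=> y /=; last first.
  by move=> [c _]; rewrite /F; case: ifPn => // /asboolP H /H.
set x := row_of_tuple y => Ux.
have [e /= e0 He] : exists2 e : R, 0 < e & ball x e `<=` U.
  by apply/nbhs_ballP; move: oU; rewrite openE => /(_ x Ux).
have e42 : e / 4 < e / 2 by lra.
have [r] := rat_in_itvoo e42; rewrite in_itv/= => /andP[r1 r2].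
have r0 : 0 < ratr r :> R by lra.
have /choice[c Hc] : forall i : 'I_N, exists c : rat, `|x 0 i - ratr c| < ratr r.
  move=> i; have xr : x 0 i - ratr r < x 0 i + ratr r by lra.
  have [c] := rat_in_itvoo xr.
  rewrite in_itv/= => /andP[c1 c2]; exists c.
  by rewrite ltr_norml; apply/andP; split; lra.
exists (\row_i c i, r) => //.
rewrite /F; case: ifPn => [_|/asboolP]; first by move=> i; rewrite /= mxE.
case=> z Hz; apply: He; split=> // i0 i; rewrite (ord1 i0) /ball/=.
have := Hz i; have := Hc i; rewrite /= mxE !ltr_norml => /andP[a1 a2] /andP[a3 a4].
by apply/andP; split; lra.
Qed.

Lemma measurable_row_continuous (Omega : set X) (h : X -> R) : open Omega ->
  (forall x, Omega x -> {for x, continuous h}) ->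
  measurable_fun (@row_of_tuple R N @^-1` Omega : set Y) (fun y : Y => h (row_of_tuple y)).
Proof.
move=> oO ch mD; apply: (measurability _ (RGenOInfty.measurableE R)) => //.
move=> _ [_ [x ->] <-].
rewrite (_ : _ `&` _ = @row_of_tuple R N @^-1` (Omega `&` [set z | x < h z])); last first.
  by apply/seteqP; split=> y /=; rewrite in_itv/= andbT.
apply: measurable_row_open.
rewrite openE => z [Oz hz]; apply: filterI.
  by move: oO; rewrite openE => /(_ z Oz).
by have := ch z Oz; move/cvgr_gt; apply.
Qed.

End measurability.

Section product_integral.
Variable R : realType.
Local Open Scope ereal_scope.

(** Tonelli's theorem along the recursion that builds [lebesgueN]. *)
Lemma integral_lebesgueN_prod (N : nat) (phi : 'I_N -> R -> R) (c : 'I_N -> R) :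
  (forall i s, (0 <= phi i s)%R) -> (forall i, (0 <= c i)%R) ->
  (forall i, measurable_fun [set: measurableTypeR R] (phi i)) ->
  (forall i, \int[@lebesgue_measure R]_s (phi i s)%:E = (c i)%:E) ->
  \int[lebesgueN R N]_y (\prod_(i < N) phi i (tnth y i))%:E = (\prod_(i < N) c i)%:E.
Proof.
elim: N phi c => [|n IH] phi c phi0 c0 mphi Iphi.
  rewrite /= !big_ord0.
  rewrite (eq_integral (cst 1)); last by move=> y _; rewrite big_ord0.
  by rewrite integral_dirac// diracT mul1e.
have mprod k (psi : 'I_k -> R -> R) : (forall i, measurable_fun [set: measurableTypeR R] (psi i)) ->
    measurable_fun [set: k.-tuple (measurableTypeR R)] (fun y : k.-tuple (measurableTypeR R) => (\prod_(i < k) psi i (tnth y i))%R).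
  move=> mpsi; apply: measurable_prod => i _.
  apply: (measurableT_comp (mpsi i)); exact: measurable_tnth.
have prod0 k (psi : 'I_k -> R -> R) (y : k.-tuple R) : (forall i s, (0 <= psi i s)%R) ->
    (0 <= \prod_(i < k) psi i (tnth y i))%R by move=> H; apply: prodr_ge0.
rewrite /= /lebesgue_cons.
rewrite (ge0_integral_pushforward (@measurable_cons_pair R n))//=; last 2 first.
- by apply/measurable_EFinP; exact: mprod.
- by move=> y _; rewrite lee_fin prod0.
rewrite preimage_setT fubini_tonelli1; last 2 first.
- apply/measurable_EFinP; apply: (measurableT_comp (mprod _ _ mphi)); exact: measurable_cons_pair.
- by move=> y /=; rewrite lee_fin prod0.
rewrite (eq_integral (fun s : measurableTypeR R => (phi ord0 s)%:E * (\prod_(i < n) c (lift ord0 i))%:E)); last first.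
  move=> s _; rewrite /fubini_F /=.
  rewrite (eq_integral (fun y : n.-tuple (measurableTypeR R) => (phi ord0 s)%:E * (\prod_(i < n) phi (lift ord0 i) (tnth y i))%:E)); last first.
    move=> y _; rewrite big_ord_recl EFinM; congr (_ * _%:E).
    by apply: eq_bigr => i _; rewrite tnthS.
  rewrite ge0_integralZl//=.
  - by rewrite (IH (fun i => phi (lift ord0 i)) (fun i => c (lift ord0 i))).
  - by apply/measurable_EFinP; exact: (mprod _ (fun i => phi (lift ord0 i))).
  - by move=> y _; rewrite lee_fin (prod0 _ (fun i => phi (lift ord0 i))).
  - by rewrite lee_fin.
rewrite ge0_integralZr//=.
- by rewrite Iphi -EFinM big_ord_recl.
- by apply/measurable_EFinP.
- by move=> s _; rewrite lee_fin.
- by rewrite lee_fin prodr_ge0.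
Qed.

End product_integral.

Section real_integrals.
Variables (d : measure_display) (Y : measurableType d) (R : realType).
Variable mu : {measure set Y -> \bar R}.

Lemma ge0_integrable (h : Y -> R) (c : R) : measurable_fun [set: Y] h ->
  (forall y, 0 <= h y) -> (\int[mu]_y (h y)%:E = c%:E)%E ->
  mu.-integrable [set: Y] (EFin \o h) /\ \int[mu]_y h y = c.
Proof.
move=> mh h0 hc; split; last by rewrite /Rintegral hc.
apply/integrableP; split; first exact/measurable_EFinP.
rewrite (eq_integral (fun y => (h y)%:E)); first by rewrite hc ltry.
by move=> y _ /=; rewrite ger0_norm.
Qed.

(** The majorant G is taken on the whole space, with f extended by 0 outside D, so that
    integrability of f on D is a consequence. *)
Lemma Rintegral_close (D : set Y) (f Z G : Y -> R) (k : R) : measurable D ->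
  measurable_fun D f -> mu.-integrable [set: Y] (EFin \o Z) ->
  mu.-integrable [set: Y] (EFin \o G) ->
  (forall y, `|(f \_ D) y - k * Z y| <= G y) ->
  `|\int[mu]_(y in D) f y - k * \int[mu]_y Z y| <= \int[mu]_y G y.
Proof.
move=> mD mf iZ iG H.
have mT : measurable [set: Y] by exact: measurableT.
have ikZ : mu.-integrable [set: Y] (EFin \o (fun y => k * Z y)).
  rewrite (_ : _ \o _ = (fun y => k%:E * (EFin \o Z) y)%E); last by apply/funext => y /=; rewrite EFinM.
  exact: integrableZl.
have mfD : measurable_fun [set: Y] (f \_ D).
  by apply/(measurable_restrict f mD mT); rewrite setTI.
have mkZ : measurable_fun [set: Y] (fun y => k * Z y).
  by apply/measurable_EFinP; case/integrableP: ikZ.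
have iF : mu.-integrable [set: Y] (EFin \o (fun y => (f \_ D) y - k * Z y)).
  apply: (le_integrable mT _ _ iG).
    by apply/measurable_EFinP; apply: measurable_funB.
  by move=> y _ /=; rewrite lee_fin (le_trans (H y))// ler_norm.
have ifD : mu.-integrable [set: Y] (EFin \o (f \_ D)).
  rewrite (_ : _ \o _ = (EFin \o (fun y => (f \_ D) y - k * Z y)%R) \+ (EFin \o (fun y => k * Z y)%R))%E; last first.
    by apply/funext => y /=; rewrite -EFinD subrK.
  exact: integrableD.
rewrite Rintegral_mkcond -RintegralZl// -RintegralB//.
apply: (le_trans (le_normr_Rintegral mT iF)).
apply: le_Rintegral => //.
by have := integrable_norm iF.
Qed.

End real_integrals.

Section heat_kernel_integral.
Variables (R : realType) (N : nat).
Notation X := 'rV[R]_N.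
Notation Y := (N.-tuple (measurableTypeR R)).
Implicit Types (x a : X) (t : R).

Lemma heat_kernel_gauss x t : 0 < t ->
  heat_kernel x t = (4 * pi) `^ (- (N%:R / 2)) * gauss (N%:R / 2) 4^-1 0 0 x t.
Proof.
move=> t0; rewrite gauss0E /heat_kernel powRM ?mulr_ge0 ?pi_ge0 ?(ltW t0)//.
rewrite enorm2 mulrA; congr (_ * expR (- _)).
by field; rewrite gt_eqF.
Qed.

(** As a product of normal densities of variance 2 t the kernel inherits measurability and total
    mass 1. *)
Lemma heat_kernel_prod a t (y : Y) : 0 < t ->
  heat_kernel (row_of_tuple y - a) t = \prod_(i < N) normal_pdf (a 0 i) (Num.sqrt (2 * t)) (tnth y i).
Proof.
move=> t0; have s0 : 0 < Num.sqrt (2 * t) by rewrite sqrtr_gt0 mulr_gt0.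
have p0 : 0 < 4 * pi * t by rewrite !mulr_gt0// pi_gt0.
rewrite (eq_bigr (fun i => (4 * pi * t) `^ (- 2^-1) * expR (- ((row_of_tuple y - a) 0 i ^+ 2 / (4 * t))))); last first.
  move=> i _; rewrite normal_pdfE ?gt_eqF// /normal_peak /normal_fun sqr_sqrtr ?mulr_ge0 ?(ltW t0)//.
  congr (_ * expR _).
    rewrite powRN powR12_sqrt ?(ltW p0)//; congr ((Num.sqrt _)^-1).
    by rewrite mulr2n; ring.
  rewrite !mxE (_ : 2 * t *+ 2 = 4 * t); last by rewrite mulr2n; ring.
  by rewrite mulNr.
rewrite big_split/= prodr_const card_ord -powR_mulrn ?powR_ge0// -powRrM -expR_sum.
rewrite /heat_kernel enorm2; congr (_ `^ _ * expR _); first by rewrite mulNr mulrC.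
by rewrite sumrN -mulr_suml.
Qed.

Lemma measurable_heat_kernel a t : 0 < t ->
  measurable_fun [set: Y] (fun y : Y => heat_kernel (row_of_tuple y - a) t).
Proof.
move=> t0; rewrite (_ : (fun _ => _) = (fun y : Y => \prod_(i < N) normal_pdf (a 0 i) (Num.sqrt (2 * t)) (tnth y i))); last first.
  by apply/funext => y; exact: heat_kernel_prod.
apply: measurable_prod => i _.
by apply: (measurableT_comp (measurable_normal_pdf _ _)); exact: measurable_tnth.
Qed.

Lemma heat_kernel_gt0 x t : 0 < t -> 0 < heat_kernel x t.
Proof. by move=> t0; rewrite mulr_gt0 ?expR_gt0// powR_gt0// !mulr_gt0// pi_gt0. Qed.

Lemma integral_heat_kernel a t : 0 < t ->
  (\int[lebesgueN R N]_y (heat_kernel (row_of_tuple y - a) t)%:E = 1)%E.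
Proof.
move=> t0; rewrite (eq_integral (fun y : Y => (\prod_(i < N) normal_pdf (a 0 i) (Num.sqrt (2 * t)) (tnth y i))%:E)); last first.
  by move=> y _; rewrite heat_kernel_prod.
rewrite (@integral_lebesgueN_prod R N (fun i => normal_pdf (a 0 i) (Num.sqrt (2 * t))) (fun=> 1))//.
- by rewrite big1.
- by move=> i s; exact: normal_pdf_ge0.
- by move=> i; exact: measurable_normal_pdf.
- by move=> i; exact: integral_normal_pdf.
Qed.

Lemma box_integral (L : R) : 0 < L -> let h (y : Y) := \prod_(i < N) \1_`[-L, L] (tnth y i) : R in
  [/\ measurable_fun [set: Y] h, forall y, 0 <= h y &
    (\int[lebesgueN R N]_y (h y)%:E = ((2 * L) ^+ N)%:E)%E].
Proof.
move=> L0 h.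
have mI : measurable_fun [set: measurableTypeR R] (\1_`[-L, L] : measurableTypeR R -> R).
  exact: measurable_indic (measurable_itv _).
split.
- apply: measurable_prod => i _.
  by apply: (measurableT_comp mI); exact: measurable_tnth.
- by move=> y; apply: prodr_ge0.
rewrite (@integral_lebesgueN_prod R N (fun=> \1_`[-L, L]) (fun=> 2 * L))//.
- by rewrite prodr_const card_ord.
- by move=> _; rewrite mulr_ge0// ltW.
- move=> _; rewrite integral_indic//.
  rewrite setIT; apply: (etrans (lebesgue_measure_itv _)); rewrite /= lte_fin gtrN// -EFinD opprK.
  by congr EFin; ring.
Qed.

(** Half of the exponent gives the small factor, the other half is the exponent at time 2 t. The
    tail of the kernel is thus dominated by a small multiple of a function of integral 1. *)
Lemma heat_kernel_far x t r : 0 < t -> r <= n2 x ->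
  heat_kernel x t <= 2 `^ (N%:R / 2) * expR (- (r / 8 / t)) * heat_kernel x (2 * t).
Proof.
move=> t0 rx; have t20 : 0 < 2 * t by rewrite mulr_gt0.
rewrite !heat_kernel_gauss// !gauss0E (@powRM _ 2) ?(ltW t0)// (powRN 2).
set p := t `^ _; set P := 2 `^ _; set c := (4 * pi) `^ _.
have p0 : 0 < p by exact: powR_gt0.
have P0 : 0 < P by exact: powR_gt0.
have c_gt0 : 0 < c by rewrite powR_gt0// mulr_gt0// pi_gt0.
have -> : P * expR (- (r / 8 / t)) * (c * (P^-1 * p * expR (- (4^-1 * n2 x / (2 * t))))) =
    c * (p * (expR (- (r / 8 / t)) * expR (- (4^-1 * n2 x / (2 * t))))).
  by field; rewrite gt_eqF.
rewrite !ler_pM2l// -expRD ler_expR -opprD lerN2.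
have -> : 4^-1 * n2 x / (2 * t) = n2 x / 8 / t by field; rewrite gt_eqF.
have -> : 4^-1 * n2 x / t = n2 x / 8 / t + n2 x / 8 / t by field; rewrite gt_eqF.
by rewrite lerD2r ler_pM2r ?invr_gt0// ler_pM2r.
Qed.

End heat_kernel_integral.

Lemma compact_bound (T : topologicalType) (R : realType) (f : T -> R) (S : set T) :
  compact S -> {within S, continuous f} -> exists2 M, 0 <= M & forall x, S x -> f x <= M.
Proof.
move=> cS cf; have [/set0P Sx|S0] := pselect (S != set0); last first.
  exists 0 => // x Sx; exfalso; apply: S0; apply/set0P; by exists x.
have [x0 h1 h2] := compact_EVT_max Sx cS cf.
exists (Num.max 0 (f x0)) => [|x xS]; first by rewrite le_max lexx.
by rewrite le_max h2 ?orbT// inE.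
Qed.

Section nbhs_n2.
Variables (R : realType) (N : nat).
Notation X := 'rV[R]_N.

Lemma nbhs_n2 (a : X) (P : set X) : nbhs a P ->
  exists2 r : R, 0 < r & forall x, n2 (x - a) <= r -> P x.
Proof.
move=> /nbhs_ballP[e /= e0 H]; exists (e ^+ 2 / 2); first by rewrite divr_gt0 ?exprn_gt0.
move=> x xr; apply: H; split=> // i0 i; rewrite (ord1 i0) /ball/=.
rewrite -(ltr_pXn2r (ltn0Sn 1)) ?nnegrE ?normr_ge0 ?(ltW e0)// real_normK ?num_real//.
have := coord_le_n2 (x - a) i; rewrite !mxE -sqrrN opprB => h.
have e20 : 0 < e ^+ 2 by rewrite exprn_gt0.
by move: h xr; set z := _ ^+ 2 => h xr; lra.
Qed.

End nbhs_n2.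

(** * The initial trace *)

Section dirac.
Variables (R : realType) (N : nat) (Omega : set 'rV[R]_N) (a : 'rV[R]_N).
Notation X := 'rV[R]_N.
Notation Y := (N.-tuple (measurableTypeR R)).
Variables (u : X * R -> R) (K T r0 : R).
Hypotheses (Omega_open : open Omega) (Omega_a : Omega a).
Hypotheses (K_ge0 : 0 <= K) (T_gt0 : 0 < T) (r0_gt0 : 0 < r0).
Hypothesis u_cont : forall t x, 0 < t < T -> Omega x -> {for x, continuous (fun x => u (x, t))}.
Hypothesis u_near : forall e : R, 0 < e -> exists2 tau : R, 0 < tau & forall x t,
  0 < t <= tau -> n2 (x - a) <= r0 ->
  `|u (x, t) - K * heat_kernel (x - a) t| <= e * heat_kernel (x - a) t.
Hypothesis u_far : forall (C : set X) (e : R), compact C -> C `<=` Omega -> ~ C a -> 0 < e ->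
  exists2 tau : R, 0 < tau & forall x t, 0 < t <= tau -> C x -> `|u (x, t)| <= e.

(** The difference between the integrand and K zeta(a) times the kernel is dominated by the sum G of
    three terms, each of integral at most e / 4: a small multiple of the kernel near a, by [u_near]
    and continuity of zeta; a small multiple of the indicator of a cube on the rest of the support,
    by [u_far]; and a small multiple of the kernel at time 2 t for the tail. *)
Theorem initial_dirac_of_near : initial_dirac Omega u K a.
Proof.
move=> zeta [czeta cS SO]; set S := closure _ in cS SO.
have zS x : zeta x != 0 -> S x by move=> h; apply: subset_closure.
have [M M0 HM] : exists2 M, 0 <= M & forall x, `|zeta x| <= M.
  have cz : continuous (fun x => `|zeta x|).
    by move=> x; apply: (@continuous_comp _ _ _ zeta (fun y : R => `|y|)); [exact: czeta|exact: norm_continuous].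
  have [M M0 HM] := compact_bound cS (continuous_subspaceT cz).
  exists M => // x; have [->|/zS/HM//] := eqVneq (zeta x) 0; by rewrite normr0.
have [B B0 HB] := compact_bound cS (continuous_subspaceT (@n2_continuous R N)).
pose L := B + 1; have L0 : 0 < L by rewrite ltr_wpDl.
have SL x i : S x -> `|x 0 i| <= L.
  move=> /HB h; have := coord_le_n2 x i; have := sqr_ge0 (`|x 0 i| - 1).
  rewrite sqrrB expr1n mulr1 real_normK ?num_real// -mulr_natl /L.
  by move: h; set w := `|_|; set z := _ ^+ 2; lra.
have [mb b0 Ib] := @box_integral R N L L0.
set bx := (X in measurable_fun _ X) in mb b0 Ib.
have bx1 x y : x = row_of_tuple y -> S x -> bx y = 1.
  move=> xE xS; rewrite /bx big1// => i _; rewrite indicE mem_set//= in_itv/=.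
  by have := SL x i xS; rewrite xE mxE ler_norml.
apply/cvgrPdist_le => e e0.
pose e1 := e / (4 * (K + M + 1)).
have KM0 : 0 < K + M + 1 by rewrite ltr_pwDr// addr_ge0.
have e10 : 0 < e1 by rewrite divr_gt0// mulr_gt0.
have : nbhs a (Omega `&` [set x | `|zeta a - zeta x| <= e1]).
  apply: filterI; first by move: Omega_open; rewrite openE => /(_ a Omega_a).
  by have := czeta a; move/cvgrPdist_le => /(_ e1 e10).
move=> /nbhs_n2[r' r'0 Hr'].
pose r1 := Num.min r' r0; have r1r' : r1 <= r' by rewrite ge_min lexx.
have r1r0 : r1 <= r0 by rewrite ge_min lexx orbT.
have r10 : 0 < r1 by rewrite lt_min r'0.
have [tau1 tau10 H1] := u_near e10.
pose C : set X := S `&` [set x | r1 <= n2 (x - a)].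
have cC : compact C.
  apply: compact_closedI => //.
  apply: (@closed_comp _ _ (fun x : X => n2 (x - a)) [set y | r1 <= y]); last exact: closed_ge.
  move=> x _; apply: (@continuous_comp _ _ _ (fun x : X => x - a) (@n2 R N)); last exact: n2_continuous.
  have h1 : (@id X) @ nbhs x --> x by exact: cvg_id.
  exact: (cvgB h1 (cvg_cst a)).
have CO : C `<=` Omega by move=> x [/SO].
have Ca : ~ C a.
  by move=> [_ /=]; rewrite subrr n2_0 leNgt r10.
pose W := (2 * L) ^+ N; have W0 : 0 < W by rewrite exprn_gt0// mulr_gt0.
pose e2 := e / (4 * (M + 1) * W).
have M10 : 0 < M + 1 by rewrite ltr_wpDl.
have e20 : 0 < e2 by rewrite divr_gt0// !mulr_gt0.
have [tau2 tau20 H2] := u_far cC CO Ca e20.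
pose Q := K * M * 2 `^ (N%:R / 2) + 1.
have Q0 : 0 < Q by rewrite ltr_wpDl// !mulr_ge0// powR_ge0.
have e30 : 0 < e / (4 * Q) by rewrite divr_gt0// mulr_gt0.
have r80 : 0 < r1 / 8 by rewrite divr_gt0.
have [tau3 tau30 H3] := expR_small r80 e30.
near=> t.
have t0 : 0 < t by near: t; exact: nbhs_right_gt.
have tT : t < T by near: t; exact: nbhs_right_lt.
have t1 : t <= tau1 by apply: ltW; near: t; exact: nbhs_right_lt.
have t2 : t <= tau2 by apply: ltW; near: t; exact: nbhs_right_lt.
have t3 : t <= tau3 by apply: ltW; near: t; exact: nbhs_right_lt.
have t20 : 0 < 2 * t by rewrite mulr_gt0.
pose Z t (y : Y) := heat_kernel (row_of_tuple y - a) t.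
have Z0 s y : 0 < s -> 0 <= Z s y by move=> s0; exact/ltW/heat_kernel_gt0.
have [iZ1 IZ1] := ge0_integrable (measurable_heat_kernel a t0) (fun y => Z0 t y t0) (integral_heat_kernel a t0).
have [iZ2 IZ2] := ge0_integrable (measurable_heat_kernel a t20) (fun y => Z0 _ y t20) (integral_heat_kernel a t20).
have [ib Ib'] := ge0_integrable mb b0 Ib.
rewrite -/(Z t) in iZ1 IZ1; rewrite -/(Z (2 * t)) in iZ2 IZ2.
pose c1 := e / 4; pose c2 := e2 * M; pose c3 := K * M * (2 `^ (N%:R / 2) * expR (- (r1 / 8 / t))).
pose G (y : Y) := c1 * Z t y + c2 * bx y + c3 * Z (2 * t) y.
have mT : measurable [set: Y] by exact: measurableT.
have iZl (k : R) (h : Y -> R) : (lebesgueN R N).-integrable [set: Y] (EFin \o h) ->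
    (lebesgueN R N).-integrable [set: Y] (EFin \o (fun y => k * h y)).
  move=> ih; rewrite (_ : _ \o _ = (fun y => k%:E * (EFin \o h) y)%E); last by apply/funext => y /=; rewrite EFinM.
  exact: integrableZl.
have iD (h1 h2 : Y -> R) : (lebesgueN R N).-integrable [set: Y] (EFin \o h1) ->
    (lebesgueN R N).-integrable [set: Y] (EFin \o h2) ->
    (lebesgueN R N).-integrable [set: Y] (EFin \o (fun y => h1 y + h2 y)).
  move=> ih1 ih2; rewrite (_ : _ \o _ = (EFin \o h1) \+ (EFin \o h2))%E; last by apply/funext => y /=; rewrite EFinD.
  exact: integrableD.
have iG : (lebesgueN R N).-integrable [set: Y] (EFin \o G).
  by apply: (iD (fun y => c1 * Z t y + c2 * bx y)); [apply: iD|]; apply: iZl.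
have IG : \int[lebesgueN R N]_y G y = c1 + c2 * W + c3.
  rewrite /G (RintegralD mT (f1 := fun y => c1 * Z t y + c2 * bx y)); last 2 first.
  - by apply: iD; apply: iZl.
  - exact: iZl.
  rewrite (RintegralD mT); [|exact: iZl|exact: iZl].
  have E1 : \int[lebesgueN R N]_y (c1 * Z t y) = c1 by rewrite (RintegralZl _ mT iZ1) IZ1 mulr1.
  have E2 : \int[lebesgueN R N]_y (c2 * bx y) = c2 * W by rewrite (RintegralZl _ mT ib) Ib'.
  have E3 : \int[lebesgueN R N]_y (c3 * Z (2 * t) y) = c3 by rewrite (RintegralZl _ mT iZ2) IZ2 mulr1.
  by rewrite E1 E2 E3.
rewrite distrC /integral_on.
have mD : measurable (@row_of_tuple R N @^-1` Omega : set Y) by exact: measurable_row_open.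
have mf : measurable_fun (@row_of_tuple R N @^-1` Omega : set Y)
    (fun y : Y => u (row_of_tuple y, t) * zeta (row_of_tuple y)).
  apply: (measurable_row_continuous (h := fun x => u (x, t) * zeta x)) => // x xO.
  have tI : 0 < t < T by rewrite t0.
  exact: (cvgM (u_cont tI xO) (czeta x)).
have H := @Rintegral_close _ Y R (lebesgueN R N) _ _ (Z t) G (K * zeta a) mD mf iZ1 iG.
rewrite IZ1 mulr1 IG in H; apply: (le_trans (H _)).
  have pt (x : X) : n2 (x - a) <= r1 -> `|u (x, t) * zeta x - K * zeta a * heat_kernel (x - a) t| <=
      e / 4 * heat_kernel (x - a) t.
    move=> xr; have hk0 := heat_kernel_gt0 (x - a) t0.
    have [xO /= zx] := Hr' x (le_trans xr r1r').
    have ux := H1 x t (introT andP (conj t0 t1)) (le_trans xr r1r0).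
    move: (heat_kernel (x - a) t) hk0 ux => w hk0 ux.
    rewrite (_ : _ - _ = (u (x, t) - K * w) * zeta x +
      K * w * (zeta x - zeta a)); last by ring.
    apply: (le_trans (ler_normD _ _)); rewrite !normrM (ger0_norm K_ge0) (ger0_norm (ltW hk0)).
    apply: (@le_trans _ _ (e1 * w * M + K * w * e1)).
      apply: lerD; first by apply: ler_pM.
      by apply: ler_wpM2l; [rewrite mulr_ge0// ltW|rewrite distrC].
    rewrite (_ : _ + _ = e1 * (K + M) * w); last by ring.
    rewrite ler_pM2r// /e1.
    have -> : e / (4 * (K + M + 1)) * (K + M) = e / 4 * ((K + M) / (K + M + 1)) by field; rewrite gt_eqF.
    by rewrite ger_pMr ?divr_gt0// ler_pdivrMr// mul1r lerDl.
  move=> y; pose x := row_of_tuple y.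
  have c20 : 0 <= c2 * bx y by rewrite mulr_ge0 ?b0// mulr_ge0// ltW.
  have c30 : 0 <= c3 by rewrite !mulr_ge0 ?powR_ge0 ?expR_ge0.
  have c3Z : 0 <= c3 * Z (2 * t) y by rewrite mulr_ge0 ?Z0.
  have c1Z : 0 <= c1 * Z t y by rewrite mulr_ge0 ?Z0 ?divr_ge0 ?(ltW e0).
  rewrite patchE /G; have [xr|xr] := leP (n2 (x - a)) r1.
    have [xO _] := Hr' x (le_trans xr r1r').
    rewrite mem_set//; apply: (le_trans (pt x xr)); rewrite -addrA lerDl.
    exact: addr_ge0.
  apply: (le_trans (ler_normB _ _)); apply: (@le_trans _ _ (c2 * bx y + c3 * Z (2 * t) y)); last first.
    by rewrite -addrA lerDr.
  apply: lerD.
    case: ifPn => _; last by rewrite normr0.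
    have [z0|/zS xS] := eqVneq (zeta x) 0; first by rewrite z0 mulr0 normr0.
    rewrite (bx1 x y)// mulr1 normrM; apply: ler_pM => //.
    by apply: H2; rewrite ?t0//; split=> //=; exact: ltW.
  rewrite (normrM (K * _)) (normrM K) (ger0_norm K_ge0) (ger0_norm (Z0 t y t0)) /c3 -[leRHS]mulrA.
  have A1 : 0 <= K * `|zeta a| by rewrite mulr_ge0.
  have A2 : K * `|zeta a| <= K * M by exact: ler_wpM2l.
  have A3 : Z t y <= 2 `^ (N%:R / 2) * expR (- (r1 / 8 / t)) * Z (2 * t) y.
    by apply: heat_kernel_far => //; exact: ltW.
  exact: (ler_pM A1 (Z0 t y t0) A2 A3).
have c2W : c2 * W <= e / 4.
  rewrite /c2 /e2.
  have -> : e / (4 * (M + 1) * W) * M * W = e / 4 * (M / (M + 1)) by field; rewrite !gt_eqF.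
  rewrite ger_pMr ?divr_gt0// ler_pdivrMr// mul1r lerDl//.
have c3e : c3 <= e / 4.
  have h3 := H3 t t0 t3.
  have : K * M * 2 `^ (N%:R / 2) * expR (- (r1 / 8 / t)) <= Q * (e / (4 * Q)).
    apply: ler_pM => //; rewrite ?expR_ge0 ?mulr_ge0 ?powR_ge0//.
    by rewrite /Q lerDl.
  rewrite (_ : Q * (e / (4 * Q)) = e / 4); last by field; rewrite gt_eqF.
  by rewrite /c3 mulrA.
rewrite /c1; move: c2W c3e e0; clear -Omega_open Omega_a K_ge0 T_gt0 r0_gt0 u_cont u_near u_far.
by lra.
Unshelve. all: by end_near. Qed.

End dirac.

Section to_origin.
Variables (R : realType) (N : nat).
Notation X := 'rV[R]_N.

Lemma near_to_origin (a : X) (r : R) (P : X * R -> Prop) : 0 < r ->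
  (exists2 tau : R, 0 < tau & forall x t, 0 < t <= tau -> n2 (x - a) <= r -> P (x, t)) ->
  \forall p \near to_origin a, P p.
Proof.
move=> r0 [tau tau0 H].
have n1 : \forall p \near (a, 0 : R), p.2 < tau.
  by have := @continuous_snd R N (a, 0); move/cvgr_lt; apply.
have n2a : \forall p \near (a, 0 : R), n2 (p.1 - a) < r.
  have := @continuous_n2_sub R N a (a, 0); move/cvgr_lt; apply.
  by rewrite /= subrr n2_0.
rewrite /to_origin; near=> p.
have p2 : p.2 < tau by near: p; apply: cvg_within; exact: n1.
have p1 : n2 (p.1 - a) < r by near: p; apply: cvg_within; exact: n2a.
have p0 : 0 < p.2 by near: p; exact: withinT.
have -> : p = (p.1, p.2) by case: (p).
by apply: H; [rewrite p0 ltW|exact: ltW].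
Unshelve. all: by end_near. Qed.

Lemma cvg_to_origin (a : X) (r : R) (h : X * R -> R) (l : R) : 0 < r ->
  (forall e : R, 0 < e -> exists2 tau : R, 0 < tau & forall x t, 0 < t <= tau -> n2 (x - a) <= r ->
    `|l - h (x, t)| <= e) -> h @ to_origin a --> l.
Proof.
move=> r0 H; apply/cvgrPdist_le => e e0.
exact: near_to_origin (H e e0).
Qed.

End to_origin.

(** * Continuity, vanishing and heat operator of [u] *)

Section solution.
Variables (R : realType) (N : nat) (Omega : set 'rV[R]_N) (a : 'rV[R]_N) (T alpha q : R).
Notation X := 'rV[R]_N.
Variable u : X * R -> R.
Hypotheses (Omega_open : open Omega) (T_gt0 : 0 < T) (q_gt1 : 1 < q).
Hypothesis u_cont : {within (Omega `*` `[0, T]) `\ (a, 0), continuous u}.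
Hypothesis u_gt0 : forall x t, (Omega `*` `]0, T[) (x, t) -> 0 < u (x, t).
Hypothesis u_sol : solves alpha q (Omega `*` `]0, T[) u.
Hypothesis u_init : forall x, Omega x -> x <> a -> u (x, 0) = 0.

Lemma interior_continuous x t : Omega x -> 0 < t < T -> {for (x, t), continuous u}.
Proof.
move=> Ox /andP[t0 tT]; pose D := (Omega `*` `[0, T]) `\ (a, 0 : R).
have DE : D (x, t).
  split; first by split=> //=; rewrite in_itv/= !ltW.
  by move=> [_ tE]; move: t0; rewrite tE ltxx.
have int : D° (x, t).
  have n1 : \forall p \near (x, t), Omega p.1.
    have h : \forall y \near x, Omega y by move: Omega_open; rewrite openE => /(_ x Ox).
    have k : (fun p : X * R => p.1) @ nbhs (x, t) --> x by exact: cvg_fst.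
    exact: (k _ h).
  have n3 : \forall p \near (x, t), 0 < p.2 by have := @continuous_snd R N (x, t); move/cvgr_gt; apply.
  have n4 : \forall p \near (x, t), p.2 < T by have := @continuous_snd R N (x, t); move/cvgr_lt; apply.
  rewrite /interior; near=> p; split.
    split=> /=; first by near: p.
    by rewrite in_itv/=; apply/andP; split; apply: ltW; near: p.
  have p0 : 0 < p.2 by near: p.
  by move=> pE; move: p0; rewrite pE ltxx.
have := (subspace_continuousP D u).1 u_cont (x, t) DE.
by rewrite (within_interior int).
Unshelve. all: by end_near. Qed.

(** Near each (x, 0) with x in C, u is small by continuity up to t = 0; compactness of C makes the
    time uniform. *)
Lemma vanish_far (C : set X) (e : R) : compact C -> C `<=` Omega -> ~ C a -> 0 < e ->
  exists2 tau : R, 0 < tau & forall x t, 0 < t <= tau -> C x -> `|u (x, t)| <= e.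
Proof.
move=> cC CO Ca e0; pose D := (Omega `*` `[0, T]) `\ (a, 0 : R).
pose P (t : R) (x : X) := D (x, t) -> `|u (x, t)| <= e.
have H x : C x -> \forall x' \near x & t \near (0 : R), P t x'.
  move=> Cx; have Dx : D (x, 0).
    split; first by split; [exact: CO|rewrite /= in_itv/= lexx ltW].
    by move=> [xa]; apply: Ca; rewrite -xa.
  have := (subspace_continuousP D u).1 u_cont (x, 0) Dx.
  rewrite u_init; [|exact: CO|by move=> xa; apply: Ca; rewrite -xa].
  move/cvgrPdist_le => /(_ e e0) K.
  have {}K : \forall p \near (x, 0 : R), D p -> `|0 - u p| <= e by exact: K.
  suff : \forall p \near (x, 0 : R), P p.2 p.1 by [].
  by apply: filterS K => -[y t] /= h Dy; have := h Dy; rewrite sub0r normrN.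
have := (compact_near_coveringP C).1 cC R (nbhs (0 : R)) P (nbhs_filter _) H => K.
have /nbhs_ballP[r /= r0 Hr] := K.
exists (Num.min (r / 2) (T / 2)); first by rewrite lt_min !divr_gt0.
move=> x t /andP[t0]; rewrite le_min => /andP[t1 t2] Cx.
have := Hr t; rewrite /ball/= sub0r normrN gtr0_norm// => K1.
have tr : t < r by move: t1 r0; lra.
apply: (K1 tr x Cx); split.
  by split; [exact: CO|rewrite /= in_itv/= (ltW t0)/=; have := T_gt0; move: t2; lra].
by move=> [xa _]; apply: Ca; rewrite -xa.
Qed.

Lemma solution_heat x t : Omega (x + a) -> 0 < t < T ->
  heat (fun x t => u (x + a, t)) x t (- absorb alpha q t (u (x + a, t))).
Proof.
move=> Ox tI; have Q : (Omega `*` `]0, T[) (x + a, t) by split=> //=; rewrite in_itv/=.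
have [du lu eq] := u_sol Q; have u0 := u_gt0 Q.
exists (derive1 (fun s : R => u (x + a, s)) t), (fun i => 'D_(ebasis R i) ('D_(ebasis R i) (fun y => u (y, t))) (x + a)).
split.
- by rewrite derive1E; exact: derivableP.
- move=> i; rewrite /sd.
  rewrite (_ : (fun h : R => u (x + h *: ebasis R i + a, t)) = (fun h => u (x + a + h *: ebasis R i, t))); last first.
    by apply/funext => h; rewrite addrAC.
  exact: (laplacian_sd (f := fun y => u (y, t))).
- have : u (x + a, t) `^ (q - 1) * u (x + a, t) = u (x + a, t) `^ q.
    by rewrite mulrC mulr_powRB1 ?(ltW u0)// (lt_trans ltr01).
  rewrite -/(laplacian _ _) => uq; move: eq; rewrite (gtr0_norm u0) uq /absorb.
  move: (derive1 _ _) (laplacian _ _) (_ * _) => d1 d2 d3.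
  by lra.
Qed.

End solution.

(** * Assembling the dichotomy *)

Lemma gauss_sol_shrink (R : realType) (N : nat) (alpha q rho T T' C : R) (f : 'rV[R]_N -> R -> R) :
  T' <= T -> gauss_sol alpha q rho T C f -> gauss_sol alpha q rho T' C f.
Proof.
move=> TT Hf x t /andP[t0 tT]; apply: Hf; by rewrite t0 (le_trans tT).
Qed.

Theorem theoremB (R : realType) (N : nat) (N_gt0 : (0 < N)%N)
    (Omega : set 'rV[R]_N) (Omega_open : open Omega)
    (Omega_connected : connected Omega)
    (a : 'rV[R]_N) (Omega_a : Omega a) (T : R) (T_gt0 : 0 < T)
    (alpha q : R) (alpha_gt : -1 < alpha)
    (q_gt1 : 1 < q) (q_lt : q < q_crit N alpha)
    (V : 'rV[R]_N -> R) (V_profile : is_profile alpha q V)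
    (u : 'rV[R]_N * R -> R)
    (u_C1 : C1_on (Omega `*` `]0, T[) u)
    (u_cont : {within (Omega `*` `[0, T]) `\ (a, 0), continuous u})
    (u_gt0 : forall x t, (Omega `*` `]0, T[) (x, t) -> 0 < u (x, t))
    (u_sol : solves alpha q (Omega `*` `]0, T[) u)
    (u_init : forall x, Omega x -> x <> a -> u (x, 0) = 0) :
  (exists k : R, [/\ 0 <= k, initial_dirac Omega u k a &
     (fun p : 'rV[R]_N * R => u p / heat_kernel (p.1 - a) p.2)
       @ to_origin a --> k])
  \/
  (fun p : 'rV[R]_N * R => u p / very_singular alpha q V (p.1 - a) p.2)
    @ to_origin a --> (1 : R).
Proof.
have gN := decay_exp_gt_half N_gt0 q_gt1 q_lt.
have g0 := decay_exp_gt0 alpha_gt q_gt1.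
set g := decay_exp alpha q in gN g0.
have [rO rO0 HrO] : exists2 r : R, 0 < r & forall x, n2 (x - a) <= r -> Omega x.
  by apply: nbhs_n2; move: Omega_open; rewrite openE => /(_ a Omega_a).
pose f (x : 'rV[R]_N) t := u (x + a, t).
have OA x : n2 x <= rO -> Omega (x + a) by move=> xr; apply: HrO; rewrite addrK.
have T20 : 0 < T / 2 by rewrite divr_gt0.
have TI t : 0 < t <= T / 2 -> 0 < t < T.
  by move=> /andP[t0 tT]; rewrite t0/=; move: tT T_gt0; clear; lra.
have uc x t : Omega x -> 0 < t < T -> {for (x, t), continuous u}.
  exact: interior_continuous.
have far (S : set 'rV[R]_N) (e : R) : compact S -> S `<=` Omega -> ~ S a -> 0 < e ->
    exists2 tau : R, 0 < tau & forall x t, 0 < t <= tau -> S x -> `|u (x, t)| <= e.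
  exact: (vanish_far T_gt0 u_cont u_init).
have [C C0 fS] : exists2 C, 0 <= C & gauss_sol alpha q (rO / 4) (T / 2) C f.
  apply: (gaussian_bound alpha_gt q_gt1 rO0 T20).
  - move=> x t tI xr; have xO := OA x xr; split.
    + apply: (@continuous_comp _ _ _ (fun p : 'rV[R]_N * R => (p.1 + a, p.2)) u); last exact: uc (TI t tI).
      have h1 : (fun p : 'rV[R]_N * R => p.1) @ nbhs (x, t) --> x by exact: cvg_fst.
      have h2 : (fun p : 'rV[R]_N * R => p.2) @ nbhs (x, t) --> t by exact: cvg_snd.
      exact: (cvg_pair (cvgD h1 (cvg_cst a)) h2).
    + by apply: u_gt0; split=> //=; rewrite in_itv/= TI.
    + exact: (solution_heat q_gt1 u_gt0 u_sol xO (TI t tI)).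
  - move=> d e d0 e0.
    pose K : set 'rV[R]_N := [set x | d <= n2 (x - a) <= rO].
    have cn : continuous (fun x : 'rV[R]_N => n2 (x - a)).
      move=> x; apply: (@continuous_comp _ _ _ (fun x : 'rV[R]_N => x - a) (@n2 R N)); last exact: n2_continuous.
      have h1 : (@id 'rV[R]_N) @ nbhs x --> x by exact: cvg_id.
      exact: (cvgB h1 (cvg_cst a)).
    have cK : compact K.
      pose G (x : 'rV[R]_N) (t : R) := Num.max (Num.max (n2 x - rO) (d - n2 x)) (- t).
      have GE x t : G x t <= 0 = [&& n2 x <= rO, d <= n2 x & 0 <= t].
        by rewrite /G !ge_max !subr_le0 oppr_le0 andbA.
      (* Compactness of the closed shell K is obtained by translating a slice at time 0 of a set
         covered by [maxprin_compact]. *)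
      rewrite (_ : K = (fun p : 'rV[R]_N * R => p.1 + a) @` [set p | G p.1 p.2 <= 0 /\ p.2 <= 0]).
        apply: continuous_compact.
          apply: continuous_subspaceT => p.
          have h1 : (fun p : 'rV[R]_N * R => p.1) @ nbhs p --> p.1 by exact: cvg_fst.
          exact: (cvgD h1 (cvg_cst a)).
        apply: (@maxprin_compact R N G rO 0).
          move=> p; apply: continuous_maxr; [apply: continuous_maxr|].
          - by apply: cvgB; [exact: continuous_n2p|exact: cvg_cst].
          - by apply: cvgB; [exact: cvg_cst|exact: continuous_n2p].
          - by apply: cvgN; exact: continuous_snd.
        by move=> x t; rewrite GE => /and3P[].
      apply/seteqP; split=> [x /andP[xd xr]|_ [[x t] /= [+ _] <-]].
        by exists (x - a, 0); rewrite /= ?GE ?xd ?xr ?lexx// subrK.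
      by rewrite GE => /and3P[h1 h2 _]; rewrite /K /= addrK h2.
    have KO : K `<=` Omega by move=> x /andP[_]; exact: HrO.
    have Ka : ~ K a.
      by rewrite /K /= subrr n2_0 leNgt d0.
    have [tau tau0 Ht] := far K e cK KO Ka e0.
    exists tau => // x t tI xI; apply: (le_trans (ler_norm _)).
    by apply: Ht => //; rewrite /K /= addrK.
have [Cv Cv0 vS] := very_singular_gauss_sol alpha_gt q_gt1 V_profile rO0 T20.
pose rho := rO / 4; have rho0 : 0 < rho by rewrite divr_gt0.
rewrite -/rho in fS vS.
have c00 := @c0_gt0 R.
pose T' := Num.min (T / 2) (c0 * rho / g).
have T'0 : 0 < T' by rewrite lt_min T20 divr_gt0// mulr_gt0.
have T'T : T' <= T / 2 by rewrite ge_min lexx.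
have TM : T' <= c0 * rho / g by rewrite ge_min lexx orbT.
clearbody T'.
have {}fS := gauss_sol_shrink T'T fS; have {}vS := gauss_sol_shrink T'T vS.
have c10 : 0 < c0 * (1 - 4 * c0) :> R by rewrite mulr_gt0// /c0; lra.
pose R2 := (g + 1) / (c0 * (1 - 4 * c0)).
have R2_ge : g + 1 <= c0 * (1 - 4 * c0) * R2 by rewrite /R2 mulrC divfK// gt_eqF.
have crho : 0 < c0 * rho by rewrite mulr_gt0.
have crho_le : c0 * rho <= rho by rewrite ger_pMl// /c0 invf_le1 ?ler1n ?ltr0n.
have fE x t : u (x, t) = f (x - a) t by rewrite /f subrK.
have [bdd|unb] := pselect (exists L : R, exists2 tau, 0 < tau & forall x t, 0 < t <= tau ->
    n2 x <= R2 * t -> f x t <= L * t `^ (- (N%:R / 2))).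
  left; have [K K0 HK] := bounded_asymptotics alpha_gt q_gt1 gN rho0 T'0 TM R2_ge fS C0 bdd.
  pose c := (4 * pi) `^ (- (N%:R / 2)) : R.
  have c_gt0 : 0 < c by rewrite powR_gt0// mulr_gt0// pi_gt0.
  have near e : 0 < e -> exists2 tau : R, 0 < tau & forall x t, 0 < t <= tau ->
      n2 (x - a) <= c0 * rho ->
      `|u (x, t) - K / c * heat_kernel (x - a) t| <= e * heat_kernel (x - a) t.
    move=> e0; have ec : 0 < e * c by rewrite mulr_gt0.
    have [tau tau0 Ht] := HK _ ec; exists tau => // x t tI xr.
    have [t0 _] := andP tI; rewrite fE (heat_kernel_gauss _ t0) -/c.
    have := Ht (x - a) t tI xr; move: (gauss _ _ _ _ _ _) => w.
    by rewrite (_ : K / c * (c * w) = K * w) ?(mulrA e)//; field; rewrite gt_eqF.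
  (* K multiplies the kernel without its constant c = (4 pi)^(-N/2), hence the division. *)
  exists (K / c); split.
  - by rewrite divr_ge0// ltW.
  - apply: (@initial_dirac_of_near R N Omega a u (K / c) T (c0 * rho)) => //.
    + by rewrite divr_ge0// ltW.
    + move=> t x tI xO; apply: (@continuous_comp _ _ _ (fun x : 'rV[R]_N => (x, t)) u); last exact: uc.
      have h1 : (@id 'rV[R]_N) @ nbhs x --> x by exact: cvg_id.
      exact: (cvg_pair h1 (cvg_cst t)).
  - apply: (cvg_to_origin crho) => e e0; have [tau tau0 Ht] := near e e0.
    exists tau => // x t tI xr; have [t0 _] := andP tI; have := Ht x t tI xr.
    have hk0 := heat_kernel_gt0 (x - a) t0; rewrite /=.
    move: (heat_kernel _ _) hk0 => w w0 h.
    rewrite distrC (_ : _ - _ = (u (x, t) - K / c * w) / w); last by field; rewrite !gt_eqF.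
    by rewrite normrM normfV (gtr0_norm w0) ler_pdivrMr.
right.
have unb' L tau : 0 < L -> 0 < tau -> exists x t, [/\ 0 < t <= tau,
    n2 x <= R2 * t & L * t `^ (- (N%:R / 2)) < f x t].
  move=> L0 tau0; apply: contrapT => H; apply: unb; exists L, tau => // x t tI xR.
  by rewrite leNgt; apply/negP => h; apply: H; exists x, t.
have flow := lower_of_unbounded alpha_gt q_gt1 gN rho0 T'0 TM R2_ge fS C0 unb'.
have vlow := very_singular_lower V_profile.
(* The ratio bound is used in both directions; the lower bound it requires comes from positivity of
   the profile for v and from unboundedness for f. *)
have fv := sol_ratio_le alpha_gt q_gt1 gN rho0 T'0 TM R2_ge fS vS C0 vlow.
have vf := sol_ratio_le alpha_gt q_gt1 gN rho0 T'0 TM R2_ge vS fS Cv0 flow.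
apply: (cvg_to_origin crho) => e e0.
have [tau1 tau10 H1] := fv e e0; have [tau2 tau20 H2] := vf e e0.
exists (Num.min T' (Num.min tau1 tau2)); first by rewrite !lt_min T'0 tau10.
move=> x t /andP[t0]; rewrite !le_min => /and3P[t1 t2 t3] xr; rewrite /= fE.
have h1 := H1 (x - a) t (introT andP (conj t0 t2)) xr.
have h2 := H2 (x - a) t (introT andP (conj t0 t3)) xr.
have [_ f0 _ _] := fS (x - a) t (introT andP (conj t0 t1)) (le_trans xr crho_le).
have [_ v0 _ _] := vS (x - a) t (introT andP (conj t0 t1)) (le_trans xr crho_le).
move: (f _ _) (very_singular _ _ _ _ _) f0 v0 h1 h2 => F W F0 W0 h1 h2.
have a1 : F / W <= 1 + e by rewrite ler_pdivrMr.
(* Uses (1 - e) (1 + e) <= 1 when e <= 1; for larger e the left side is nonpositive. *)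
have a2 : 1 - e <= F / W.
  rewrite ler_pdivlMr//; have [e1|/ltW e1] := leP e 1.
    have : (1 - e) * W <= (1 - e) * ((1 + e) * F) by rewrite ler_wpM2l// subr_ge0.
    have : 0 <= e * e * F by rewrite !mulr_ge0// ltW.
    by clear; lra.
  by apply: le_trans (ltW F0); rewrite pmulr_lle0// subr_le0.
by rewrite ler_norml; apply/andP; split; move: a1 a2; clear; lra.
Qed.
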